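(* Let $n\ge 3$, let $S$ be an $n$-gon, and fix an index set $I$ for the triangles of ideal triangulations of $S$ (so $|I|=n-2$). Let $\mathrm{Vec}$ be the category of finite dimensional complex vector spaces and linear maps. The following assignment yields a well-defined projective functor from the sane LD-groupoid of $S$ to $\mathrm{Vec}$. (Objects) For a sane LD-triangulation of $S$ and $t\in I$, let $\lambda_{t_1},\lambda_{t_2},\lambda_{t_3}$ be the edge-labels of the sides of the triangle labeled by $t$, in this counterclockwise order, with $\lambda_{t_3}$ the label of the side opposite the dot of $t$. To this sane LD-triangulation assign the vector space $\bigotimes_{t\in I} M_{\lambda_{t_1},\lambda_{t_2}}^{\lambda_{t_3}}$. (Elementary morphisms) (i) To $\mathbf{A}^{\epsilon_I}$, $\epsilon_I=(\epsilon_t)_{t\in I}\in\{\pm1\}^I$, assign $\bigotimes_{t\in I}\mathbf{A}_t^{\epsilon_t}$, where $\mathbf{A}_t^{+1}$ is the map $\mathbf{A}_{\lambda_{t_1},\lambda_{t_2}}^{\lambda_{t_3}}: M_{\lambda_{t_1},\lambda_{t_2}}^{\lambda_{t_3}}\to M_{\lambda_{t_2},\lambda_{t_3}^*}^{\lambda_{t_1}^*}$ and $\mathbf{A}_t^{-1}$ is the map $(\mathbf{A}_{\lambda_{t_3}^*,\lambda_{t_1}}^{\lambda_{t_2}^*})^{-1}: M_{\lambda_{t_1},\lambda_{t_2}}^{\lambda_{t_3}}\to M_{\lambda_{t_3}^*,\lambda_{t_1}}^{\lambda_{t_2}^*}$. (ii) To $\mathbf{T}_{st}$ assign the operator $$\mathbf{T}_{\lambda_{t_1},\lambda_{t_2},\lambda_{s_2}}: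 M_{\lambda_{s_1},\lambda_{s_2}}^{\lambda_{s_3}}\otimes M_{\lambda_{t_1},\lambda_{t_2}}^{\lambda_{t_3}}\to M_{\lambda_{t_2},\lambda_{s_2}}^{\lambda_{s,t}}\otimes M_{\lambda_{t_1},\lambda_{s,t}}^{\lambda_{s_3}}$$ applied on the $s$-th and $t$-th tensor factors (in this order), where $\lambda_{s,t}:=\lambda_{t_2}\lambda_{s_2}$ is the edge-label of the new diagonal edge. (iii) To $\mathbf{P}_\gamma$ assign the factor permuting operator $\bigotimes_{t\in I}M_{\lambda_{t_1},\lambda_{t_2}}^{\lambda_{t_3}}\to\bigotimes_{t\in I}M_{\lambda_{\gamma^{-1}(t)_1},\lambda_{\gamma^{-1}(t)_2}}^{\lambda_{\gamma^{-1}(t)_3}}$ sending each $t$-th factor to the $\gamma(t)$-th factor. Inverses of elementary morphisms are sent to the inverse operators.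
   Context: **Algebra.** $N$ is a fixed odd positive integer, $q=e^{\pi\sqrt{-1}/N}$. $\mathcal W$ is the Hopf algebra over $\mathbb C$ generated by $X^{\pm1},Y$ with $XY=q^2YX$, $\Delta X=X\otimes X$, $\Delta Y=Y\otimes X+1\otimes Y$, $\epsilon(X)=1$, $\epsilon(Y)=0$, $S(X)=X^{-1}$, $S(Y)=-YX^{-1}$. Representations are finite dimensional complex left $\mathcal W$-modules; tensor products are formed via $\Delta$; a representation is trivial if each $W\in\mathcal W$ acts by $\epsilon(W)\,\mathrm{id}$. **Operators and roots.** $e_0,\dots,e_{N-1}$ is the standard basis of $\mathbb C^N$, indices mod $N$; $Ae_k=q^{2k}e_k$, $Be_k=e_{k+1}$. For each $z\in\mathbb C^\times$ an $N$-th root $z^{1/N}$ is fixed, with $1^{1/N}=1$, $(z^{1/N})^{-1}=(z^{-1})^{1/N}=:z^{-1/N}$, $(-z)^{1/N}=-z^{1/N}$. For $z,w\in\mathbb C^\times$, $m_{z,w}\in\{0,\dots,N-1\}$ is defined by $(zw)^{1/N}=q^{2m_{z,w}}z^{1/N}w^{1/N}$. Subscripts on operators indicate the tensor factors acted on (e.g. $A_2=\mathrm{id}\otimes A$; $O_{ij}$ means a two-factor operator $O$ applied with its first slot at factor $i$ and second slot at factor $j$). **Weights.** A weight is a pair $\lambda=(x,y)\in\mathbb C^2$, non-singular if $x,y\ne0$. Product: $(x,y)(x',y')=(xx',yx'+y')$. For non-singular $\lambda=(x,y)$: dual weight $\lambda^*=(x^{-1},-yx^{-1})$, and $V_\lambda$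 is $\mathbb C^N$ with $X$ acting by $x^{1/N}A$ and $Y$ by $y^{1/N}B$. A sequence of non-singular weights $(\lambda_1,\dots,\lambda_n)$ is regular if $X$ and $Y$ act invertibly on $V_{\lambda_i}\otimes\cdots\otimes V_{\lambda_j}$ for all $i\le j$ (equivalently all products $\lambda_i\cdots\lambda_j$ are non-singular). For a regular pair, $M_{\lambda,\lambda'}^{\lambda\lambda'}$ is $\mathbb C^N$ as a trivial representation. **Cyclic quantum dilogarithm.** For $\mathbf a,\mathbf c\in\mathbb C$ with $\mathbf c^N-\mathbf a^N=1$: $w(\mathbf a,\mathbf c|0)=1$, $w(\mathbf a,\mathbf c|n)=\prod_{j=1}^n(\mathbf c-\mathbf a q^{2j})^{-1}$ ($N$-periodic in $n$). For an operator $C$ with $C^N=\mathrm{id}$, $\Phi^q_{\mathbf a,\mathbf c}(C)$ acts on the $q^{2i}$-eigenspace of $C$ by the scalar $\zeta_{\mathbf a,\mathbf c}w(\mathbf a,\mathbf c|i)$, where $\zeta_{\mathbf a,\mathbf c}$ is a fixed nonzero constant. **$\mathbf F$.** For a regular pair $\lambda=(x,y),\lambda'=(x',y')$, $\mathbf F_{\lambda,\lambda'}=B_2^{-m_{x,x'}}\,\mathbf S\,\Phi^q_{\mathbf a,\mathbf c}(B_1A_2B_2^{-1})$ on $\mathbb C^N\otimes\mathbb C^N$, where $\mathbf S(e_i\otimes e_j)=e_i\otimes e_{i+j}$, $\mathbf a=-\frac{y^{1/N}(x')^{1/N}}{(yx'+y')^{1/N}}$, $\mathbf c=\frac{(y')^{1/N}}{(yx'+y')^{1/N}}$.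 It is a $\mathcal W$-isomorphism $V_\lambda\otimes V_{\lambda'}\to M^{\lambda\lambda'}_{\lambda,\lambda'}\otimes V_{\lambda\lambda'}$. **$\mathbf T$.** For a regular triple $(\lambda,\lambda',\lambda'')$, $\mathbf T_{\lambda,\lambda',\lambda''}: M^{\lambda\lambda'\lambda''}_{\lambda\lambda',\lambda''}\otimes M^{\lambda\lambda'}_{\lambda,\lambda'}\to M^{\lambda'\lambda''}_{\lambda',\lambda''}\otimes M^{\lambda\lambda'\lambda''}_{\lambda,\lambda'\lambda''}$ is the unique invertible linear map with $(\mathbf F_{\lambda,\lambda'\lambda''})_{13}(\mathbf F_{\lambda',\lambda''})_{23}(\mathbf F_{\lambda,\lambda'})_{12}^{-1}(\mathbf F_{\lambda\lambda',\lambda''})_{23}^{-1}=(\mathbf T_{\lambda,\lambda',\lambda''})_{21}$ on $\mathbb C^N\otimes\mathbb C^N\otimes\mathbb C^N$. **$\mathbf A$.** For non-singular $\lambda=(x,y)$ define on $\mathbb C^N$: $C_\lambda e_i=q^{-2i\,m_{y,x^{-1}}}q^{-i(i-1)}e_{-i}$, $D_\lambda e_i=q^{-2i\,m_{y,x^{-1}}}q^{i(i-1)}e_{-i}$. For a regular pair let $I^{\lambda\lambda'}_{\lambda,\lambda'}:M^{\lambda\lambda'}_{\lambda,\lambda'}\to\mathrm{Hom}_{\mathcal W}(V_{\lambda\lambda'},V_\lambda\otimes V_{\lambda'})$ be the isomorphism $(I^{\lambda\lambda'}_{\lambda,\lambda'}f)(v)=\mathbf F^{-1}_{\lambda,\lambda'}(f\otimes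 v)$. Let $\mathbf A^{\mathrm{Hom}}:\mathrm{Hom}_{\mathcal W}(V_{\lambda\lambda'},V_\lambda\otimes V_{\lambda'})\to\mathrm{Hom}_{\mathcal W}(V_{\lambda^*},V_{\lambda'}\otimes V_{(\lambda\lambda')^*})$ be the isomorphism sending $f$ to the $g$ determined by $\sum_j e_j\otimes g(e_j)=(D_{\lambda^*}\otimes\mathrm{id}\otimes C_{\lambda\lambda'})\big(\sum_j f(e_j)\otimes e_j\big)$. Then $\mathbf A^{\lambda\lambda'}_{\lambda,\lambda'}:=(I^{\lambda^*}_{\lambda',(\lambda\lambda')^*})^{-1}\circ\mathbf A^{\mathrm{Hom}}\circ I^{\lambda\lambda'}_{\lambda,\lambda'}:M^{\lambda\lambda'}_{\lambda,\lambda'}\to M^{\lambda^*}_{\lambda',(\lambda\lambda')^*}$ (here $\lambda'(\lambda\lambda')^*=\lambda^*$). **Triangulations and groupoids.** An $n$-gon is (for these purposes) an oriented Euclidean convex polygon with $n$ sides; an ideal triangulation of it is a triangulation by straight segments between vertices (its edges are the $n$ sides and a maximal set of non-crossing diagonals). A dotted ideal triangulation has in addition a distinguished corner (''dot'') in each triangle and a bijective labeling of the triangles by $I$. An LD-triangulation is a dotted ideal triangulation together with a labeling of each edge by a non-singular weight. It is sane if for every triangle, with edge labels $\lambda_1,\lambda_2,\lambda_3$ in counterclockwise order and $\lambda_3$ opposite the dot, one has $\lambda_1\lambda_2=\lambda_3$. The LD-groupoid of $S$ is the category whose objects are all LD-triangulations, with exactly one morphism between any two objects. Elementary morphisms: -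 $\mathbf A^{\epsilon_I}$, $\epsilon_I\in\{\pm1\}^I$: for each $t$, the dot of triangle $t$ moves to the next corner counterclockwise if $\epsilon_t=+1$ and clockwise if $\epsilon_t=-1$. If $t$ has labels $(\lambda_1,\lambda_2,\lambda_3)$ (counterclockwise, $\lambda_3$ opposite the old dot), the labels of these same edges become $(\lambda_1^*,\lambda_2,\lambda_3^* )$ if $\epsilon_t=+1$ and $(\lambda_1,\lambda_2^*,\lambda_3^* )$ if $\epsilon_t=-1$ (the two triangles sharing an edge must give it the same new label). - $\mathbf T_{st}$: triangles $s,t$ are adjacent, forming a quadrilateral with vertices $P_1,P_2,P_3,P_4$ in counterclockwise order and side labels $\lambda_1$ on $P_1P_2$, $\lambda_2$ on $P_2P_3$, $\lambda_3$ on $P_3P_4$, $\lambda_0$ on $P_4P_1$. Before: diagonal $P_1P_3$ labeled $\lambda_4$, $t=P_1P_2P_3$ with dot at $P_2$, $s=P_1P_3P_4$ with dot at $P_3$. After: diagonal $P_2P_4$ labeled $\lambda_5$, $s=P_2P_3P_4$ with dot at $P_3$, $t=P_1P_2P_4$ with dot at $P_2$. Everything else is unchanged. (Between sane LD-triangulations, $\lambda_5=\lambda_2\lambda_3$.) - $\mathbf P_\gamma$, for a permutation $\gamma$ of $I$: changes the label $t$ of each triangle to $\gamma(t)$. The inverses of these are also called elementary morphisms. The sane LD-groupoid of $S$ is the subgroupoid of the LD-groupoid whose objects are the sane LD-triangulations, with a morphism from one object to another if and only if they are connected by a finite sequence of elementary morphisms (through sane LD-triangulations). A projective functor is an assignment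 on objects and morphisms preserving composition up to nonzero multiplicative constants; ''well-defined'' means that the operator assigned to a morphism by composing the operators along a sequence of elementary morphisms representing it does not depend on the sequence, up to a nonzero multiplicative constant. *)

(* Defs.v *)
From mathcomp Require Import all_boot all_order fingroup perm all_algebra.
From mathcomp Require Import all_classical all_reals all_analysis.
From mathcomp Require Import complex.

Set Implicit Arguments.
Unset Strict Implicit.
Unset Printing Implicit Defensive.

Import GRing.Theory.
Local Open Scope ring_scope.

Section LinearAlgebra.
Variable R : realType.
Local Notation C := R[i].

(* The space with basis X. Thus C^N is space 'I_N, the tensor product of
   space X and space Y is space (X * Y), and the tensor product of copies of
   C^N indexed by a finite set J is space {ffun J -> 'I_N}. *)
Definition space (X : finType) : vectType C := {ffun X -> C^o}.

Definition bv (X : finType) (x : X) : space X := [ffun y => (y == x)%:R].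

Definition lin (X : finType) (V : vectType C) (g : X -> V) : 'Hom(space X, V) :=
  linfun (fun v : space X => \sum_x (v x : C) *: g x).

Definition tensv (X Y : finType) (v : space X) (w : space Y) :
    space (X * Y)%type :=
  [ffun p => (v p.1 : C) * (w p.2 : C)].

Definition tensl (X Y X' Y' : finType)
    (f : 'Hom(space X, space X')) (g : 'Hom(space Y, space Y')) :
    'Hom(space (X * Y)%type, space (X' * Y')%type) :=
  lin (fun p => tensv (f (bv p.1)) (g (bv p.2))).

Definition tensA (X Y Z : finType) (v : space (X * Y * Z)%type) :
    space (X * (Y * Z))%type :=
  [ffun p => v (p.1, p.2.1, p.2.2)].

Definition lpow (V : vectType C) (f : 'End(V)) (k : nat) : 'End(V) :=
  iter k (fun g => (f \o g)%VF) \1%VF.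

Definition tensI (X J : finType) (O : J -> 'End(space X)) :
    'End(space {ffun J -> X}) :=
  lin (fun h : {ffun J -> X} => [ffun h' : {ffun J -> X} =>
    \prod_j (O j (bv (h j)) (h' j) : C)] : space {ffun J -> X}).

(* O_{ij}, for i != j: the two-factor operator O with its first slot at factor
   i and its second slot at factor j. *)
Definition at2 (X J : finType) (i j : J) (O : 'End(space (X * X)%type)) :
    'End(space {ffun J -> X}) :=
  lin (fun h : {ffun J -> X} => \sum_p (O (bv (h i, h j)) p : C) *:
    bv [ffun k => if k == i then p.1 else if k == j then p.2 else h k]).

Definition permI (X J : finType) (g : {perm J}) : 'End(space {ffun J -> X}) :=
  lin (fun h : {ffun J -> X} => bv [ffun t => h ((g^-1)%g t)]).

Definition proj_eq (U V : vectType C) (f g : 'Hom(U, V)) : Prop :=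
  exists2 c : C, c != 0 & f = c *: g.

(* Categories with at most one morphism between two objects are given by the
   proposition Mor a b that a morphism a -> b exists. *)
Definition projective_functor (Ob : Type) (Mor : Ob -> Ob -> Prop)
    (F0 : Ob -> vectType C)
    (F1 : forall a b, Mor a b -> 'Hom(F0 a, F0 b)) : Prop :=
  (forall a (u : Mor a a), proj_eq (F1 a a u) \1%VF) /\
  (forall a b c (u : Mor a b) (v : Mor b c) (w : Mor a c),
      proj_eq (F1 a c w) (F1 b c v \o F1 a b u)%VF).

(* A representation of the Hopf algebra W is given by the operators by which the
   generators X and Y act; an intertwiner commuting with X commutes with X^-1. *)
Definition actions (V : vectType C) : Type := ('End(V) * 'End(V))%type.

Definition homW (U V : vectType C) (a : actions U) (b : actions V) :
    {vspace 'Hom(U, V)} :=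
  (lker (linfun (fun f : 'Hom(U, V) => (f \o a.1) - (b.1 \o f))) :&:
   lker (linfun (fun f : 'Hom(U, V) => (f \o a.2) - (b.2 \o f))))%VF%VS.

(* Delta X = X (x) X and Delta Y = Y (x) X + 1 (x) Y. *)
Definition tens_act (X Y : finType) (a : actions (space X))
    (b : actions (space Y)) : actions (space (X * Y)%type) :=
  (tensl a.1 b.1, tensl a.2 b.1 + tensl \1%VF b.2).

End LinearAlgebra.

Section Weights.
Variable R : realType.
Local Notation C := R[i].

Definition weight : Type := (C * C)%type.

Definition nonsing (l : weight) : bool := (l.1 != 0) && (l.2 != 0).

Definition wmul (l l' : weight) : weight :=
  (l.1 * l'.1, l.2 * l'.1 + l'.2).

Definition wdual (l : weight) : weight := (l.1^-1, - l.2 * l.1^-1).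

Definition root_choice (N : nat) (root : C -> C) : Prop :=
  [/\ root 1 = 1,
      forall z, z != 0 -> root z ^+ N = z,
      forall z, z != 0 -> root z^-1 = (root z)^-1
    & forall z, z != 0 -> root (- z) = - root z].

End Weights.

(* Throughout, N = p.+1, root is the choice of N-th roots, and zeta a c is the
   normalization constant of the cyclic quantum dilogarithm. *)
Section Operators.
Variables (R : realType) (p : nat).
Local Notation C := R[i].
Local Notation N := p.+1.
Variables (root : C -> C) (zeta : C -> C -> C).

Definition q : C := (cos (pi / N%:R) +i* sin (pi / N%:R))%C.

Definition CN : vectType C := space R 'I_N.
Definition CN2 : vectType C := space R ('I_N * 'I_N)%type.

Definition opA : 'End(CN) := lin (fun k : 'I_N => q ^+ (2 * k) *: bv R k).
Definition opB : 'End(CN) := lin (fun k : 'I_N => bv R (ordS k)).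

Definition mexp (z w : C) : nat :=
  odflt ord0 [pick m : 'I_N | root (z * w) == q ^+ (2 * m) * root z * root w].

Definition wdilog (a c : C) (k : nat) : C :=
  \prod_(1 <= j < k.+1) (c - a * q ^+ (2 * j))^-1.

Definition Phi (V : vectType C) (a c : C) (O : 'End(V)) : 'End(V) :=
  xget 0 [set P : 'End(V) | forall (k : 'I_N) (v : V),
    O v = q ^+ (2 * k) *: v -> P v = (zeta a c * wdilog a c k) *: v].

Definition opS : 'End(CN2) :=
  lin (fun ij : 'I_N * 'I_N => bv R (ij.1, ij.1 + ij.2)).

Definition opF (l l' : weight R) : 'End(CN2) :=
  let: (x, y) := l in
  let: (x', y') := l' in
  let d := root (y * x' + y') in
  let a := - (root y * root x' / d) in
  let c := root y' / d in
  (lpow (tensl \1 opB^-1) (mexp x x') \o opS \o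
   Phi a c (tensl opB \1 \o tensl \1 opA \o tensl \1 opB^-1))%VF.

Definition opT (l l' l'' : weight R) : 'End(CN2) :=
  let f1 : 'I_3 := inord 0 in
  let f2 : 'I_3 := inord 1 in
  let f3 : 'I_3 := inord 2 in
  xget 0 [set T : 'End(CN2) | lker T == 0%VS /\
    (at2 f1 f3 (opF l (wmul l' l'')) \o at2 f2 f3 (opF l' l'') \o
     (at2 f1 f2 (opF l l'))^-1 \o (at2 f2 f3 (opF (wmul l l') l''))^-1)%VF
    = at2 f2 f1 T].

Definition V_ (l : weight R) : actions CN :=
  (root l.1 *: opA, root l.2 *: opB).

Definition homV (m l l' : weight R) : {vspace 'Hom(CN, CN2)} :=
  homW (V_ m) (tens_act (V_ l) (V_ l')).

(* The projection vsproj onto Hom_W acts as the identity on its argument here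
   and in AHom, as F and C, D are such that the argument lies in Hom_W. *)
Definition opI (l l' : weight R) : 'Hom(CN, subvs_of (homV (wmul l l') l l')) :=
  linfun (fun f : CN => vsproj (homV (wmul l l') l l')
    (linfun (fun v : CN => (opF l l')^-1%VF (tensv f v)))).

Definition opC (l : weight R) : 'End(CN) :=
  lin (fun k : 'I_N =>
    (q ^- (2 * k * mexp l.2 l.1^-1) * q ^- (k * k.-1)) *: bv R (- k)).

Definition opD (l : weight R) : 'End(CN) :=
  lin (fun k : 'I_N =>
    (q ^- (2 * k * mexp l.2 l.1^-1) * q ^+ (k * k.-1)) *: bv R (- k)).

(* The g with \sum_j e_j (x) g(e_j) = (D (x) id (x) C) (\sum_j f(e_j) (x) e_j) *)
Definition AHom_fun (l l' : weight R) (f : 'Hom(CN, CN2)) : 'Hom(CN, CN2) :=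
  let s := \sum_(j : 'I_N) tensA (tensv (f (bv R j)) (bv R j)) in
  let r := tensl (opD (wdual l)) (tensl \1%VF (opC (wmul l l'))) s in
  lin (fun j : 'I_N => [ffun ab => r (j, ab)] : CN2).

Definition AHom (l l' : weight R) :
    'Hom(subvs_of (homV (wmul l l') l l'),
         subvs_of (homV (wmul l' (wdual (wmul l l'))) l' (wdual (wmul l l')))) :=
  linfun (fun f => vsproj _ (AHom_fun l l' (vsval f))).

Definition opAA (l l' : weight R) : 'End(CN) :=
  ((opI l' (wdual (wmul l l')))^-1 \o AHom l l' \o opI l l')%VF.

End Operators.

(* The vertices of the n-gon are the elements of 'I_n in counterclockwise order,
   and segments between vertices are two-element sets of vertices. *)
Section Triangulations.
Variables (R : realType) (n : nat) (I : finType).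

Definition side (e : {set 'I_n}) : bool := [exists k, e == [set k; ordS k]].

Definition diagonal (e : {set 'I_n}) : bool := (#|e| == 2) && ~~ side e.

(* The interiors of the segments intersect in one point. *)
Definition crossing (e f : {set 'I_n}) : bool :=
  [exists a : 'I_n, exists b : 'I_n, exists c : 'I_n, exists d : 'I_n,
    [&& e == [set a; b], f == [set c; d],
        (a < c < b)%N & (d < a)%N || (b < d)%N]].

Definition noncrossing_diagonals (D : {set {set 'I_n}}) : bool :=
  [forall e in D, diagonal e] &&
  [forall e in D, forall f in D, ~~ crossing e f].

Definition ccw (a b c : 'I_n) : bool :=
  [|| (a < b < c)%N, (b < c < a)%N | (c < a < b)%N].

(* A dotted triangle is the triple of its vertices in counterclockwise order
   with the dotted one in the middle. *)
Definition dtriangle : Type := ('I_n * 'I_n * 'I_n)%type.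

(* The sides of a dotted triangle in counterclockwise order, the third one
   being opposite the dot. *)
Definition side1 (T : dtriangle) : {set 'I_n} := [set T.1.1; T.1.2].
Definition side2 (T : dtriangle) : {set 'I_n} := [set T.1.2; T.2].
Definition side3 (T : dtriangle) : {set 'I_n} := [set T.2; T.1.1].

Definition vertices (T : dtriangle) : {set 'I_n} := [set T.1.1; T.1.2; T.2].

(* LD-triangulations. The weight of a segment which is not an edge is fixed to
   be (0, 0), so that equal LD-triangulations are equal as records. *)
Record LD : Type := MkLD {
  diags : {set {set 'I_n}};
  tri : {ffun I -> dtriangle};
  wt : {ffun {set 'I_n} -> weight R};
  edges := [set e | side e] :|: diags;
  diags_max : maxset noncrossing_diagonals diags;
  tri_ccw : forall t, ccw (tri t).1.1 (tri t).1.2 (tri t).2;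
  tri_edges : forall t,
    [/\ side1 (tri t) \in edges, side2 (tri t) \in edges
      & side3 (tri t) \in edges];
  tri_bij : forall a b c : 'I_n, ccw a b c ->
    [set a; b] \in edges -> [set b; c] \in edges -> [set c; a] \in edges ->
    exists! t, vertices (tri t) = [set a; b; c];
  wt_nonsing : forall e, e \in edges -> nonsing (wt e);
  wt_default : forall e, e \notin edges -> wt e = (0, 0)
}.

Definition w1 (tau : LD) (t : I) : weight R := wt tau (side1 (tri tau t)).
Definition w2 (tau : LD) (t : I) : weight R := wt tau (side2 (tri tau t)).
Definition w3 (tau : LD) (t : I) : weight R := wt tau (side3 (tri tau t)).

Definition sane (tau : LD) : Prop :=
  forall t, wmul (w1 tau t) (w2 tau t) = w3 tau t.

Inductive elementary : Type :=
  | elA of {ffun I -> bool}   (* true stands for +1, false for -1 *)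
  | elT of I & I
  | elP of {perm I}.

Definition is_A (eps : {ffun I -> bool}) (tau tau' : LD) : Prop :=
  diags tau' = diags tau /\
  forall t, let: (a, d, b) := tri tau t in
    tri tau' t = (if eps t then (d, b, a) else (b, a, d)) /\
    (wt tau' [set a; d], wt tau' [set d; b], wt tau' [set b; a]) =
    (if eps t then (wdual (w1 tau t), w2 tau t, wdual (w3 tau t))
     else (w1 tau t, wdual (w2 tau t), wdual (w3 tau t))).

Definition is_T (s t : I) (tau tau' : LD) : Prop :=
  exists P1 P2 P3 P4 : 'I_n,
  [/\ tri tau t = (P1, P2, P3) /\ tri tau s = (P1, P3, P4),
      tri tau' s = (P2, P3, P4) /\ tri tau' t = (P1, P2, P4),
      forall u, u != s -> u != t -> tri tau' u = tri tau u,
      diags tau' = [set P2; P4] |: (diags tau :\ [set P1; P3])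
    & forall e, e != [set P1; P3] -> e != [set P2; P4] ->
        wt tau' e = wt tau e].

Definition is_P (g : {perm I}) (tau tau' : LD) : Prop :=
  [/\ diags tau' = diags tau, wt tau' = wt tau
    & forall t, tri tau' (g t) = tri tau t].

Definition is_elementary (m : elementary) : LD -> LD -> Prop :=
  match m with
  | elA eps => is_A eps
  | elT s t => is_T s t
  | elP g => is_P g
  end.

Record saneLD : Type := MkSane { ld :> LD; ld_sane : sane ld }.

Inductive sane_seq (tau : saneLD) : saneLD -> Type :=
  | seq_nil : sane_seq tau tau
  | seq_fwd m (tau1 tau2 : saneLD) :
      sane_seq tau tau1 -> is_elementary m tau1 tau2 -> sane_seq tau tau2
  | seq_bwd m (tau1 tau2 : saneLD) :
      sane_seq tau tau1 -> is_elementary m tau2 tau1 -> sane_seq tau tau2.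

Definition sane_mor (tau tau' : saneLD) : Prop := inhabited (sane_seq tau tau').

End Triangulations.

Section Assignment.
Variables (R : realType) (p : nat).
Local Notation C := R[i].
Local Notation N := p.+1.
Variables (root : C -> C) (zeta : C -> C -> C).
Variables (n : nat) (I : finType).

(* Every multiplicity space is C^N as a vector space. *)
Definition obj_space (tau : saneLD R n I) : vectType C :=
  space R {ffun I -> 'I_N}.

Definition elementary_op (m : elementary I) (tau tau' : saneLD R n I) :
    'Hom(obj_space tau, obj_space tau') :=
  match m with
  | elA eps => tensI (fun t =>
      if eps t then opAA p root zeta (w1 tau t) (w2 tau t)
      else (opAA p root zeta (wdual (w3 tau t)) (w1 tau t))^-1%VF)
  | elT s t =>
      at2 s t (opT p root zeta (w1 tau t) (w2 tau t) (w2 tau s))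
  | elP g => permI R 'I_N g
  end.

Fixpoint seq_op (tau tau' : saneLD R n I) (s : sane_seq tau tau') :
    'Hom(obj_space tau, obj_space tau') :=
  match s in sane_seq _ tau' return 'Hom(obj_space tau, obj_space tau') with
  | seq_nil => \1%VF
  | seq_fwd m tau1 tau2 s' _ => (elementary_op m tau1 tau2 \o seq_op s')%VF
  | seq_bwd m tau1 tau2 s' _ => ((elementary_op m tau2 tau1)^-1 \o seq_op s')%VF
  end.

End Assignment.

(* Main.v *)
(*
Every sane dotted triangulation tau gets a linear map [gluing tau] from its
space to one fixed space, and each elementary operator commutes with these maps
up to a nonzero scalar. As the maps are injective, they determine the operator
of a sequence of elementary morphisms up to a nonzero scalar, so that no
presentation of the groupoid by generators and relations is needed.

The map [gluing tau] is a state sum. Using F^-1, an element of the space of a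
triangle whose dot is at its middle vertex (in the order 0 < ... < n-1) becomes
a tensor with one index for each side; if the dot is elsewhere the tensor is
first rotated by the maps C and D. The sum runs over the indices at the sides
joining the smallest to the largest vertex of some triangle.
- The operator A was defined by rotating tensors, and the third power of the
  rotation is a scalar on intertwiners; hence compatibility with A.
- The definition of T gives compatibility when all dots are in the middle. In
  the three other positions of the quadrilateral, C and D cancel along the
  diagonal and contribute the same factors on the sides before and after.
- Injectivity: F^-1 is injective, and a triangle of minimal span (largest minus
  smallest vertex) can be split off the sum.
*)

Require Import Defs.
From HB Require Import structures.
From mathcomp Require Import all_boot all_order fingroup perm all_algebra.
From mathcomp Require Import all_classical all_reals all_analysis.
From mathcomp Require Import complex ring lra zify.
Set Implicit Arguments.
Unset Strict Implicit.
Unset Printing Implicit Defensive.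
Import Order.TTheory GRing.Theory Num.Theory.
Local Open Scope ring_scope.

(** * Coordinates *)

(** Several operators are defined by a choice or a projection, so using them requires existence
    proofs. For [Phi] the source is the spectral decomposition of an operator of order N. For [opI]
    and [AHom] it is that F commutes with X and Y, and that the exponents m in C and D are the
    discrepancies between the roots of a weight and those of its dual. For T it is Schur's lemma:
    the composite of the four maps F commutes with X and Y on the third factor, where they act by
    multiples of A and B, so it acts on the first two factors only.

    The scalars other than 1 have one source. Since F commutes with X, the tensor of F^-1 vanishes
    unless om^(i+j-k) equals one constant, where i, j, k are the indices at the three sides and om =
    q^2. This makes the third power of the rotation a scalar, and it removes a leftover power of om
    in one position of the quadrilateral.

    Oddness of N gives om^(N(N-1)/2) = 1, hence periodicity of q^(i(i-1)) in i and (A B^-1)^N = 1;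
    it also gives (-1)^N = -1, hence c^N - a^N = 1 for the parameters of F. *)

Lemma linfun_fE (K : fieldType) (U V : vectType K) (f : U -> V) :
  linear f -> linfun f =1 f.
Proof.
move=> fP; pose L : {linear U -> V} :=
  HB.pack f (GRing.isLinear.Build _ _ _ _ f fP).
exact: (lfunE L).
Qed.

Lemma lker0_inj0 (K : fieldType) (U V : vectType K) (f : 'Hom(U, V)) :
  reflect (forall v, f v = 0 -> v = 0) (lker f == 0%VS).
Proof.
apply: (iffP idP) => [/lker0P fi v fv|fi].
  by apply: fi; rewrite fv linear0.
apply/lker0P => u v fuv.
by apply/eqP; rewrite -subr_eq0; apply/eqP/fi; rewrite linearB /= fuv subrr.
Qed.

(** Coordinates are accessed only through this function, so that it and the basis vectors can be
    made opaque: vectors are compared by the rules below and not by unfolding finite functions. *)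
Definition cf (R : realType) (X : finType) (v : Defs.space R X) (x : X) : R[i] :=
  v x.

Section Coefficients.
Variable R : realType.
Local Notation C := R[i].
Local Notation sp := (Defs.space R).

Lemma cf_bv (X : finType) (x y : X) : cf (bv R x) y = (y == x)%:R.
Proof. by rewrite /cf ffunE. Qed.

Lemma cfP (X : finType) (v w : sp X) : cf v =1 cf w -> v = w.
Proof. by move=> vw; apply/ffunP. Qed.

Lemma cfD (X : finType) (v w : sp X) x : cf (v + w) x = cf v x + cf w x.
Proof. by rewrite /cf ffunE. Qed.

Lemma cfZ (X : finType) (a : C) (v : sp X) x : cf (a *: v) x = a * cf v x.
Proof. by rewrite /cf ffunE. Qed.

Lemma cf0 (X : finType) x : cf (0 : sp X) x = 0.
Proof. by rewrite /cf ffunE. Qed.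

Lemma cf_finfun (X : finType) (f : X -> C^o) x : cf (finfun f : sp X) x = f x.
Proof. by rewrite /cf ffunE. Qed.

Lemma cf_tensv (X Y : finType) (v : sp X) (w : sp Y) x :
  cf (tensv v w) x = cf v x.1 * cf w x.2.
Proof. by rewrite /cf ffunE. Qed.

Lemma cf_tensA (X Y Z : finType) (v : sp (X * Y * Z)%type) x :
  cf (tensA v) x = cf v (x.1, x.2.1, x.2.2).
Proof. by rewrite /cf ffunE. Qed.

Lemma lin_cf (X : finType) (V : vectType C) (g : X -> V) :
  lin g = linfun (fun v : sp X => \sum_x cf v x *: g x).
Proof. by []. Qed.

Lemma tensI_cf (X J : finType) (O : J -> 'End(sp X)) :
  tensI O = lin (fun h : {ffun J -> X} => [ffun h' : {ffun J -> X} =>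
    \prod_j cf (O j (bv R (h j))) (h' j)] : sp {ffun J -> X}).
Proof. by []. Qed.

Lemma at2_cf (X J : finType) (i j : J) (O : 'End(sp (X * X)%type)) :
  at2 i j O =
  lin (fun h : {ffun J -> X} => \sum_p cf (O (bv R (h i, h j))) p *:
    bv R [ffun k => if k == i then p.1 else if k == j then p.2 else h k]).
Proof. by []. Qed.

Lemma AHom_fun_cf (p : nat) (root : C -> C) (l l' : weight R)
    (f : 'Hom(CN R p, CN2 R p)) :
  AHom_fun root l l' f =
  let s := \sum_(j : 'I_p.+1) tensA (tensv (f (bv R j)) (bv R j)) in
  let r := tensl (opD p root (wdual l)) (tensl \1%VF (opC p root (wmul l l'))) s in
  lin (fun j : 'I_p.+1 => [ffun ab => cf r (j, ab)] : CN2 R p).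
Proof. by []. Qed.

End Coefficients.

Opaque cf bv Defs.space.

Section Coefficients2.
Variable R : realType.
Local Notation C := R[i].
Local Notation sp := (Defs.space R).

Lemma cf_sum (X J : finType) (P : pred J) (F : J -> sp X) x :
  cf (\sum_(j | P j) F j) x = \sum_(j | P j) cf (F j) x.
Proof.
by apply: (big_ind2 (fun (u : sp X) c => cf u x = c)); rewrite ?cf0// => u ? v ? <- <-;
  rewrite cfD.
Qed.

Lemma cf_lincomb (X J : finType) (P : pred J) (a : J -> C) (F : J -> sp X) x :
  cf (\sum_(j | P j) a j *: F j) x = \sum_(j | P j) a j * cf (F j) x.
Proof. by rewrite cf_sum; apply: eq_bigr => j _; exact: cfZ. Qed.

Lemma linE (X : finType) (V : vectType C) (g : X -> V) (v : sp X) :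
  lin g v = \sum_x cf v x *: g x.
Proof.
rewrite lin_cf linfun_fE// => a u w.
rewrite scaler_sumr -big_split; apply: eq_bigr => x _ /=.
by rewrite cfD cfZ scalerDl scalerA.
Qed.

Lemma lin_bv (X : finType) (V : vectType C) (g : X -> V) x :
  lin g (bv R x) = g x.
Proof.
rewrite linE (bigD1 x) //= cf_bv eqxx scale1r.
by rewrite big1 ?addr0// => y ne; rewrite cf_bv (negbTE ne) scale0r.
Qed.

Lemma sp_expand (X : finType) (v : sp X) : v = \sum_x cf v x *: bv R x.
Proof.
apply: cfP => y; rewrite cf_lincomb (bigD1 y) //= cf_bv eqxx mulr1.
by rewrite big1 ?addr0// => x ne; rewrite cf_bv eq_sym (negbTE ne) mulr0.
Qed.

Lemma hom_expand (X : finType) (V : vectType C) (f : 'Hom(sp X, V)) v :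
  f v = \sum_x cf v x *: f (bv R x).
Proof.
by rewrite {1}[v]sp_expand linear_sum; apply: eq_bigr => x _; rewrite linearZ.
Qed.

Lemma cf_hom (X Y : finType) (f : 'Hom(sp X, sp Y)) v y :
  cf (f v) y = \sum_x cf v x * cf (f (bv R x)) y.
Proof. by rewrite hom_expand cf_lincomb. Qed.

Lemma cf_homZ (V : vectType C) (Y : finType) (f : 'Hom(V, sp Y)) (a : C) v y :
  cf ((a *: f) v) y = a * cf (f v) y.
Proof. by rewrite -cfZ -scale_lfunE. Qed.

Lemma cf_homD (V : vectType C) (Y : finType) (f g : 'Hom(V, sp Y)) v y :
  cf ((f + g) v) y = cf (f v) y + cf (g v) y.
Proof. by rewrite -cfD -add_lfunE. Qed.

Lemma cf_comp (X Y Z : finType) (f : 'Hom(sp X, sp Y)) (g : 'Hom(sp Y, sp Z)) x z :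
  cf ((g \o f)%VF (bv R x)) z = \sum_y cf (f (bv R x)) y * cf (g (bv R y)) z.
Proof. by rewrite comp_lfunE cf_hom. Qed.

Lemma hom_bvP (X : finType) (V : vectType C) (f g : 'Hom(sp X, V)) :
  (forall x, f (bv R x) = g (bv R x)) -> f = g.
Proof.
move=> fg; apply/lfunP => v; rewrite hom_expand [RHS]hom_expand.
by apply: eq_bigr => x _; rewrite fg.
Qed.

Lemma tensv_bv (X Y : finType) (x : X) (y : Y) :
  tensv (bv R x) (bv R y) = bv R (x, y).
Proof.
by apply: cfP => -[a b]; rewrite cf_tensv !cf_bv /= -natrM mulnb xpair_eqE.
Qed.

Lemma tensl_bv (X Y X' Y' : finType) (f : 'Hom(sp X, sp X'))
    (g : 'Hom(sp Y, sp Y')) x y :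
  tensl f g (bv R (x, y)) = tensv (f (bv R x)) (g (bv R y)).
Proof. by rewrite lin_bv. Qed.

Lemma tensl_v (X Y X' Y' : finType) (f : 'Hom(sp X, sp X'))
    (g : 'Hom(sp Y, sp Y')) v w :
  tensl f g (tensv v w) = tensv (f v) (g w).
Proof.
apply: cfP => -[a b]; rewrite cf_hom cf_tensv /= cf_hom.
rewrite (cf_hom g) big_distrlr /= pair_bigA /=; apply: eq_bigr => -[x y] _.
by rewrite tensl_bv !cf_tensv /= mulrACA.
Qed.

Lemma tensl_comp (X Y X' Y' X2 Y2 : finType) (f : 'Hom(sp X, sp X'))
    (g : 'Hom(sp Y, sp Y')) (f' : 'Hom(sp X', sp X2)) (g' : 'Hom(sp Y', sp Y2)) :
  (tensl f' g' \o tensl f g = tensl (f' \o f) (g' \o g))%VF.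
Proof.
by apply: hom_bvP => -[x y]; rewrite comp_lfunE !tensl_bv tensl_v !comp_lfunE.
Qed.

Lemma tensl1 (X Y : finType) : tensl (\1 : 'End(sp X))%VF (\1 : 'End(sp Y))%VF = \1%VF.
Proof. by apply: hom_bvP => -[x y]; rewrite tensl_bv !id_lfunE tensv_bv. Qed.

Lemma tenslZ (X Y X' Y' : finType) (f : 'Hom(sp X, sp X'))
    (g : 'Hom(sp Y, sp Y')) (a b : C) :
  tensl (a *: f) (b *: g) = (a * b) *: tensl f g.
Proof.
apply: hom_bvP => -[x y]; apply: cfP => z.
transitivity (a * cf (f (bv R x)) z.1 * (b * cf (g (bv R y)) z.2)).
  by rewrite tensl_bv cf_tensv; congr (_ * _); exact: cf_homZ.
by rewrite mulrACA -cf_tensv -tensl_bv -cf_homZ.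
Qed.

End Coefficients2.

Opaque lin tensl tensv tensA.

(** * Operators with a discrete spectrum *)

Section Eigen.
Variables (K : fieldType) (V : vectType K) (N : nat) (om : K).
Hypotheses (om_prim : N.-primitive_root om) (N_neq0 : N%:R != 0 :> K).
Variable U : 'End(V).

(** Orthogonality of the characters of Z/N: for i <> j the ratio z is not 1, and z - 1 times the sum
    is z^N - 1 = 0. *)
Lemma sum_roots (i j : nat) : (i < N)%N -> (j < N)%N ->
  \sum_(k < N) (om ^+ i / om ^+ j) ^+ k = (i == j)%:R * N%:R.
Proof.
have om0 : om != 0 by apply/eqP => om0; have := prim_expr_order om_prim;
  rewrite om0 expr0n gtn_eqF ?(prim_order_gt0 om_prim)// => /eqP; rewrite eq_sym oner_eq0.
move=> iN jN; case: (eqVneq i j) => [->|ne].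
  rewrite divff ?expf_neq0// mul1r (eq_bigr (fun=> 1)) => [|k _]; last by rewrite expr1n.
  by rewrite sumr_const card_ord.
set z := _ / _; have z1 : z - 1 != 0.
  rewrite subr_eq0 -(inj_eq (mulIf (expf_neq0 j om0))) divfK ?expf_neq0// mul1r.
  by rewrite (eq_prim_root_expr om_prim) !modn_small.
apply: (mulfI z1); rewrite -subrX1 mul0r mulr0 /z exprMn exprVn.
by rewrite -!exprM !(mulnC _ N) !exprM (prim_expr_order om_prim) !expr1n invr1 mulr1 subrr.
Qed.

(** The Fourier average of the powers of U; when U^N = 1 it is the projection onto the
    om^k-eigenspace. *)
Definition eigproj (k : nat) : 'End(V) :=
  N%:R^-1 *: \sum_(j < N) (om ^- k) ^+ j *: iter j (comp_lfun U) \1%VF.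

Lemma eigprojE k v :
  eigproj k v = N%:R^-1 *: \sum_(j < N) (om ^- k) ^+ j *: iter j U v.
Proof.
rewrite scale_lfunE sum_lfunE; congr (_ *: _); apply: eq_bigr => j _.
rewrite scale_lfunE; congr (_ *: _).
by elim: (j : nat) => [|i IH] /=; rewrite ?id_lfunE// comp_lfunE IH.
Qed.

Lemma eigproj_eig (k k' : nat) v : (k < N)%N -> (k' < N)%N ->
  U v = om ^+ k *: v -> eigproj k' v = (k == k')%:R *: v.
Proof.
move=> kN k'N Uv; have it j : iter j U v = (om ^+ k) ^+ j *: v.
  elim: j => [|j IH] /=; first by rewrite scale1r.
  by rewrite IH linearZ /= Uv scalerA exprSr.
rewrite eigprojE (eq_bigr (fun j : 'I_N => (om ^+ k / om ^+ k') ^+ j *: v)); last first.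
  by move=> j _; rewrite it scalerA -exprMn mulrC.
by rewrite -scaler_suml sum_roots// scalerA mulrCA mulVf// mulr1.
Qed.

(** The combination of the Fourier averages with weights c k works: on an om^k-eigenvector the k-th
    average is the identity and the others vanish. *)
Lemma eigen_op_exists (c : nat -> K) :
  exists P : 'End(V), forall (k : 'I_N) v, U v = om ^+ k *: v -> P v = c k *: v.
Proof.
exists (\sum_(k < N) c k *: eigproj k) => k v Uv.
rewrite sum_lfunE (bigD1 k) //= scale_lfunE (eigproj_eig _ _ Uv)// eqxx scale1r.
rewrite big1 ?addr0// => k' ne; rewrite scale_lfunE (eigproj_eig _ _ Uv)//.
by rewrite -val_eqE /= eq_sym in ne *; rewrite (negbTE ne) scale0r scaler0.
Qed.

Hypothesis U_order : forall v, iter N U v = v.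

(** Applying U shifts the summation index by one; the last term wraps around to the first because
    U^N = 1 and om^(kN) = 1. *)
Lemma eigproj_in (k : nat) v : U (eigproj k v) = om ^+ k *: eigproj k v.
Proof.
have om0 : om != 0 by apply/eqP => om0; have := prim_expr_order om_prim;
  rewrite om0 expr0n gtn_eqF ?(prim_order_gt0 om_prim)// => /eqP; rewrite eq_sym oner_eq0.
rewrite eigprojE linearZ /= scalerA mulrC -scalerA; congr (_ *: _).
rewrite linear_sum scaler_sumr /=.
have N0 := prim_order_gt0 om_prim; case: (N) N0 U_order (prim_expr_order om_prim) => // n _ Uo omN.
rewrite big_ord_recr [RHS]big_ord_recl /= addrC; congr (_ + _).
  rewrite linearZ -iterS Uo !expr0 !scale1r; congr (_ *: _).
  apply: (mulfI (expf_neq0 n (expf_neq0 k om0))).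
  by rewrite -exprMn divff ?expf_neq0// expr1n -exprSr -exprM mulnC exprM omN expr1n.
apply: eq_bigr => j _; rewrite linearZ /= -iterS scalerA /bump leq0n add1n exprS.
by rewrite mulrA divff ?expf_neq0// mul1r.
Qed.

(** After exchanging the sums, the coefficient of U^j is a character sum, which survives only for j
    = 0. Thus the eigenvectors of U span, which is what [eigen_ext] exploits. *)
Lemma eigproj_sum v : v = \sum_(k < N) eigproj k v.
Proof.
have N0 := prim_order_gt0 om_prim; rewrite (eq_bigr _ (fun (k : 'I_N) _ => eigprojE k v)) -scaler_sumr exchange_big /=.
rewrite (bigD1 (Ordinal N0)) //= (eq_bigr (fun=> v)) => [|k _]; last by rewrite scale1r.
rewrite sumr_const card_ord [X in _ + X]big1 => [|j ne].
  by rewrite addr0 -scaler_nat scalerA mulVf// scale1r.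
rewrite -scaler_suml (eq_bigr (fun k : 'I_N => (om ^+ 0 / om ^+ j) ^+ k)) => [|k _].
  by rewrite sum_roots// -val_eqE /= eq_sym in ne *; rewrite (negbTE ne) mul0r scale0r.
by rewrite mul1r -!exprVn -!exprM mulnC.
Qed.

Lemma eigen_ext (W : vectType K) (f g : 'Hom(V, W)) :
  (forall (k : 'I_N) v, U v = om ^+ k *: v -> f v = g v) -> f = g.
Proof.
move=> fg; apply/lfunP => v; rewrite [v]eigproj_sum !linear_sum.
by apply: eq_bigr => k _; apply: (fg k); rewrite eigproj_in.
Qed.

Variables (P : 'End(V)) (c : nat -> K).
Hypothesis P_eigen : forall (k : 'I_N) v, U v = om ^+ k *: v -> P v = c k *: v.

Lemma eigen_op_inj : (forall k, (k < N)%N -> c k != 0) -> lker P == 0%VS.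
Proof.
move=> c0; apply/lker0_inj0 => v Pv.
have Pp (k : 'I_N) : c k *: eigproj k v = 0.
  transitivity (eigproj k (P v)); last by rewrite Pv linear0.
  rewrite [v in P v]eigproj_sum !linear_sum /= (bigD1 k) //=.
  rewrite (P_eigen (eigproj_in k v)) linearZ /= (eigproj_eig _ _ (eigproj_in k v))// eqxx scale1r.
  rewrite big1 ?addr0// => j ne.
  rewrite (P_eigen (eigproj_in j v)) linearZ /= (eigproj_eig _ _ (eigproj_in j v))//.
  by rewrite -val_eqE /= in ne; rewrite (negbTE ne) scale0r scaler0.
rewrite [v]eigproj_sum big1// => k _; apply/eqP.
by have /eqP := Pp k; rewrite scaler_eq0 (negbTE (c0 _ _)).
Qed.

Lemma eigen_op_commute (X : 'End(V)) :
  (U \o X = X \o U)%VF -> (P \o X = X \o P)%VF.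
Proof.
move=> UX; apply: eigen_ext => k v Uv; rewrite !comp_lfunE (P_eigen Uv) linearZ /=.
by apply: P_eigen; rewrite -comp_lfunE UX comp_lfunE Uv linearZ.
Qed.

(* [E] maps the om^k-eigenspace of [U] to the om^(k+1)-eigenspace. *)
Lemma eigen_op_shift (E : 'End(V)) (a b d : K) :
  (forall v, U (E v) = om *: E (U v)) ->
  (forall k, c (k %% N)%N = c k) ->
  (forall k, c k.+1 * (a * om ^+ k.+1 + b) = d * c k) ->
  (P \o (a *: (U \o E) + b *: E) = d *: (E \o P))%VF.
Proof.
move=> UE cN cS; apply: eigen_ext => k v Uv.
have UEv : U (E v) = om ^+ (k.+1) *: E v by rewrite UE Uv linearZ scalerA exprS.
(* For k = N - 1 the new eigenvalue om^N is om^0, so the index is reduced modulo N and the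
   periodicity of c is used. *)
have kN : (k.+1 %% N < N)%N by rewrite ltn_mod (prim_order_gt0 om_prim).
have PEv : P (E v) = c k.+1 *: E v.
  rewrite -cN; apply: (@P_eigen (Ordinal kN)); rewrite UEv /=.
  by rewrite (prim_expr_mod om_prim).
rewrite !(comp_lfunE, add_lfunE, scale_lfunE) UEv linearD !linearZ /= PEv (P_eigen Uv) linearZ /=.
rewrite [E (_ *: _)]linearZ /= !scalerA -scalerDl; congr (_ *: _).
by rewrite -cS mulrDr !(mulrC (c _)) (mulrC a).
Qed.

End Eigen.

(** * Roots of unity and weights *)

Section RootOfUnity.
Variables (R : realType) (p : nat).
Local Notation C := R[i].
Local Notation N := p.+1.

Definition omega : C := q R p ^+ 2.

Lemma q_expr k : q R p ^+ k =
  (cos (k%:R * (pi / N%:R)) +i* sin (k%:R * (pi / N%:R)))%C.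
Proof.
rewrite /q; move: (pi / _) => t.
elim: k => [|k IH]; first by rewrite mul0r cos0 sin0.
rewrite exprS IH -natr1 mulrDl mul1r cosD sinD.
by apply/eqP; rewrite eq_complex /= !(mulrC (cos t)) !(mulrC (sin t)) eqxx addrC eqxx.
Qed.

(** If om^i = 1 with 0 < i < N, then x = i pi / N satisfies cos 2x = 1, hence sin x = 0, although 0
    < x < pi. *)
Lemma omega_prim : N.-primitive_root omega.
Proof.
apply/andP; split=> //; apply/forallP => -[i iN] /=; rewrite unity_rootE /omega -exprM q_expr.
have N0 : (N%:R : R) != 0 by rewrite pnatr_eq0.
rewrite mul2n -addnn natrD mulrDl; set x := i.+1%:R * _.
rewrite eqSS; move: iN; rewrite ltnS leq_eqVlt => /orP[/eqP ip|ip]; rewrite ?ip ?eqxx.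
  rewrite /x ip mulrCA divff// mulr1 (cosD pi) (sinD pi) sinpi cospi !mulr0 !mul0r addr0 subr0 mulN1r opprK.
  by rewrite !eqxx.
rewrite (ltn_eqF ip).
have sx : 0 < sin x.
  apply: sin_gt0_pi; rewrite /x; apply/andP; split.
    by apply: mulr_gt0; [rewrite ltr0n | apply: divr_gt0; rewrite ?pi_gt0 ?ltr0n].
  by rewrite mulrCA -[X in _ < X]mulr1 ltr_pM2l ?pi_gt0// ltr_pdivrMr ?ltr0n// mul1r ltr_nat ltnS.
apply/eqP/negbTE; rewrite eq_complex /= negb_and; apply/orP; left.
rewrite cosD -!expr2 cos2sin2; apply/eqP => h.
have : sin x ^+ 2 = 0 by move: h; clear; move: (sin x ^+ 2) => u; lra.
by move/eqP; rewrite sqrf_eq0 gt_eqF.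
Qed.

Lemma omega_order : omega ^+ N = 1. Proof. exact: prim_expr_order omega_prim. Qed.

Lemma omega_neq0 : omega != 0.
Proof. by apply/eqP => o; move: omega_order; rewrite o expr0n => /eqP; rewrite eq_sym oner_eq0. Qed.

Lemma N_neq0 : (N%:R : C) != 0. Proof. by rewrite pnatr_eq0. Qed.

Lemma omega_mod k : omega ^+ (k %% N) = omega ^+ k.
Proof. exact: prim_expr_mod omega_prim k. Qed.

Lemma omega_D (i j : 'I_N) : omega ^+ (i + j)%R = omega ^+ i * omega ^+ j.
Proof. by rewrite -exprD -[RHS]omega_mod. Qed.

Lemma omega_N (i : 'I_N) : omega ^+ (- i)%R = (omega ^+ i)^-1.
Proof.
have oi : omega ^+ i != 0 by rewrite expf_neq0 ?omega_neq0.
by apply: (mulIf oi); rewrite mulVf// -omega_D addNr.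
Qed.

Lemma omega_1 : omega ^+ (Zp1 : 'I_N) = omega.
Proof. by rewrite -[RHS]expr1 -[in RHS]omega_mod. Qed.

Lemma q_even k : q R p ^+ (2 * k) = omega ^+ k. Proof. by rewrite exprM. Qed.

Lemma ordSE (i : 'I_N) : ordS i = i + Zp1.
Proof. by apply: val_inj; rewrite /= modnDmr addn1. Qed.

Lemma N_root_omega (z w : C) : z != 0 -> z ^+ N = w ^+ N -> {m : 'I_N | w = omega ^+ m * z}.
Proof.
move=> z0 zw; have [|m mE] := prim_rootP omega_prim (x := w / z).
  by rewrite exprMn exprVn -zw divff ?expf_neq0.
by exists m; rewrite -mE divfK.
Qed.

End RootOfUnity.

Section Weights.
Variables (R : realType) (p : nat).
Local Notation C := R[i].
Local Notation N := p.+1.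
Local Notation om := (omega R p).
Variable root : C -> C.
Hypothesis hroot : root_choice N root.

Lemma root_expr z : z != 0 -> root z ^+ N = z. Proof. by case: hroot => _ + _ _; apply. Qed.
Lemma root_inv z : z != 0 -> root z^-1 = (root z)^-1. Proof. by case: hroot => _ _ + _; apply. Qed.
Lemma root_opp z : z != 0 -> root (- z) = - root z. Proof. by case: hroot => _ _ _ +; apply. Qed.
Lemma root_neq0 z : z != 0 -> root z != 0.
Proof. by move=> z0; apply/eqP => rz; have := root_expr z0; rewrite rz expr0n => e; move: z0; rewrite -e eqxx. Qed.

(** Both roots have the same N-th power, so they differ by a power of om and the default value in
    [mexp] is never taken. *)
Lemma mexpP z w : z != 0 -> w != 0 ->
  root (z * w) = om ^+ mexp p root z w * root z * root w.
Proof.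
move=> z0 w0; rewrite /mexp; case: pickP => [m /eqP|/=]; first by rewrite q_even.
have r0 : root z * root w != 0 by rewrite mulf_neq0 ?root_neq0.
have [|m mE] := @N_root_omega R p (root z * root w) (root (z * w)) r0.
  by rewrite exprMn !root_expr ?mulf_neq0.
by move/(_ m); rewrite q_even mE mulrA eqxx.
Qed.

Lemma wdualK (l : weight R) : nonsing l -> wdual (wdual l) = l.
Proof.
case: l => x y /andP[/= x0 y0]; rewrite /wdual /= invrK; congr pair.
by field.
Qed.

Lemma nonsing_dual (l : weight R) : nonsing l -> nonsing (wdual l).
Proof. by case: l => x y /andP[/= x0 y0]; rewrite /nonsing /= invr_neq0//= mulf_neq0 ?oppr_eq0 ?invr_neq0. Qed.

Lemma wmul_rot (l l' : weight R) : nonsing l -> nonsing l' ->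
  wmul l' (wdual (wmul l l')) = wdual l.
Proof.
case: l l' => [x y] [x' y'] /andP[/= x0 y0] /andP[/= x'0 y'0].
rewrite /wmul /wdual /=; congr pair; field; by rewrite x0 x'0.
Qed.

Lemma wmulA (a b c : weight R) : wmul a (wmul b c) = wmul (wmul a b) c.
Proof. by rewrite /wmul /= mulrA; congr pair; ring. Qed.

End Weights.

(** * The operators A, B and F *)

Section Monomial.
Variable R : realType.
Local Notation C := R[i].
Local Notation sp := (Defs.space R).

Lemma cf_tensl (X Y X' Y' : finType) (f : 'Hom(sp X, sp X'))
    (g : 'Hom(sp Y, sp Y')) w z :
  cf (tensl f g w) z =
  \sum_x \sum_y cf w (x, y) * (cf (f (bv R x)) z.1 * cf (g (bv R y)) z.2).
Proof.
rewrite cf_hom pair_bigA /=; apply: eq_bigr => -[x y] _.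
by rewrite tensl_bv cf_tensv.
Qed.

(** Products of monomial operators, those for which each coordinate of the image is a multiple of
    one coordinate of the argument. A, B, C, D and the actions of X and Y on a single V_l are of
    this kind. *)
Lemma tensl_mono (X Y X' Y' : finType) (f : 'Hom(sp X, sp X'))
    (g : 'Hom(sp Y, sp Y')) (a : X' -> C) (s : X' -> X) (b : Y' -> C) (t : Y' -> Y) :
  (forall v i, cf (f v) i = a i * cf v (s i)) ->
  (forall v i, cf (g v) i = b i * cf v (t i)) ->
  forall w z, cf (tensl f g w) z = a z.1 * b z.2 * cf w (s z.1, t z.2).
Proof.
move=> fE gE w [i j]; rewrite cf_tensl (bigD1 (s i)) //= (bigD1 (t j)) //=.
rewrite fE gE !cf_bv !eqxx !mulr1 [cf w _ * _]mulrC.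
rewrite big1 ?addr0 => [|y ne]; last by rewrite gE cf_bv eq_sym (negbTE ne) !mulr0.
rewrite big1 ?addr0// => x ne; rewrite big1// => y _.
by rewrite fE cf_bv eq_sym (negbTE ne) mulr0 mul0r mulr0.
Qed.

Lemma cf_id (X : finType) (v : sp X) i : cf ((\1 : 'End(sp X))%VF v) i = 1 * cf v i.
Proof. by rewrite id_lfunE mul1r. Qed.

Lemma cf_lin_perm (X : finType) (s s' : X -> X) :
  cancel s s' -> cancel s' s ->
  forall v i, cf (lin (fun k => bv R (s k)) v) i = cf v (s' i).
Proof.
move=> sK s'K v i; transitivity (\sum_x cf v x * (i == s x)%:R).
  by rewrite linE cf_lincomb; apply: eq_bigr => x _; rewrite cf_bv.
rewrite (bigD1 (s' i)) //= s'K eqxx mulr1 big1 ?addr0// => x ne.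
by case: (eqVneq i (s x)) ne => [->|]; rewrite ?sK ?eqxx// mulr0.
Qed.

Lemma cf_lin_mono (X : finType) (c : X -> C) (s s' : X -> X) :
  cancel s s' -> cancel s' s ->
  forall v i, cf (lin (fun k => c k *: bv R (s k)) v) i = c (s' i) * cf v (s' i).
Proof.
move=> sK s'K v i; transitivity (\sum_x cf v x * (c x * (i == s x)%:R)).
  rewrite linE cf_lincomb; apply: eq_bigr => x _.
  by rewrite -cf_bv; congr (_ * _); exact: cfZ.
rewrite (bigD1 (s' i)) //= s'K eqxx mulr1 mulrC big1 ?addr0// => x ne.
by case: (eqVneq i (s x)) ne => [->|]; rewrite ?sK ?eqxx// !mulr0.
Qed.
End Monomial.

Section Operators.
Variables (R : realType) (p : nat).
Local Notation C := R[i].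
Local Notation N := p.+1.
Local Notation om := (omega R p).
Local Notation CN := (CN R p).
Local Notation CN2 := (CN2 R p).
Local Notation opA := (opA R p).
Local Notation opB := (opB R p).
Local Notation opS := (opS R p).

Lemma opA_lin : opA = lin (fun k : 'I_N => q R p ^+ (2 * k) *: bv R k).
Proof. by []. Qed.

Lemma opB_lin : opB = lin (fun k : 'I_N => bv R (ordS k)).
Proof. by []. Qed.

Lemma cf_opA (v : CN) i : cf (opA v) i = om ^+ i * cf v i.
Proof.
by rewrite opA_lin (@cf_lin_mono R _ (fun k : 'I_N => q R p ^+ (2 * k)) id id)// q_even.
Qed.

Lemma cf_opB (v : CN) i : cf (opB v) i = 1 * cf v (i - Zp1).
Proof.
have K1 : cancel (@ordS N) (fun k => k - Zp1) by move=> k; rewrite ordSE addrK.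
have K2 : cancel (fun k => k - Zp1) (@ordS N) by move=> k; rewrite ordSE subrK.
by rewrite mul1r opB_lin (cf_lin_perm K1 K2).
Qed.

End Operators.

Opaque opA opB.

Section Operators2.
Variables (R : realType) (p : nat).
Local Notation C := R[i].
Local Notation N := p.+1.
Local Notation om := (omega R p).
Local Notation CN := (CN R p).
Local Notation CN2 := (CN2 R p).
Local Notation opA := (opA R p).
Local Notation opB := (opB R p).
Local Notation opS := (opS R p).

Lemma opB_inj : lker opB == 0%VS.
Proof.
apply/lker0_inj0 => v Bv; apply: cfP => i; rewrite cf0.
by rewrite -[X in cf v X](addrK Zp1) -[LHS]mul1r -cf_opB Bv cf0.
Qed.

Lemma cf_opBV (v : CN) i : cf (opB^-1%VF v) i = 1 * cf v (i + Zp1).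
Proof. by rewrite -[v in RHS](lker0_lfunVK opB_inj) cf_opB !mul1r addrK. Qed.

Lemma omega_shift (i : 'I_N) : om ^+ i = om * om ^+ (i - Zp1)%R.
Proof. by rewrite omega_D omega_N omega_1 mulrCA divff ?omega_neq0// mulr1. Qed.

Lemma omega_shift' (i : 'I_N) : om ^+ (i + Zp1)%R = om * om ^+ i.
Proof. by rewrite omega_D omega_1 mulrC. Qed.

Lemma opAB v : opA (opB v) = om *: opB (opA v).
Proof.
apply: cfP => i; rewrite -> cfZ, cf_opA, cf_opB, cf_opB, cf_opA.
by rewrite !mul1r mulrA -omega_shift.
Qed.

Lemma opBVA v : opB^-1%VF (opA v) = om *: opA (opB^-1%VF v).
Proof.
apply: cfP => i; rewrite -> cfZ, cf_opBV, cf_opA, cf_opA, cf_opBV.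
by rewrite !mul1r mulrA -omega_shift'.
Qed.

Lemma iter_opB k (v : CN) i : cf (iter k opB v) i = cf v (i - Zp1 *+ k).
Proof.
elim: k i => [|k IH] i; first by rewrite subr0.
by rewrite iterS cf_opB mul1r IH mulrS opprD addrA.
Qed.

Lemma iter_opBV k (v : CN) i : cf (iter k opB^-1%VF v) i = cf v (i + Zp1 *+ k).
Proof.
elim: k i => [|k IH] i; first by rewrite addr0.
by rewrite iterS cf_opBV mul1r IH mulrS addrA.
Qed.

Lemma iter_opA k (v : CN) i : cf (iter k opA v) i = om ^+ i ^+ k * cf v i.
Proof.
elim: k => [|k IH]; first by rewrite mul1r.
by rewrite iterS cf_opA IH mulrA exprS.
Qed.

Lemma Zp1_order : (Zp1 : 'I_N) *+ N = 0.
Proof. by apply: val_inj; rewrite Zp_mulrn /= modnMl. Qed.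

Definition opU : 'End(CN2) :=
  (tensl opB \1 \o tensl \1 opA \o tensl \1 opB^-1)%VF.

Lemma opUE : opU = tensl opB (opA \o opB^-1)%VF.
Proof.
rewrite /opU; rewrite -> tensl_comp, tensl_comp.
by rewrite -> comp_lfun1r, comp_lfun1r, comp_lfun1l.
Qed.

Lemma iter_comp_lfun (V : vectType C) (f : 'End(V)) k v :
  iter k (comp_lfun f) \1%VF v = iter k f v.
Proof. by elim: k => [|k IH] /=; rewrite ?id_lfunE// comp_lfunE IH. Qed.

Lemma iter_tensl (X Y : finType) (f : 'End(Defs.space R X)) (g : 'End(Defs.space R Y)) k :
  iter k (comp_lfun (tensl f g)) \1%VF =
  tensl (iter k (comp_lfun f) \1%VF) (iter k (comp_lfun g) \1%VF).
Proof.
elim: k => [|k IH] /=; first by rewrite tensl1.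
by rewrite IH; exact: tensl_comp.
Qed.

Hypothesis oddN : odd N.

Lemma iter_opBVA k u :
  opB^-1%VF (iter k opA u) = om ^+ k *: iter k opA (opB^-1%VF u).
Proof.
elim: k => [|k IH]; first by rewrite expr0 scale1r.
rewrite !iterS opBVA IH exprS -scalerA; congr (_ *: _); exact: linearZ.
Qed.

(** By the commutation relation (A B^-1)^k = om^binomial(k,2) A^k B^-k. For k = N the exponent is a
    multiple of N, as N is odd, and A^N = B^N = 1. *)
Lemma opABV_order v : iter N (opA \o opB^-1)%VF v = v.
Proof.
have it k : iter k (opA \o opB^-1)%VF v = om ^+ binomial k 2 *: iter k opA (iter k opB^-1%VF v).
  elim: k => [|k IH]; first by rewrite expr0 scale1r.
  rewrite iterS IH comp_lfunE binS bin1 exprD -scalerA !iterS.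
  transitivity (om ^+ binomial k 2 *: opA (opB^-1%VF (iter k opA (iter k opB^-1%VF v)))).
    by rewrite -linearZ -linearZ.
  congr (_ *: _); rewrite iter_opBVA; exact: linearZ.
rewrite it bin2odd// exprM omega_order expr1n scale1r.
apply: cfP => i; rewrite iter_opA iter_opBV Zp1_order addr0.
by rewrite -exprM mulnC exprM omega_order expr1n mul1r.
Qed.

Lemma opU_order v : iter N opU v = v.
Proof.
rewrite -iter_comp_lfun opUE iter_tensl (_ : tensl _ _ = \1%VF) ?id_lfunE//.
rewrite -tensl1; congr tensl; apply/lfunP => u; rewrite iter_comp_lfun id_lfunE.
  by apply: cfP => i; rewrite iter_opB Zp1_order subr0.
exact: opABV_order.
Qed.

End Operators2.

Lemma mem_lker_comm (K : fieldType) (U V : vectType K)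
    (u : 'End(U)) (v : 'End(V)) (f : 'Hom(U, V)) :
  (f \in lker (linfun (fun f : 'Hom(U, V) => (f \o u) - (v \o f)))%VF) =
  ((f \o u)%VF == (v \o f)%VF).
Proof.
rewrite memv_ker linfun_fE ?subr_eq0// => c g h.
rewrite comp_lfunDl comp_lfunDr -comp_lfunZl -comp_lfunZr.
by rewrite scalerBr opprD addrACA.
Qed.

(** X^n - 1 = prod_j (X - om^j) evaluated at c / a and multiplied by a^n. The factors j = 0 and j =
    n agree, which accounts for the shifted range. It is the reason why the dilogarithm is
    N-periodic. *)
Lemma prod_sub_unity (K : fieldType) (n : nat) (om a c : K) :
  n.-primitive_root om -> a != 0 ->
  \prod_(1 <= j < n.+1) (c - a * om ^+ j) = c ^+ n - a ^+ n.
Proof.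
move=> prim a0; have := congr1 (fun P => P.[c / a]) (factor_Xn_sub_1 prim).
rewrite horner_prod hornerD hornerN hornerC hornerXn.
move/(congr1 (fun z => a ^+ n * z)); rewrite mulrBr mulr1 -exprMn [a * _]mulrC divfK// => <-.
have -> : a ^+ n = \prod_(0 <= j < n) a by rewrite prodr_const_nat subn0.
rewrite -big_split /= big_add1 /=; have n0 := prim_order_gt0 prim.
case: n n0 {prim} (prim_expr_order prim) => // n _ omn.
rewrite big_nat_recr //= big_nat_recl //= omn mulrC; congr (_ * _).
  by rewrite !hornerE mulrBr mulrCA divff ?mulr1.
apply: eq_bigr => j _.
by rewrite !hornerE mulrBr mulrCA divff ?mulr1.
Qed.

Section HomW.
Variables (R : realType) (U V : vectType R[i]).

Lemma homWP (a : actions U) (b : actions V) (f : 'Hom(U, V)) :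
  reflect ((f \o a.1)%VF = (b.1 \o f)%VF /\ (f \o a.2)%VF = (b.2 \o f)%VF)
          (f \in homW a b).
Proof.
have -> : (f \in homW a b) =
    ((f \o a.1)%VF == (b.1 \o f)%VF) && ((f \o a.2)%VF == (b.2 \o f)%VF).
  rewrite -(mem_lker_comm a.1 b.1) -(mem_lker_comm a.2 b.2); exact: memv_cap.
by apply: (iffP andP) => -[/eqP ? /eqP ?].
Qed.

End HomW.

(** * The cyclic quantum dilogarithm *)

Section Dilogarithm.
Variables (R : realType) (p : nat).
Local Notation C := R[i].
Local Notation N := p.+1.
Local Notation om := (omega R p).
Variables (a c : C).
Hypotheses (a0 : a != 0) (ac : c ^+ N - a ^+ N = 1).

Lemma wdilogE k : wdilog p a c k = \prod_(1 <= j < k.+1) (c - a * om ^+ j)^-1.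
Proof. by apply: eq_big_nat => j _; rewrite q_even. Qed.

(** A vanishing factor would give c^N = a^N, since om^(jN) = 1. *)
Lemma dilog_factor_neq0 j : c - a * om ^+ j != 0.
Proof.
apply/eqP => e; have : c ^+ N - (a * om ^+ j) ^+ N = 0.
  by move/eqP: e; rewrite subr_eq0 => /eqP ->; rewrite subrr.
rewrite exprMn -exprM mulnC exprM omega_order expr1n mulr1 ac => /eqP.
by rewrite oner_eq0.
Qed.

Lemma wdilogS k : wdilog p a c k.+1 * (c - a * om ^+ k.+1) = wdilog p a c k.
Proof. by rewrite !wdilogE big_nat_recr//= divfK// dilog_factor_neq0. Qed.

Lemma wdilog_neq0 k : wdilog p a c k != 0.
Proof. by rewrite wdilogE prodf_seq_neq0; apply/allP => j _; rewrite invr_neq0 ?dilog_factor_neq0. Qed.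

Lemma wdilog_N : wdilog p a c N = 1.
Proof.
by rewrite wdilogE prodfV (prod_sub_unity c (omega_prim R p) a0) ac invr1.
Qed.

(** The recursion closes up at the last index N - 1 because w(N) = 1 = w(0); hence it holds for
    indices modulo N. *)
Lemma wdilog_shift k :
  wdilog p a c (k.+1 %% N) * (c - a * om ^+ k.+1) = wdilog p a c (k %% N).
Proof.
have kN : (k %% N < N)%N by rewrite ltn_mod.
have -> : om ^+ k.+1 = om ^+ (k %% N).+1 by rewrite !exprS omega_mod.
have -> : (k.+1 %% N = (k %% N).+1 %% N)%N by rewrite -[in LHS]addn1 -modnDml addn1.
rewrite -[RHS]wdilogS; move: kN; rewrite leq_eqVlt => /orP[/eqP ->|kN].
  by rewrite modnn wdilog_N /wdilog big_geq.
by rewrite [(_.+1 %% N)%N]modn_small.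
Qed.

End Dilogarithm.

(** * F commutes with X and Y *)

Section OpF.
Variables (R : realType) (p : nat).
Local Notation C := R[i].
Local Notation N := p.+1.
Local Notation om := (omega R p).
Local Notation CN := (CN R p).
Local Notation CN2 := (CN2 R p).
Local Notation opA := (opA R p).
Local Notation opB := (opB R p).
Local Notation opS := (opS R p).
Local Notation opU := (opU R p).
Variables (root : C -> C) (zeta : C -> C -> C).

Lemma cf_opS w z : cf (opS w) z = cf w (z.1, z.2 - z.1).
Proof.
have K1 : cancel (fun ij : 'I_N * 'I_N => (ij.1, ij.1 + ij.2)) (fun z => (z.1, z.2 - z.1)).
  by case=> i j /=; rewrite addrC addKr.
have K2 : cancel (fun z : 'I_N * 'I_N => (z.1, z.2 - z.1)) (fun ij => (ij.1, ij.1 + ij.2)).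
  by case=> i j /=; rewrite addrC subrK.
exact: (cf_lin_perm K1 K2).
Qed.

Lemma opS_inj : lker opS == 0%VS.
Proof.
apply/lker0_inj0 => w Sw; apply: cfP => -[i j]; rewrite cf0.
have := cf_opS w (i, j + i); rewrite /= addrK => <-.
by rewrite Sw cf0.
Qed.

Hypothesis oddN : odd N.
Hypothesis hroot : root_choice N root.
Hypothesis hzeta : forall a c : C, c ^+ N - a ^+ N = 1 -> zeta a c != 0.

(** The choice in [Phi] is met by [eigen_op_exists]. The reduction modulo N, trivial for k in 'I_N,
    gives the eigenvalues the periodic form required by [eigen_op_shift]. *)
Lemma Phi_eigen a c (k : 'I_N) v : opU v = om ^+ k *: v ->
  Phi p zeta a c opU v = (zeta a c * wdilog p a c (k %% N)) *: v.
Proof.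
rewrite modn_small// /Phi; case: xgetP => [P _ PE|nP]; first by rewrite -q_even => /PE.
have [P PE] := eigen_op_exists (omega_prim R p) (N_neq0 R p) opU (fun k => zeta a c * wdilog p a c k).
by case: (nP P) => {}k {}v; rewrite q_even => /PE.
Qed.

(** S replaces the second index by the sum of both, so the eigenvalue om^(i+j) of A (x) A becomes an
    eigenvalue of A on the second factor. *)
Lemma tensl_opSA : (opS \o tensl opA opA)%VF = (tensl \1 opA \o opS)%VF.
Proof.
apply/lfunP => w; apply: cfP => z; rewrite -> comp_lfunE, comp_lfunE, cf_opS.
rewrite -> (tensl_mono (@cf_opA R p) (@cf_opA R p) w).
rewrite -> (tensl_mono (@cf_id R _) (@cf_opA R p)), cf_opS.
rewrite mul1r; congr (_ * _).
by rewrite -omega_D; congr (om ^+ nat_of_ord _); rewrite /= addrC subrK.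
Qed.

Lemma tensl_opSB : (opS \o tensl \1 opB)%VF = (tensl \1 opB \o opS)%VF.
Proof.
apply/lfunP => w; apply: cfP => z; rewrite -> comp_lfunE, comp_lfunE, cf_opS.
rewrite -> (tensl_mono (@cf_id R _) (@cf_opB R p) w).
rewrite -> (tensl_mono (@cf_id R _) (@cf_opB R p)), cf_opS.
by rewrite /= addrAC.
Qed.
End OpF.

(* [T f g] stands for the tensor product of [f] and [g], and [F] below for
   B_2^-m S Phi(U) with U = B_1 A_2 B_2^-1. *)
Section AbstractF.
Variables (K : fieldType) (V W : vectType K) (T : 'End(V) -> 'End(V) -> 'End(W)).
Hypothesis T_comp : forall f g f' g', (T f' g' \o T f g = T (f' \o f) (g' \o g))%VF.
Hypothesis T_scale : forall f g (a b : K), T (a *: f) (b *: g) = (a * b) *: T f g.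
Variables (N : nat) (om : K).
Hypotheses (om_prim : N.-primitive_root om) (N_neq0 : N%:R != 0 :> K).
Variables (A B : 'End(V)).
Hypotheses (AB : (A \o B)%VF = om *: (B \o A)%VF).
Hypothesis (BVA : (B^-1 \o A)%VF = om *: (A \o B^-1)%VF).
Hypothesis B_inj : lker B == 0%VS.
Let U := T B (A \o B^-1)%VF.
Hypothesis U_order : forall v, iter N U v = v.

Let T_scale_r f g (b : K) : T f (b *: g) = b *: T f g.
Proof. by have := T_scale f g 1 b; rewrite scale1r mul1r. Qed.

Let T_scale_l f g (a : K) : T (a *: f) g = a *: T f g.
Proof. by have := T_scale f g a 1; rewrite scale1r mulr1. Qed.

Lemma abs_U_AA : (U \o T A A)%VF = (T A A \o U)%VF.
Proof. by rewrite /U !T_comp AB -comp_lfunA BVA -comp_lfunZr T_scale_r T_scale_l comp_lfunA. Qed.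

(** Consequently the action a T B A + b T 1 B of Y on the tensor product factors as (a U + b) T 1 B.
    As T 1 B raises the eigenvalue of U by one power of om, the recursion of the dilogarithm turns
    the factor a U + b into the constant d. *)
Lemma abs_UB : (U \o T \1 B)%VF = T B A.
Proof. by rewrite /U T_comp comp_lfun1r lker0_compfVK. Qed.

Lemma abs_U_shift v : U (T \1%VF B v) = om *: T \1%VF B (U v).
Proof.
rewrite -!comp_lfunE -scale_lfunE abs_UB; congr (fun_of_lfun _ v).
rewrite /U T_comp comp_lfun1l -T_scale_r; congr (T _ _).
by rewrite comp_lfunA comp_lfunZl -AB lker0_compfK.
Qed.

Variables (P S : 'End(W)) (f : nat -> K) (a b d : K).
Hypothesis P_eigen : forall (k : 'I_N) v, U v = om ^+ k *: v -> P v = f k *: v.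
Hypothesis f_mod : forall k, f (k %% N)%N = f k.
Hypothesis f_shift : forall k, f k.+1 * (a * om ^+ k.+1 + b) = d * f k.
Hypothesis f_neq0 : forall k, f k != 0.
Hypothesis S_inj : lker S == 0%VS.
Hypothesis SA : (S \o T A A)%VF = (T \1 A \o S)%VF.
Hypothesis SB : (S \o T \1 B)%VF = (T \1 B \o S)%VF.
Variable m : nat.
Let Bm := iter m (comp_lfun (T \1 B^-1))%VF \1%VF.
Let F := (Bm \o S \o P)%VF.

(** Moving A past each B^-1 costs one factor om. This is the purpose of B_2^-m in F: it corrects the
    discrepancy between the root of x x' and the product of the roots. *)
Let BmA : (Bm \o T \1 A)%VF = om ^+ m *: (T \1 A \o Bm)%VF.
Proof.
rewrite /Bm; elim: m => [|k IH]; first by rewrite scale1r comp_lfun1l comp_lfun1r.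
rewrite iterS -comp_lfunA IH -comp_lfunZr !comp_lfunA !T_comp !comp_lfun1l BVA.
by rewrite T_scale_r -comp_lfunZl scalerA -exprSr.
Qed.

Let BmB : (Bm \o T \1 B)%VF = (T \1 B \o Bm)%VF.
Proof.
rewrite /Bm; elim: m => [|k IH]; first by rewrite comp_lfun1l comp_lfun1r.
rewrite iterS -comp_lfunA IH !comp_lfunA !T_comp !comp_lfun1l.
by rewrite lker0_compVf// lker0_compfV.
Qed.

Hypothesis T1 : T \1%VF \1%VF = \1%VF.

Lemma abs_F_inj : lker F == 0%VS.
Proof.
apply/lker0_inj0 => v; rewrite /F !comp_lfunE => Fv.
have P_inj := eigen_op_inj om_prim N_neq0 U_order P_eigen (fun k _ => f_neq0 k).
apply: (lker0_inj0 _ P_inj); apply: (lker0_inj0 _ S_inj); move: Fv.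
move: (S _) => u; rewrite /Bm; elim: (m) => [|k IH]; first by rewrite id_lfunE.
rewrite iterS comp_lfunE => /(congr1 (T \1%VF B)).
by rewrite linear0 -comp_lfunE T_comp comp_lfun1l lker0_compfV// T1 id_lfunE.
Qed.

Lemma abs_F_X : (F \o T A A)%VF = om ^+ m *: (T \1 A \o F)%VF.
Proof.
rewrite /F -!comp_lfunA (eigen_op_commute om_prim N_neq0 U_order P_eigen abs_U_AA).
by rewrite (comp_lfunA S) SA !comp_lfunA BmA !comp_lfunZl.
Qed.

Lemma abs_F_Y : (F \o (a *: T B A + b *: T \1 B))%VF = d *: (T \1 B \o F)%VF.
Proof.
rewrite -abs_UB /F -!comp_lfunA.
rewrite (eigen_op_shift om_prim N_neq0 U_order P_eigen abs_U_shift f_mod f_shift).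
by rewrite -!comp_lfunZr (comp_lfunA S) SB !comp_lfunA BmB.
Qed.

End AbstractF.

Section OpF.
Variables (R : realType) (p : nat).
Local Notation C := R[i].
Local Notation N := p.+1.
Local Notation om := (omega R p).
Variables (root : C -> C) (zeta : C -> C -> C).
Hypothesis oddN : odd N.
Hypothesis hroot : root_choice N root.
Hypothesis hzeta : forall a c : C, c ^+ N - a ^+ N = 1 -> zeta a c != 0.

Local Notation A := (opA R p).
Local Notation B := (opB R p).
Local Notation T := (@tensl R 'I_N 'I_N 'I_N 'I_N).

Let T_comp f g f' g' : (T f' g' \o T f g = T (f' \o f) (g' \o g))%VF := tensl_comp f g f' g'.
Let T_scale f g (a b : C) : T (a *: f) (b *: g) = (a * b) *: T f g := tenslZ f g a b.

Let AB : (A \o B)%VF = om *: (B \o A)%VF.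
Proof.
apply/lfunP => v; transitivity (A (B v)); first exact: comp_lfunE.
transitivity (om *: (B (A v))); first exact: opAB.
symmetry; rewrite -[B (A v)]comp_lfunE; exact: scale_lfunE.
Qed.

Let BVA : (B^-1 \o A)%VF = om *: (A \o B^-1)%VF.
Proof.
apply/lfunP => v; transitivity (B^-1%VF (A v)); first exact: comp_lfunE.
transitivity (om *: (A (B^-1%VF v))); first exact: opBVA.
symmetry; rewrite -[A (_ v)]comp_lfunE; exact: scale_lfunE.
Qed.

Let U_order v : iter N (T B (A \o B^-1)%VF) v = v.
Proof. by rewrite -opUE opU_order. Qed.

Section FixedWeights.
Variables (x y x' y' : C).
Hypotheses (x0 : x != 0) (y0 : y != 0) (x'0 : x' != 0) (y'0 : y' != 0).
Hypothesis d0 : y * x' + y' != 0.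
Let d := root (y * x' + y').
Let a := - (root y * root x' / d).
Let c := root y' / d.

Let rd0 : d != 0. Proof. exact: (root_neq0 hroot). Qed.
Let a0 : a != 0.
Proof. by rewrite oppr_eq0 !mulf_neq0 ?invr_neq0// ?(root_neq0 hroot). Qed.

(** Since N is odd, a^N = - y x' / (y x' + y'), while c^N = y' / (y x' + y'). *)
Let ac : c ^+ N - a ^+ N = 1.
Proof.
rewrite /c /a exprNn -signr_odd oddN expr1 mulN1r opprK !exprMn !exprVn !(root_expr hroot)//.
by rewrite -mulrDl addrC divff.
Qed.

Let f k := zeta a c * wdilog p a c (k %% N).
Let f_mod k : f (k %% N) = f k. Proof. by rewrite /f modn_mod. Qed.
Let f_neq0 k : f k != 0. Proof. by rewrite mulf_neq0 ?hzeta ?wdilog_neq0. Qed.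
(** The factor a U + b in the action of Y, with coefficients root y root x' and root y', is d times
    the factor c - a om^j of the dilogarithm; this explains the parameters of F. *)
Let f_shift k : f k.+1 * (root y * root x' * om ^+ k.+1 + root y') = d * f k.
Proof.
have -> : root y * root x' * om ^+ k.+1 + root y' = d * (c - a * om ^+ k.+1).
  by rewrite /c /a mulNr opprK mulrDr mulrCA divff// mulr1 addrC mulrA [d * _]mulrCA divff// mulr1.
by rewrite /f -(wdilog_shift a0 ac k) mulrCA !mulrA.
Qed.

Let P_eigen (k : 'I_N) v : T B (A \o B^-1)%VF v = om ^+ k *: v ->
  Phi p zeta a c (opU R p) v = f k *: v.
Proof. by rewrite -opUE; exact: Phi_eigen. Qed.

Let prim := omega_prim R p.
Let N0 := N_neq0 R p.
Let Binj := opB_inj R p.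

Lemma opF_pair_inj : lker (opF p root zeta (x, y) (x', y')) == 0%VS.
Proof.
exact: (abs_F_inj T_comp prim N0 Binj U_order P_eigen f_neq0 (@opS_inj R p) _ (tensl1 _ _ _)).
Qed.

Lemma opF_pair_X : let F := opF p root zeta (x, y) (x', y') in
  (F \o T (root x *: A) (root x' *: A) = T \1 (root (x * x') *: A) \o F)%VF.
Proof.
move=> F; have E : (F \o T A A)%VF = om ^+ (mexp p root x x') *: (T \1 A \o F)%VF.
  exact: (abs_F_X T_comp T_scale prim N0 AB BVA U_order P_eigen (@tensl_opSA R p)).
rewrite T_scale -comp_lfunZr E scalerA comp_lfunZl; congr (_ \o _)%VF.
rewrite -[\1%VF in RHS]scale1r T_scale mul1r; congr (_ *: _).
by rewrite (mexpP hroot)// -mulrA mulrC.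
Qed.

Lemma opF_pair_Y : let F := opF p root zeta (x, y) (x', y') in
  (F \o (T (root y *: B) (root x' *: A) + T \1 (root y' *: B)) = T \1 (d *: B) \o F)%VF.
Proof.
move=> F.
have E : (F \o ((root y * root x') *: T B A + root y' *: T \1 B))%VF = d *: (T \1 B \o F)%VF.
  exact: (abs_F_Y T_comp T_scale prim N0 AB Binj U_order P_eigen f_mod f_shift (@tensl_opSB R p)).
have Z k : T \1%VF (k *: B) = k *: T \1%VF B.
  by rewrite -[\1%VF in LHS]scale1r T_scale mul1r.
transitivity (d *: (T \1%VF B \o F)%VF); last by rewrite -> Z; exact: comp_lfunZl.
rewrite -E; congr (_ \o _)%VF; congr (_ + _); [exact: T_scale | exact: Z].
Qed.

End FixedWeights.

Variables (l l' : weight R).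
Hypotheses (hl : nonsing l) (hl' : nonsing l') (hll' : nonsing (wmul l l')).
Local Notation F := (opF p root zeta l l').

Lemma opF_inj : lker F == 0%VS.
Proof.
case: l l' hl hl' hll' => [x y] [x' y'] /andP[/= x0 y0] /andP[/= x'0 y'0] /andP[/= _ d0].
exact: opF_pair_inj.
Qed.

Lemma opF_X : (F \o (tens_act (V_ p root l) (V_ p root l')).1 =
  T \1 (V_ p root (wmul l l')).1 \o F)%VF.
Proof.
case: l l' hl hl' hll' => [x y] [x' y'] /andP[/= x0 y0] /andP[/= x'0 y'0] /andP[/= _ d0].
exact: opF_pair_X.
Qed.

Lemma opF_Y : (F \o (tens_act (V_ p root l) (V_ p root l')).2 =
  T \1 (V_ p root (wmul l l')).2 \o F)%VF.
Proof.
case: l l' hl hl' hll' => [x y] [x' y'] /andP[/= x0 y0] /andP[/= x'0 y'0] /andP[/= _ d0].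
exact: opF_pair_Y.
Qed.

End OpF.

(** * Rotation of intertwiners *)

Section Phases.
Variables (R : realType) (p : nat).
Local Notation C := R[i].
Local Notation N := p.+1.
Local Notation om := (omega R p).
Variable root : C -> C.
Hypothesis oddN : odd N.
Hypothesis hroot : root_choice N root.

Lemma ordS_ind (P : 'I_N -> Prop) :
  P 0 -> (forall i, P i -> P (i + Zp1)) -> forall i, P i.
Proof.
move=> P0 PS i; have -> : i = Zp1 *+ i.
  apply: val_inj; rewrite Zp_mulrn /=; case: p i {P P0 PS} => [|n] i.
    by rewrite (ord1 i).
  by rewrite modn_small ?mul1n ?modn_small.
by elim: (i : nat) => [|k IH]; rewrite ?mulr0n// mulrSr; exact: PS.
Qed.

(* q^(i(i-1)) *)
Definition gauss (i : 'I_N) : C := om ^+ binomial i 2.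

Lemma omega_binS k : om ^+ binomial k.+1 2 = om ^+ binomial k 2 * om ^+ k.
Proof. by rewrite binS bin1 exprD. Qed.

(** At i = N - 1 the index wraps to 0, and oddness of N gives om^binomial(N,2) = 1. *)
Lemma gaussS (i : 'I_N) : gauss (i + Zp1) = gauss i * om ^+ i.
Proof.
rewrite /gauss -omega_binS -ordSE /=; have := ltn_ord i.
rewrite leq_eqVlt => /orP[/eqP ->|iN]; last by rewrite modn_small.
by rewrite modnn [in RHS]bin2odd// exprM omega_order expr1n.
Qed.

Lemma gauss_neq0 i : gauss i != 0.
Proof. by rewrite expf_neq0 ?omega_neq0. Qed.

Lemma omega_ord_neq0 (i : 'I_N) : om ^+ i != 0.
Proof. by rewrite expf_neq0 ?omega_neq0. Qed.

Lemma gaussN (i : 'I_N) : gauss (- i) = om ^+ i * gauss i.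
Proof.
elim/ordS_ind: i => [|i IH]; first by rewrite oppr0 mul1r.
have := gaussS (- (i + Zp1)); rewrite [in LHS]opprD addrNK IH omega_N gaussS => e.
by rewrite [gauss i * _]mulrC e mulrCA divff ?omega_ord_neq0// mulr1.
Qed.

Definition mdual (l : weight R) : nat := mexp p root l.2 l.1^-1.

(* The coefficients of [opC l] and of [opD (wdual l)], see [cf_opC], [cf_opD]. *)
Definition beta (l : weight R) (i : 'I_N) : C :=
  (om ^+ (- i : 'I_N) ^+ mdual l)^-1 * (gauss (- i))^-1.

Definition alpha (l : weight R) (i : 'I_N) : C :=
  (om ^+ (- i : 'I_N) ^+ mdual (wdual l))^-1 * gauss (- i).

(** Passing from the root of y to that of - y x^-1 and back to that of - y, by [mexpP] twice,
    returns minus the root of y, so the two discrepancies cancel. *)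
Lemma omega_mdual l : nonsing l -> om ^+ mdual l * om ^+ mdual (wdual l) = 1.
Proof.
case: l => x y /andP[/= x0 y0]; rewrite /mdual /wdual /=.
have xV0 : x^-1 != 0 by rewrite invr_neq0.
have yx0 : - y * x^-1 != 0 by rewrite mulf_neq0 ?oppr_eq0.
have := mexpP hroot yx0 (invr_neq0 xV0).
rewrite invrK mulfVK// (root_opp hroot)// mulNr (root_opp hroot) ?mulf_neq0//.
rewrite (mexpP hroot y0 xV0) (root_inv hroot)//.
have := root_neq0 hroot y0; have := root_neq0 hroot x0.
move: (om ^+ _) (om ^+ _) (root x) (root y) => u v rx ry rx0 ry0 e.
by apply: (mulIf ry0); apply: oppr_inj; rewrite mul1r e; field.
Qed.

Lemma alpha_beta l i : nonsing l -> alpha l i * beta l i = 1.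
Proof.
move=> hl; rewrite /alpha /beta mulrACA divff ?gauss_neq0// mulr1 -invfM.
have E k : om ^+ (- i : 'I_N) ^+ k = om ^+ k ^+ (- i : 'I_N) by rewrite exprAC.
rewrite !E -exprMn [om ^+ mdual _ * _]mulrC omega_mdual//.
by rewrite expr1n invr1.
Qed.

(** In a full turn every side is met once by C and once by D. The exponents m then cancel, and the
    Gauss phases at i and -i differ by om^i. *)
Lemma beta_dual l i : beta (wdual l) i * alpha l (- i) = (om ^+ i)^-1.
Proof.
rewrite /beta /alpha opprK omega_N mulrACA -invfM -exprMn mulVf ?omega_ord_neq0//.
by rewrite expr1n invr1 mul1r gaussN invfM mulfVK ?gauss_neq0.
Qed.

Lemma betaE l i : beta l i = om ^+ i ^+ mdual l * (gauss (- i))^-1.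
Proof. by rewrite /beta omega_N exprVn invrK. Qed.

Lemma betaS l i : beta l (i + Zp1) * om ^+ (i + Zp1)%R = om ^+ mdual l * beta l i.
Proof.
have := gaussS (- (i + Zp1)); rewrite [in LHS]opprD addrNK omega_N !betaE => ->.
rewrite invfM invrK {1}omega_shift' exprMn -!mulrA; by congr (_ * (_ * _)).
Qed.

Lemma beta_neq0 l i : beta l i != 0.
Proof.
by rewrite betaE; apply: mulf_neq0; rewrite ?invr_neq0 ?gauss_neq0// 2?expf_neq0 ?omega_neq0.
Qed.

Lemma alphaS l i : nonsing l ->
  om ^+ mdual l * alpha l (i + Zp1) = om ^+ (i + Zp1)%R * alpha l i.
Proof.
move=> hl; apply: (mulIf (beta_neq0 l i)); rewrite -[RHS]mulrA alpha_beta// mulr1.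
rewrite mulrAC -betaS mulrAC [beta _ _ * _]mulrC alpha_beta// mul1r.
by [].
Qed.

End Phases.

(** The Y-equation of a rotated tensor with all entries replaced by variables. [HX] and [HY] are the
    X- and Y-equations of the original tensor; M1 and M3 are the powers om^m of two of the
    weights. *)
Lemma rot_shift_identity (K : fieldType)
    (r1 r2 r3 s1 s2 s3 om u v J A B F1 F2 F3 M1 M3 : K) :
  r1 != 0 -> r3 != 0 -> om != 0 -> J != 0 -> B != 0 -> M1 != 0 -> M3 != 0 ->
  r3 * B^-1 * F1 = r1 * r2 * (om * J)^-1 * A * F1 ->
  s3 * F3 = s1 * r2 * A * F1 + s2 * F2 ->
  - (M1 * s1 * r1^-1) * (M1^-1 * (om * J * u) * v * F1) =
  s2 * r3^-1 * B * (u * v * F2) + - (M3 * s3 * r3^-1) * (u * (M3^-1 * (B * v)) * F3).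
Proof.
move=> r10 r30 om0 J0 B0 M10 M30 HX HY.
have HX' : om * J * F1 = r1 * r2 * A * B * r3^-1 * F1.
  transitivity (om * J * B * r3^-1 * (r3 * B^-1 * F1)); first by field; rewrite r30 B0.
  by rewrite HX; field; rewrite r30 J0 om0.
transitivity (- (s1 * r1^-1 * u * v * (om * J * F1))); first by field; rewrite r10 M10.
rewrite HX'; transitivity (u * v * B * r3^-1 * (s2 * F2 - s3 * F3)).
  by rewrite HY; field; rewrite r30 r10.
by field; rewrite r30 M30.
Qed.

Section Intertwiners.
Variables (R : realType) (p : nat).
Local Notation C := R[i].
Local Notation N := p.+1.
Local Notation om := (omega R p).
Local Notation CN := (CN R p).
Local Notation CN2 := (CN2 R p).
Local Notation opA := (opA R p).
Local Notation opB := (opB R p).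
Variable root : C -> C.

(** Commutation with X and Y in coordinates; f i a k is the coefficient of e_i (x) e_a in the image
    of e_k. *)
Definition intertwiner (m l l' : weight R) (f : 'I_N -> 'I_N -> 'I_N -> C) : Prop :=
  (forall i a k : 'I_N, root m.1 * om ^+ k * f i a k =
     root l.1 * root l'.1 * om ^+ i * om ^+ a * f i a k) /\
  (forall i a k : 'I_N, root m.2 * f i a (k + Zp1) =
     root l.2 * root l'.1 * om ^+ a * f (i - Zp1) a k + root l'.2 * f i (a - Zp1) k).

Lemma opA_bv (k : 'I_N) : opA (bv R k) = om ^+ k *: bv R k.
Proof. by rewrite opA_lin lin_bv q_even. Qed.

Lemma opB_bv (k : 'I_N) : opB (bv R k) = bv R (k + Zp1).
Proof. by rewrite opB_lin lin_bv ordSE. Qed.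

Lemma cf_V1 l (v : CN) i : cf ((V_ p root l).1 v) i = (root l.1 * om ^+ i) * cf v i.
Proof. by rewrite -mulrA -cf_opA; exact: cf_homZ. Qed.

Lemma cf_V2 l (v : CN) i : cf ((V_ p root l).2 v) i = root l.2 * cf v (i - Zp1).
Proof. by rewrite -[cf v _]mul1r -cf_opB; exact: cf_homZ. Qed.

Lemma cf_hom_V1 m (V : finType) (f : 'Hom(CN, Defs.space R V)) k z :
  cf ((f \o (V_ p root m).1)%VF (bv R k)) z = root m.1 * om ^+ k * cf (f (bv R k)) z.
Proof.
transitivity (cf ((root m.1 * om ^+ k) *: f (bv R k)) z); last exact: cfZ.
rewrite comp_lfunE -linearZ /=; congr (cf (f _) z).
by rewrite -scalerA -opA_bv; exact: scale_lfunE.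
Qed.

Lemma cf_hom_V2 m (V : finType) (f : 'Hom(CN, Defs.space R V)) k z :
  cf ((f \o (V_ p root m).2)%VF (bv R k)) z = root m.2 * cf (f (bv R (k + Zp1))) z.
Proof.
transitivity (cf (root m.2 *: f (bv R (k + Zp1))) z); last exact: cfZ.
rewrite comp_lfunE -linearZ /=; congr (cf (f _) z).
by rewrite -opB_bv; exact: scale_lfunE.
Qed.

Lemma cf_tens_act1 l l' (v : CN2) z :
  cf ((tens_act (V_ p root l) (V_ p root l')).1 v) z =
  root l.1 * root l'.1 * om ^+ z.1 * om ^+ z.2 * cf v z.
Proof.
have -> : (tens_act (V_ p root l) (V_ p root l')).1 =
  tensl (V_ p root l).1 (V_ p root l').1 by [].
rewrite -> (tensl_mono (@cf_V1 l) (@cf_V1 l')).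
by case: z => i j; rewrite mulrACA !mulrA.
Qed.

Lemma cf_tens_act2 l l' (v : CN2) i a :
  cf ((tens_act (V_ p root l) (V_ p root l')).2 v) (i, a) =
  root l.2 * root l'.1 * om ^+ a * cf v (i - Zp1, a) + root l'.2 * cf v (i, a - Zp1).
Proof.
transitivity (cf (tensl (V_ p root l).2 (V_ p root l').1 v) (i, a) +
  cf (tensl \1%VF (V_ p root l').2 v) (i, a)); first exact: cf_homD.
rewrite -> (tensl_mono (@cf_V2 l) (@cf_V1 l')).
rewrite -> (tensl_mono (@cf_id R _) (@cf_V2 l')).
by rewrite mul1r !mulrA.
Qed.

Lemma homV_cfP m l l' (f : 'Hom(CN, CN2)) :
  f \in homV p root m l l' <-> intertwiner m l l' (fun i a k => cf (f (bv R k)) (i, a)).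
Proof.
split=> [/homWP[fX fY]|[fX fY]].
  split=> i a k.
    by rewrite -cf_hom_V1 fX comp_lfunE; exact: cf_tens_act1.
  by rewrite -cf_hom_V2 fY comp_lfunE; exact: cf_tens_act2.
apply/homWP; split; apply: hom_bvP => k; apply: cfP => -[i a].
  by rewrite cf_hom_V1 fX comp_lfunE; symmetry; exact: cf_tens_act1.
by rewrite cf_hom_V2 fY comp_lfunE; symmetry; exact: cf_tens_act2.
Qed.

Hypothesis oddN : odd N.
Hypothesis hroot : root_choice N root.

(** The map [AHom_fun] in coordinates, see [cf_AHom_fun], available for arbitrary tensors so that it
    can be iterated without membership proofs. *)
Definition rot_tensor (l l' : weight R) (f : 'I_N -> 'I_N -> 'I_N -> C) : 'I_N -> 'I_N -> 'I_N -> C :=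
  fun a b j => alpha root l j * beta root (wmul l l') b * f (- j) a (- b).

Lemma root_wdual1 l : nonsing l -> root (wdual l).1 = (root l.1)^-1.
Proof. by case/andP => l0 _; rewrite (root_inv hroot). Qed.

Lemma root_wdual2 l : nonsing l ->
  root (wdual l).2 = - (om ^+ mdual p root l * root l.2 * (root l.1)^-1).
Proof.
case: l => x y /andP[/= x0 y0].
rewrite mulNr (root_opp hroot) ?mulf_neq0 ?invr_neq0//; congr (- _).
by rewrite (mexpP hroot) ?invr_neq0// (root_inv hroot).
Qed.

(** The factor om^m by which the root of the second entry of the dual weight deviates from the
    expected quotient is the factor produced by shifting the index of [alpha] or [beta]. With these
    cancelled, the Y-equation follows from the old X- and Y-equations. *)
Lemma rot_intertwiner l l' f : nonsing l -> nonsing l' -> nonsing (wmul l l') ->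
  intertwiner (wmul l l') l l' f ->
  intertwiner (wdual l) l' (wdual (wmul l l')) (rot_tensor l l' f).
Proof.
move=> hl hl' hll' [fX fY]; set l3 := wmul l l' in hll' fX fY *.
have /andP[/(root_neq0 hroot) r10 /(root_neq0 hroot) s10] := hl.
have /andP[/(root_neq0 hroot) r20 /(root_neq0 hroot) s20] := hl'.
have /andP[/(root_neq0 hroot) r30 /(root_neq0 hroot) s30] := hll'.
split=> a b j; rewrite /rot_tensor -/l3.
  rewrite !root_wdual1//; have := fX (- j) a (- b); rewrite !omega_N.
  have := omega_ord_neq0 R j; have := omega_ord_neq0 R b.
  move: (f _ _ _) (alpha _ _ _) (beta _ _ _) => F u v.
  move: (om ^+ j) (om ^+ b) (om ^+ a) => J B A B0 J0 e.
  transitivity (u * v * J * B * (root l.1)^-1 * (root l3.1)^-1 * (root l3.1 * B^-1 * F)).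
    by field; rewrite r10 B0 r30.
  by rewrite e; field; rewrite r10 J0 r30.
rewrite root_wdual1// !root_wdual2//.
have e1 : alpha root l (j + Zp1) = (om ^+ mdual p root l)^-1 * (om * om ^+ j * alpha root l j).
  have M0 : om ^+ mdual p root l != 0 by rewrite expf_neq0 ?omega_neq0.
  by apply: (mulfI M0); rewrite (alphaS oddN hroot) // mulVKf// omega_shift'.
have e2 : beta root l3 (b - Zp1) = (om ^+ mdual p root l3)^-1 * (om ^+ b * beta root l3 b).
  have M0 : om ^+ mdual p root l3 != 0 by rewrite expf_neq0 ?omega_neq0.
  by apply: (mulfI M0); rewrite -(betaS root oddN) subrK mulVKf// mulrC.
have := fX (- (j + Zp1)) a (- b); have := fY (- j) a (- b).
rewrite !omega_N e1 e2 omega_shift' opprD opprB [_ + Zp1]addrC => HY HX.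
rewrite -/l3 in HX *.
have := @rot_shift_identity _ (root l.1) (root l'.1) (root l3.1) (root l.2) (root l'.2) (root l3.2)
  om (alpha root l j) (beta root l3 b) (om ^+ j) (om ^+ a) (om ^+ b)
  (f (- j - Zp1) a (- b)) (f (- j) (a - Zp1) (- b)) (f (- j) a (Zp1 - b))
  (om ^+ mdual p root l) (om ^+ mdual p root l3).
by apply => //; rewrite ?omega_neq0 ?omega_ord_neq0 ?expf_neq0 ?omega_neq0.
Qed.

End Intertwiners.

Lemma comp_intertwine (K : fieldType) (U V W : vectType K) (g : 'Hom(U, V)) (f : 'Hom(V, W)) X Y Z :
  (g \o X = Y \o g)%VF -> (f \o Y = Z \o f)%VF -> ((f \o g) \o X = Z \o (f \o g))%VF.
Proof. by move=> gX fY; rewrite -comp_lfunA gX comp_lfunA fY comp_lfunA. Qed.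

Section OpAA.
Variables (R : realType) (p : nat).
Local Notation C := R[i].
Local Notation N := p.+1.
Local Notation om := (omega R p).
Local Notation CN := (CN R p).
Local Notation CN2 := (CN2 R p).
Variables (root : C -> C) (zeta : C -> C -> C).

Lemma opC_lin l : opC p root l = lin (fun k : 'I_N =>
  (q R p ^- (2 * k * mexp p root l.2 l.1^-1) * q R p ^- (k * k.-1)) *: bv R (- k)).
Proof. by []. Qed.

Lemma opD_lin l : opD p root l = lin (fun k : 'I_N =>
  (q R p ^- (2 * k * mexp p root l.2 l.1^-1) * q R p ^+ (k * k.-1)) *: bv R (- k)).
Proof. by []. Qed.

Lemma q_gauss (k : 'I_N) : q R p ^+ (k * k.-1) = gauss R k.
Proof. by rewrite -[k.-1]bin1 mul_bin_diag q_even. Qed.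

Lemma cf_opC l (v : CN) i : cf (opC p root l v) i = beta root l i * cf v (- i).
Proof.
rewrite opC_lin (cf_lin_mono _ (@opprK _) (@opprK _)).
by rewrite q_gauss -mulnA q_even exprM.
Qed.

Lemma cf_opD l (v : CN) i : cf (opD p root (wdual l) v) i = alpha root l i * cf v (- i).
Proof.
rewrite opD_lin (cf_lin_mono _ (@opprK _) (@opprK _)).
by rewrite q_gauss -mulnA q_even exprM.
Qed.

Lemma cf_AHom_fun l l' (f : 'Hom(CN, CN2)) j a b :
  cf (AHom_fun root l l' f (bv R j)) (a, b) =
  rot_tensor root l l' (fun i a k => cf (f (bv R k)) (i, a)) a b j.
Proof.
rewrite AHom_fun_cf; set s := \sum_j _; lazy zeta; rewrite lin_bv.
transitivity (cf (tensl (opD p root (wdual l)) (tensl \1%VF (opC p root (wmul l l'))) s) (j, (a, b))).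
  exact: cf_finfun.
rewrite -> (tensl_mono (@cf_opD l) (tensl_mono (@cf_id R _) (@cf_opC (wmul l l')))).
rewrite mul1r /rot_tensor; congr (_ * _).
transitivity (\sum_k cf (f (bv R k)) (- j, a) * (- b == k)%:R).
  rewrite /s; rewrite -> cf_sum; apply: eq_bigr => k _.
  transitivity (cf (tensv (f (bv R k)) (bv R k)) (- j, a, - b)); first exact: cf_tensA.
  by rewrite -cf_bv; exact: cf_tensv.
rewrite (bigD1 (- b)) //= eqxx mulr1 big1 ?addr0// => k ne.
by rewrite eq_sym (negbTE ne) mulr0.
Qed.

Hypothesis oddN : odd N.
Hypothesis hroot : root_choice N root.
Hypothesis hzeta : forall a c : C, c ^+ N - a ^+ N = 1 -> zeta a c != 0.

Section Pair.
Variables (l l' : weight R).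
Hypotheses (hl : nonsing l) (hl' : nonsing l') (hll' : nonsing (wmul l l')).
Local Notation F := (opF p root zeta l l').
Local Notation H := (homV p root (wmul l l') l l').

(** The intertwiner given by h before [opI] projects it to Hom_W. *)
Definition multI (h : CN) : 'Hom(CN, CN2) := linfun (fun v : CN => F^-1%VF (tensv h v)).

Lemma tensv_linear_r (h : CN) : linear (fun v : CN => tensv h v).
Proof.
move=> a u v; apply: cfP => z.
transitivity (cf (a *: tensv h u) z + cf (tensv h v) z); last by symmetry; exact: cfD.
transitivity (a * cf (tensv h u) z + cf (tensv h v) z); last by congr (_ + _); symmetry; exact: cfZ.
rewrite -> cf_tensv, cf_tensv, cf_tensv.
transitivity (cf h z.1 * (a * cf u z.2 + cf v z.2)); last by rewrite mulrDr mulrCA.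
congr (_ * _); transitivity (cf (a *: u) z.2 + cf v z.2); first exact: cfD.
by congr (_ + _); exact: cfZ.
Qed.

Lemma multIE h v : multI h v = F^-1%VF (tensv h v).
Proof.
apply: (linfun_fE (f := fun v : CN => F^-1%VF (tensv h v))) => a u w.
by rewrite tensv_linear_r linearP.
Qed.

Let Finj : lker F == 0%VS. Proof. exact: opF_inj. Qed.

Lemma multI_hom h : multI h \in H.
Proof.
have key (X : 'End(CN)) (Y : 'End(CN2)) : (F \o Y = tensl \1 X \o F)%VF ->
    (multI h \o X = Y \o multI h)%VF.
  move=> FY; apply/lfunP => v; rewrite comp_lfunE [RHS]comp_lfunE.
  have [-> ->] := (multIE h (X v), multIE h v).
  apply: (can_inj (lker0_lfunK Finj)); rewrite lker0_lfunVK//.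
  rewrite -[RHS]comp_lfunE FY comp_lfunE lker0_lfunVK// tensl_v; congr tensv.
  by rewrite id_lfunE.
by apply/homWP; split; apply: key; [exact: opF_X | exact: opF_Y].
Qed.

Lemma omega_ord_inj (i k : 'I_N) : om ^+ i = om ^+ k -> i = k.
Proof.
move/eqP; rewrite (eq_prim_root_expr (omega_prim R p)) !modn_small// => /eqP.
exact: val_inj.
Qed.

(** Schur's lemma: F g commutes with the action on the second factor. The X-equation makes it
    diagonal in the second index, the Y-equation makes it constant along the diagonal, so F g has
    the form v |-> h (x) v with h read off at index 0. *)
Lemma hom_multI g : g \in H -> exists h, g = multI h.
Proof.
case/homWP=> gX gY; pose f := (F \o g)%VF.
have fX : (f \o (V_ p root (wmul l l')).1 = tensl \1 (V_ p root (wmul l l')).1 \o f)%VF.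
  by apply: comp_intertwine gX _; exact: opF_X.
have fY : (f \o (V_ p root (wmul l l')).2 = tensl \1 (V_ p root (wmul l l')).2 \o f)%VF.
  by apply: comp_intertwine gY _; exact: opF_Y.
have /andP[/(root_neq0 hroot) r1 /(root_neq0 hroot) r2] := hll'.
have cX h i k : cf (f (bv R k)) (h, i) = (i == k)%:R * cf (f (bv R k)) (h, i).
  have : root (wmul l l').1 * om ^+ k * cf (f (bv R k)) (h, i) =
      1 * (root (wmul l l').1 * om ^+ i) * cf (f (bv R k)) (h, i).
    rewrite -cf_hom_V1 fX comp_lfunE.
    exact: (tensl_mono (@cf_id R _) (@cf_V1 _ _ root (wmul l l'))).
  rewrite mul1r => e; case: eqVneq => [_|ne]; rewrite ?mul1r// mul0r.
  apply/eqP/contraT => f0; move/eqP: ne; case.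
  by apply/esym/omega_ord_inj; move: e => /(mulIf f0) /(mulfI r1).
have cY h i k : cf (f (bv R (k + Zp1))) (h, i) = cf (f (bv R k)) (h, i - Zp1).
  apply: (mulfI r2); rewrite -cf_hom_V2 fY comp_lfunE -[X in _ = X * _]mul1r.
  exact: (tensl_mono (@cf_id R _) (@cf_V2 _ _ root (wmul l l'))).
pose v : CN := \sum_h cf (f (bv R 0)) (h, 0) *: bv R h.
have cv h : cf v h = cf (f (bv R 0)) (h, 0).
  rewrite /v; rewrite -> cf_lincomb; rewrite (bigD1 h) //= cf_bv eqxx mulr1.
  by rewrite big1 ?addr0// => k ne; rewrite cf_bv eq_sym (negbTE ne) mulr0.
exists v; apply: hom_bvP => k; rewrite multIE.
apply: (can_inj (lker0_lfunK Finj)); rewrite lker0_lfunVK//.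
rewrite -comp_lfunE -/f; apply: cfP => -[h i].
transitivity (cf v h * cf (bv R k) i); last by symmetry; exact: cf_tensv.
rewrite cX cv cf_bv mulrC; case: eqVneq => [->|]; rewrite ?mulr0//.
congr (_ * _); elim/ordS_ind: k {i} => // k IH.
by rewrite cY addrK.
Qed.

Lemma multI_linear : linear multI.
Proof.
move=> a u v; apply/lfunP => w.
transitivity (a *: multI u w + multI v w); last first.
  by symmetry; rewrite -scale_lfunE; exact: add_lfunE.
rewrite !multIE -linearP; congr (fun_of_lfun _ _); apply: cfP => z.
transitivity (cf (a *: tensv u w) z + cf (tensv v w) z); last by symmetry; exact: cfD.
transitivity (a * cf (tensv u w) z + cf (tensv v w) z); last by congr (_ + _); symmetry; exact: cfZ.
transitivity (cf (a *: u + v) z.1 * cf w z.2); first exact: cf_tensv.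
transitivity (a * (cf u z.1 * cf w z.2) + cf v z.1 * cf w z.2); last first.
  by congr (_ * _ + _); symmetry; exact: cf_tensv.
transitivity ((a * cf u z.1 + cf v z.1) * cf w z.2); last by rewrite mulrDl mulrA.
congr (_ * _); transitivity (cf (a *: u) z.1 + cf v z.1); first exact: cfD.
by congr (_ + _); exact: cfZ.
Qed.

Lemma opIE h : vsval (opI p root zeta l l' h) = multI h.
Proof.
have -> : opI p root zeta l l' h = vsproj H (multI h); last exact/vsprojK/multI_hom.
apply: (linfun_fE (f := fun f : CN => vsproj H (multI f))) => a u v.
by rewrite multI_linear linearP.
Qed.

Lemma opI_inj : lker (opI p root zeta l l') == 0%VS.
Proof.
apply/lker0_inj0 => h /(congr1 vsval); rewrite opIE linear0 => e.
apply: cfP => i; rewrite cf0; have := congr1 (fun g : 'Hom(CN, CN2) => F (g (bv R 0))) e.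
rewrite multIE lker0_lfunVK// zero_lfunE linear0 => /(congr1 (fun v => cf v (i, 0))).
rewrite cf0 => <-; transitivity (cf h i * cf (bv R (0 : 'I_N)) 0).
  by rewrite cf_bv eqxx mulr1.
by symmetry; exact: cf_tensv.
Qed.

Lemma opIV g : opI p root zeta l l' ((opI p root zeta l l')^-1%VF g) = g.
Proof.
apply: limg_lfunVK; have [h gh] := hom_multI (subvsP g).
have -> : g = opI p root zeta l l' h by apply: val_inj; rewrite /= opIE.
exact: memv_img (memvf _).
Qed.

(** By [rot_intertwiner] the rotated map is already in Hom_W, so the projection leaves it
    unchanged. *)
Lemma AHomE (g : subvs_of H) :
  vsval (AHom p root l l' g) = AHom_fun root l l' (vsval g).
Proof.
have L : linear (@AHom_fun R p root l l').
  move=> a u v; apply: hom_bvP => j; apply: cfP => -[x y].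
  transitivity (a * cf (AHom_fun root l l' u (bv R j)) (x, y) + cf (AHom_fun root l l' v (bv R j)) (x, y)).
    pose G f := rot_tensor root l l' (fun i a k => cf (f (bv R k)) (i, a)) x y j.
    transitivity (G (a *: u + v)); first exact: cf_AHom_fun.
    transitivity (a * G u + G v); last by congr (_ * _ + _); symmetry; exact: cf_AHom_fun.
    rewrite /G /rot_tensor; move: (_ * beta _ _ _) => c.
    transitivity (c * (a * cf (u (bv R (- y))) (- j, x) + cf (v (bv R (- y))) (- j, x))).
      2: by rewrite mulrDr mulrCA.
    congr (_ * _).
    transitivity (cf ((a *: u) (bv R (- y))) (- j, x) + cf (v (bv R (- y))) (- j, x)).
      exact: cf_homD.
    by congr (_ + _); exact: cf_homZ.
  by symmetry; rewrite -cf_homZ; exact: cf_homD.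
have -> : AHom p root l l' g = vsproj _ (AHom_fun root l l' (vsval g)).
  apply: (linfun_fE (f := fun f => vsproj _ (AHom_fun root l l' (vsval f)))) => a u v.
  by rewrite linearP L linearP.
apply: vsprojK; apply/homV_cfP; rewrite wmul_rot//.
have := rot_intertwiner oddN hroot hl hl' hll' (iffLR (homV_cfP _ _ _ _ _) (subvsP g)).
by case=> gX gY; split=> i a k; rewrite !cf_AHom_fun.
Qed.

End Pair.

End OpAA.

(** * The coefficients of F^-1 *)

Section Coupling.
Variables (R : realType) (p : nat).
Local Notation C := R[i].
Local Notation N := p.+1.
Local Notation om := (omega R p).
Local Notation CN := (CN R p).
Local Notation CN2 := (CN2 R p).
Variables (root : C -> C) (zeta : C -> C -> C).
Hypothesis oddN : odd N.
Hypothesis hroot : root_choice N root.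
Hypothesis hzeta : forall a c : C, c ^+ N - a ^+ N = 1 -> zeta a c != 0.

(** Clebsch-Gordan coefficients: h is the multiplicity index, and i, j, k belong to l, l' and their
    product. *)
Definition coupling (l l' : weight R) (h i j k : 'I_N) : C :=
  cf ((opF p root zeta l l')^-1%VF (bv R (h, k))) (i, j).

Definition opAA_cf (l l' : weight R) (h h' : 'I_N) : C :=
  cf (opAA p root zeta l l' (bv R h)) h'.

Lemma cf_multI l l' (h : CN) i j k :
  cf (multI root zeta l l' h (bv R k)) (i, j) =
  \sum_h' cf h h' * coupling l l' h' i j k.
Proof.
rewrite multIE.
transitivity (\sum_x cf (tensv h (bv R k)) x * cf ((opF p root zeta l l')^-1%VF (bv R x)) (i, j)).
  exact: cf_hom.
transitivity (\sum_h' \sum_k' (cf h h' * (k' == k)%:R) * coupling l l' h' i j k').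
  rewrite pair_bigA /=; apply: eq_bigr => -[h' k'] _; congr (_ * _).
  by rewrite -cf_bv; exact: cf_tensv.
apply: eq_bigr => h' _; rewrite (bigD1 k) //= eqxx mulr1 big1 ?addr0// => k' ne.
by rewrite (negbTE ne) mulr0 mul0r.
Qed.

Lemma cf_multI_bv l l' h i j k :
  cf (multI root zeta l l' (bv R h) (bv R k)) (i, j) = coupling l l' h i j k.
Proof.
rewrite cf_multI (bigD1 h) //= cf_bv eqxx mul1r big1 ?addr0// => h' ne.
by rewrite cf_bv (negbTE ne) mul0r.
Qed.

Section Pair.
Variables (l l' : weight R).
Hypotheses (hl : nonsing l) (hl' : nonsing l') (hll' : nonsing (wmul l l')).
Local Notation F := (opF p root zeta l l').

Lemma coupling_intertwiner h : intertwiner root (wmul l l') l l' (coupling l l' h).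
Proof.
have := iffLR (homV_cfP _ _ _ _ _) (multI_hom oddN hroot hzeta hl hl' hll' (bv R h)).
by case=> gX gY; split=> i a k; have := gX i a k; have := gY i a k; rewrite !cf_multI_bv.
Qed.

Lemma coupling_support : exists2 c : C, c != 0 &
  forall h (i j k : 'I_N), om ^+ i * om ^+ j * coupling l l' h i j k = c * om ^+ k * coupling l l' h i j k.
Proof.
have /andP[/(root_neq0 hroot) r1 _] := hl.
have /andP[/(root_neq0 hroot) r2 _] := hl'.
have /andP[/(root_neq0 hroot) r3 _] := hll'.
exists (root (wmul l l').1 / (root l.1 * root l'.1)).
  by rewrite mulf_neq0 ?invr_neq0 ?mulf_neq0.
move=> h i j k; have [gX _] := coupling_intertwiner h.
have r0 : root l.1 * root l'.1 != 0 by rewrite mulf_neq0.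
apply: (mulfI r0); transitivity (root l.1 * root l'.1 * om ^+ i * om ^+ j * coupling l l' h i j k).
  by rewrite !mulrA.
by rewrite -gX [RHS]mulrA; congr (_ * _); rewrite mulrA; congr (_ * _); rewrite mulrCA divff ?mulr1.
Qed.

Lemma coupling_inj (v : 'I_N -> 'I_N -> C) :
  (forall i j, \sum_h \sum_k v h k * coupling l l' h i j k = 0) -> forall h k, v h k = 0.
Proof.
move=> v0 h k; pose w : CN2 := \sum_hk v hk.1 hk.2 *: bv R hk.
have cw : cf w (h, k) = v h k.
  rewrite /w; rewrite -> cf_lincomb; rewrite (bigD1 (h, k)) //= cf_bv eqxx mulr1.
  by rewrite big1 ?addr0// => x ne; rewrite cf_bv eq_sym (negbTE ne) mulr0.
have Finj := opF_inj oddN hroot hzeta hl hl' hll'.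
suff w0 : F^-1%VF w = 0 by rewrite -cw -[w](lker0_lfunVK Finj) w0 linear0 cf0.
rewrite /w linear_sum; apply: cfP => -[i j]; rewrite cf0 -[RHS](v0 i j) pair_bigA /=.
rewrite -> cf_sum; apply: eq_bigr => x _; rewrite linearZ /= ; case: x => h' k'.
exact: cfZ.
Qed.

Lemma multI_inj (u v : CN) : multI root zeta l l' u = multI root zeta l l' v -> u = v.
Proof.
by rewrite -!(opIE oddN hroot hzeta hl hl' hll') => /val_inj; apply/lker0P/opI_inj.
Qed.

Lemma nonsing_rot : nonsing (wmul l' (wdual (wmul l l'))).
Proof. by rewrite wmul_rot// nonsing_dual. Qed.

Lemma multI_opAA v : multI root zeta l' (wdual (wmul l l')) (opAA p root zeta l l' v) =
  AHom_fun root l l' (multI root zeta l l' v).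
Proof.
have hd := nonsing_dual hll'.
rewrite -(opIE oddN hroot hzeta hl' hd nonsing_rot) -(opIE oddN hroot hzeta hl hl' hll').
rewrite -(AHomE oddN hroot hl hl' hll'); congr vsval.
rewrite /opAA; rewrite -> comp_lfunE, comp_lfunE.
exact: (opIV oddN hroot hzeta hl' hd nonsing_rot).
Qed.

(** The definition of the operator A read in coordinates: a rotation of the tensor amounts to A
    acting on the multiplicity index. *)
Lemma rot_coupling h a b j :
  rot_tensor root l l' (coupling l l' h) a b j =
  \sum_h' opAA_cf l l' h h' * coupling l' (wdual (wmul l l')) h' a b j.
Proof.
transitivity (cf (multI root zeta l' (wdual (wmul l l')) (opAA p root zeta l l' (bv R h)) (bv R j)) (a, b)).
  rewrite multI_opAA cf_AHom_fun /rot_tensor; congr (_ * _); exact/esym/cf_multI_bv.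
exact: cf_multI.
Qed.

(** If A v = 0, the rotated tensor of v vanishes; its phases are nonzero, so the tensor of v itself
    vanishes. *)
Lemma opAA_inj : lker (opAA p root zeta l l') == 0%VS.
Proof.
apply/lker0_inj0 => v Av; apply: multI_inj.
have e := multI_opAA v; rewrite Av in e.
apply: hom_bvP => k; apply: cfP => -[i j].
have := congr1 (fun g : 'Hom(CN, CN2) => cf (g (bv R (- i))) (j, - k)) e.
rewrite /= cf_AHom_fun /rot_tensor !opprK => {}e.
have ab0 : alpha root l (- i) * beta root (wmul l l') (- k) != 0.
  rewrite mulf_neq0 ?beta_neq0//; apply: contraTneq isT => a0.
  by have := alpha_beta hroot (- i) hl; rewrite a0 mul0r => /eqP; rewrite eq_sym oner_eq0.
have z0 l1 l2 i' j' k' : cf (multI root zeta l1 l2 (0 : CN) (bv R k')) (i', j') = 0.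
  by rewrite cf_multI big1// => h' _; rewrite cf0 mul0r.
by apply: (mulfI ab0); rewrite -e !z0 mulr0.
Qed.

End Pair.
End Coupling.

(** * The operator T *)

Section At2.
Variable R : realType.
Local Notation C := R[i].
Local Notation sp := (Defs.space R).
Variables (X J : finType) (i j : J).
Hypothesis ij : i != j.

Definition upd2 (h : {ffun J -> X}) (p : X * X) : {ffun J -> X} :=
  [ffun k => if k == i then p.1 else if k == j then p.2 else h k].

Lemma at2_lin (O : 'End(sp (X * X)%type)) :
  at2 i j O = lin (fun h : {ffun J -> X} => \sum_p cf (O (bv R (h i, h j))) p *: bv R (upd2 h p)).
Proof. exact: at2_cf. Qed.

Lemma upd2_l h p : upd2 h p i = p.1. Proof. by rewrite ffunE eqxx. Qed.
Lemma upd2_r h p : upd2 h p j = p.2. Proof. by rewrite ffunE eq_sym (negbTE ij) eqxx. Qed.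
Lemma upd2_id h : upd2 h (h i, h j) = h.
Proof. by apply/ffunP => k; rewrite ffunE; case: eqP => [->//|_]; case: eqP => [->|]. Qed.
Lemma upd2_upd2 h p p' : upd2 (upd2 h p) p' = upd2 h p'.
Proof. by apply/ffunP => k; rewrite !ffunE; case: (k == i) => //; case: (k == j). Qed.

Lemma cf_at2 (O : 'End(sp (X * X)%type)) v h :
  cf (at2 i j O v) h = \sum_p cf v (upd2 h p) * cf (O (bv R p)) (h i, h j).
Proof.
transitivity (\sum_g cf v g * \sum_p cf (O (bv R (g i, g j))) p * (h == upd2 g p)%:R).
  rewrite at2_lin linE; rewrite -> cf_lincomb; apply: eq_bigr => g _; congr (_ * _).
  by rewrite -> cf_lincomb; apply: eq_bigr => p _; rewrite cf_bv.
transitivity (\sum_g cf v g * (cf (O (bv R (g i, g j))) (h i, h j) * (h == upd2 g (h i, h j))%:R)).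
  apply: eq_bigr => g _; congr (_ * _); rewrite (bigD1 (h i, h j)) //= big1 ?addr0// => p ne.
  case: eqP => [e|]; rewrite ?mulr0//; move: ne; rewrite e upd2_l upd2_r -surjective_pairing.
  by rewrite eqxx.
rewrite (partition_big (fun g : {ffun J -> X} => (g i, g j)) predT) //=; apply: eq_bigr => p _.
rewrite (bigD1 (upd2 h p)) /=; last by rewrite upd2_l upd2_r -surjective_pairing.
rewrite upd2_l upd2_r -surjective_pairing upd2_upd2 upd2_id eqxx mulr1.
rewrite big1 ?addr0// => g /andP[/eqP gp ne]; case: eqP => [e|]; rewrite ?mulr0//.
by move: ne; rewrite e upd2_upd2 -gp upd2_id eqxx.
Qed.

End At2.

Section Triples.
Variables (K : comNzRingType) (X : finType).

Definition pair_op (o : X * X -> X * X -> K) (u : X -> X -> K) : X -> X -> K :=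
  fun i j => \sum_p u p.1 p.2 * o p (i, j).

Lemma pair_op_lin o k u w i j :
  pair_op o (fun x y => k * u x y + w x y) i j = k * pair_op o u i j + pair_op o w i j.
Proof.
rewrite /pair_op big_distrr -big_split /=; apply: eq_bigr => p _.
by rewrite mulrDl mulrA.
Qed.

Lemma pair_opZ o k u i j : pair_op o (fun x y => k * u x y) i j = k * pair_op o u i j.
Proof. by rewrite /pair_op big_distrr /=; apply: eq_bigr => p _; rewrite mulrA. Qed.

Definition op12 o (v : X -> X -> X -> K) a b c := pair_op o (fun x y => v x y c) a b.
Definition op23 o (v : X -> X -> X -> K) a b c := pair_op o (v a) b c.
Definition op13 o (v : X -> X -> X -> K) a b c := pair_op o (fun x y => v x b y) a c.
Definition op21 o (v : X -> X -> X -> K) a b c := pair_op o (fun y x => v x y c) b a.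
End Triples.

Definition slot1 : 'I_3 := inord 0.
Definition slot2 : 'I_3 := inord 1.
Definition slot3 : 'I_3 := inord 2.

Lemma slot12 : slot1 != slot2. Proof. by rewrite -val_eqE /= !inordK. Qed.
Lemma slot13 : slot1 != slot3. Proof. by rewrite -val_eqE /= !inordK. Qed.
Lemma slot23 : slot2 != slot3. Proof. by rewrite -val_eqE /= !inordK. Qed.

Lemma slotP (P : 'I_3 -> Prop) : P slot1 -> P slot2 -> P slot3 -> forall k, P k.
Proof.
move=> P1 P2 P3 k; have : (val k < 3)%N := ltn_ord k.
have e (s : 'I_3) m : (m < 3)%N -> s = inord m -> val k = m -> k = s.
  by move=> m3 -> km; apply: val_inj; rewrite /= km inordK.
case E : (val k) => [|[|[|]]] // _.
- by rewrite (e slot1 0%N).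
- by rewrite (e slot2 1%N).
by rewrite (e slot3 2%N).
Qed.

Section TripleSpace.
Variables (R : realType) (X : finType).
Local Notation C := R[i].
Local Notation sp := (Defs.space R).

Definition trip (a b c : X) : {ffun 'I_3 -> X} :=
  [ffun k => if k == slot1 then a else if k == slot2 then b else c].

Lemma trip1 a b c : trip a b c slot1 = a. Proof. by rewrite ffunE eqxx. Qed.
Lemma trip2 a b c : trip a b c slot2 = b.
Proof. by rewrite ffunE eq_sym (negbTE slot12) eqxx. Qed.
Lemma trip3 a b c : trip a b c slot3 = c.
Proof. by rewrite ffunE eq_sym (negbTE slot13) eq_sym (negbTE slot23). Qed.
Lemma trip_eta (h : {ffun 'I_3 -> X}) : h = trip (h slot1) (h slot2) (h slot3).
Proof. by apply/ffunP; apply: slotP; rewrite ?trip1 ?trip2 ?trip3. Qed.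

Definition cf3 (v : sp {ffun 'I_3 -> X}) a b c : C := cf v (trip a b c).
Definition mcf (O : 'End(sp (X * X)%type)) (p r : X * X) : C := cf (O (bv R p)) r.

Let E := (eqxx, negbTE slot12, negbTE slot13, negbTE slot23, eq_sym slot2 slot1,
  eq_sym slot3 slot1, eq_sym slot3 slot2).

Lemma cf3_at12 O v : cf3 (at2 slot1 slot2 O v) = op12 (mcf O) (cf3 v).
Proof.
apply/funext => a; apply/funext => b; apply/funext => c; rewrite /cf3 (cf_at2 slot12) trip1 trip2.
apply: eq_bigr => p _; congr (cf v _ * _).
by apply/ffunP; apply: slotP; rewrite !ffunE !E.
Qed.

Lemma cf3_at23 O v : cf3 (at2 slot2 slot3 O v) = op23 (mcf O) (cf3 v).
Proof.
apply/funext => a; apply/funext => b; apply/funext => c; rewrite /cf3 (cf_at2 slot23) trip2 trip3.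
apply: eq_bigr => p _; congr (cf v _ * _).
by apply/ffunP; apply: slotP; rewrite !ffunE !E.
Qed.

Lemma cf3_at13 O v : cf3 (at2 slot1 slot3 O v) = op13 (mcf O) (cf3 v).
Proof.
apply/funext => a; apply/funext => b; apply/funext => c; rewrite /cf3 (cf_at2 slot13) trip1 trip3.
apply: eq_bigr => p _; congr (cf v _ * _).
by apply/ffunP; apply: slotP; rewrite !ffunE !E.
Qed.

Lemma cf3_at21 O v : cf3 (at2 slot2 slot1 O v) = op21 (mcf O) (cf3 v).
Proof.
have ne : slot2 != slot1 by rewrite eq_sym slot12.
apply/funext => a; apply/funext => b; apply/funext => c; rewrite /cf3 (cf_at2 ne) trip1 trip2.
apply: eq_bigr => p _; congr (cf v _ * _).
by apply/ffunP; apply: slotP; rewrite !ffunE !E.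
Qed.

Lemma cf3_inj v w : cf3 v = cf3 w -> v = w.
Proof.
move=> vw; apply: cfP => h; rewrite [h]trip_eta.
exact: (congr1 (fun f => f _ _ _) vw).
Qed.

Lemma mcf_comp O O' u : pair_op (mcf (O \o O')%VF) u = pair_op (mcf O) (pair_op (mcf O') u).
Proof.
apply/funext => i; apply/funext => j; rewrite /pair_op.
transitivity (\sum_p \sum_r u p.1 p.2 * (mcf O' p r * mcf O r (i, j))).
  by apply: eq_bigr => p _; rewrite -big_distrr /=; congr (_ * _); exact: cf_comp.
rewrite exchange_big; apply: eq_bigr => -[a b] _ /=; rewrite big_distrl /=.
by apply: eq_bigr => p _; rewrite mulrA.
Qed.

Lemma mcf1 u : pair_op (mcf \1%VF) u = u.
Proof.
apply/funext => i; apply/funext => j; rewrite /pair_op (bigD1 (i, j)) //= /mcf id_lfunE cf_bv eqxx mulr1.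
by rewrite big1 ?addr0// => p ne; rewrite id_lfunE cf_bv eq_sym (negbTE ne) mulr0.
Qed.

Section At2Inverse.
Variables (i j : 'I_3) (opij : (X * X -> X * X -> C) -> (X -> X -> X -> C) -> X -> X -> X -> C).
Hypothesis cf3_at : forall O v, cf3 (at2 i j O v) = opij (mcf O) (cf3 v).
Hypothesis opij_comp : forall O O' v, opij (mcf (O \o O')%VF) v = opij (mcf O) (opij (mcf O') v).
Hypothesis opij1 : forall v, opij (mcf \1%VF) v = v.
Variable O : 'End(sp (X * X)%type).
Hypothesis O_inj : lker O == 0%VS.

Let at2K u : opij (mcf O^-1%VF) (cf3 (at2 i j O u)) = cf3 u.
Proof.
transitivity (opij (mcf (O^-1 \o O)%VF) (cf3 u)).
  symmetry; transitivity (opij (mcf O^-1%VF) (opij (mcf O) (cf3 u))); first exact: opij_comp.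
  by congr opij; symmetry; exact: cf3_at.
have -> : (O^-1 \o O)%VF = \1%VF by exact: lker0_compVf.
exact: opij1.
Qed.

Lemma at2_inj : lker (at2 i j O) == 0%VS.
Proof.
apply/lker0_inj0 => v Ov; apply: cf3_inj.
by rewrite -(at2K v) -(at2K 0) Ov linear0.
Qed.

(** [opT] uses inverses of the embedded operators. Embedding is multiplicative and unital, so the
    coordinates of such an inverse are those of the embedded inverse. *)
Lemma cf3_at2V v : cf3 ((at2 i j O)^-1%VF v) = opij (mcf O^-1%VF) (cf3 v).
Proof. by rewrite -(at2K ((at2 i j O)^-1%VF v)) (lker0_lfunVK at2_inj). Qed.

End At2Inverse.

Lemma op12_comp O O' v : op12 (mcf (O \o O')%VF) v = op12 (mcf O) (op12 (mcf O') v).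
Proof.
apply/funext => a; apply/funext => b; apply/funext => c.
exact: (congr1 (fun f => f a b) (mcf_comp O O' (fun x y => v x y c))).
Qed.

Lemma op23_comp O O' v : op23 (mcf (O \o O')%VF) v = op23 (mcf O) (op23 (mcf O') v).
Proof. by apply/funext => a; exact: (mcf_comp O O' (v a)). Qed.

Lemma op13_comp O O' v : op13 (mcf (O \o O')%VF) v = op13 (mcf O) (op13 (mcf O') v).
Proof.
apply/funext => a; apply/funext => b; apply/funext => c.
exact: (congr1 (fun f => f a c) (mcf_comp O O' (fun x y => v x b y))).
Qed.

Lemma op12_1 v : op12 (mcf \1%VF) v = v.
Proof.
apply/funext => a; apply/funext => b; apply/funext => c.
exact: (congr1 (fun f => f a b) (mcf1 (fun x y => v x y c))).
Qed.

Lemma op23_1 v : op23 (mcf \1%VF) v = v.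
Proof. by apply/funext => a; exact: (mcf1 (v a)). Qed.

Lemma op13_1 v : op13 (mcf \1%VF) v = v.
Proof.
apply/funext => a; apply/funext => b; apply/funext => c.
exact: (congr1 (fun f => f a c) (mcf1 (fun x y => v x b y))).
Qed.

(** A kernel vector of O becomes a kernel vector of the embedded operator when tensored with e_c0 in
    the third factor. *)
Lemma lker0_of_at21 (O : 'End(sp (X * X)%type)) (c0 : X) :
  lker (at2 slot2 slot1 O) == 0%VS -> lker O == 0%VS.
Proof.
move=> /lker0_inj0 Tinj; apply/lker0_inj0 => v Ov; apply: cfP => -[b a]; rewrite cf0.
pose w : sp {ffun 'I_3 -> X} :=
  \sum_(q : X * X) cf v q *: bv R (trip q.2 q.1 c0).
have cw x y z : cf3 w x y z = (z == c0)%:R * cf v (y, x).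
  rewrite /cf3 /w; rewrite -> cf_lincomb; rewrite (bigD1 (y, x)) //= cf_bv mulrC.
  rewrite big1 ?addr0 => [|[y' x'] ne].
    congr (_%:R * _); congr nat_of_bool; apply/eqP/eqP => [e|->//].
    by rewrite -(trip3 x y z) e trip3.
  rewrite cf_bv; case: eqP => [e|]; rewrite ?mulr0//; case/eqP: ne.
  by congr pair; [have := trip2 x y z | have := trip1 x y z]; rewrite e ?trip1 ?trip2.
have w0 : w = 0.
  apply: Tinj; apply: cf3_inj; rewrite cf3_at21.
  apply/funext => x; apply/funext => y; apply/funext => z.
  rewrite /op21 /pair_op.
  transitivity ((z == c0)%:R * \sum_q cf v q * mcf O q (y, x)).
    by rewrite big_distrr /=; apply: eq_bigr => -[y' x'] _; rewrite cw mulrA.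
  have <- : cf (O v) (y, x) = \sum_q cf v q * mcf O q (y, x) by exact: cf_hom.
  by rewrite Ov cf0 mulr0 /cf3 cf0.
have := cw a b c0; rewrite w0 /cf3 cf0 eqxx mul1r => <-.
by [].
Qed.

End TripleSpace.

Section Delta.
Variables (K : pzRingType) (X Y : finType).

Lemma sum_delta (x : X) (F : X -> K) : \sum_z (z == x)%:R * F z = F x.
Proof.
by rewrite (bigD1 x) //= eqxx mul1r big1 ?addr0// => z ne; rewrite (negbTE ne) mul0r.
Qed.

Lemma sum_delta_fst (x : X) (F : X * Y -> K) :
  \sum_p (p.1 == x)%:R * F p = \sum_y F (x, y).
Proof.
transitivity (\sum_z \sum_y (z == x)%:R * F (z, y)).
  by rewrite pair_bigA; apply: eq_bigr => -[].
rewrite exchange_big /=.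
by apply: eq_bigr => y _; rewrite sum_delta.
Qed.

Lemma sum_delta_snd (y : Y) (F : X * Y -> K) :
  \sum_p (p.2 == y)%:R * F p = \sum_x F (x, y).
Proof.
transitivity (\sum_x \sum_z (z == y)%:R * F (x, z)).
  by rewrite pair_bigA; apply: eq_bigr => -[].
apply: eq_bigr => x _.
by rewrite (bigD1 y) //= eqxx mul1r big1 ?addr0// => z ne; rewrite (negbTE ne) mul0r.
Qed.
End Delta.

Section PairRelations.
Variables (R : realType) (p : nat).
Local Notation C := R[i].
Local Notation N := p.+1.
Local Notation om := (omega R p).
Variables (root : C -> C) (zeta : C -> C -> C).
Hypothesis oddN : odd N.
Hypothesis hroot : root_choice N root.
Hypothesis hzeta : forall a c : C, c ^+ N - a ^+ N = 1 -> zeta a c != 0.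

(** X and Y in coordinates: [act1], [act2] on V_l (x) V_l', and [snd1], [snd2] on the second factor
    of M (x) V_m. *)
Definition act1 (l l' : weight R) (u : 'I_N -> 'I_N -> C) : 'I_N -> 'I_N -> C :=
  fun i j => root l.1 * root l'.1 * om ^+ i * om ^+ j * u i j.
Definition act2 (l l' : weight R) (u : 'I_N -> 'I_N -> C) : 'I_N -> 'I_N -> C :=
  fun i j => root l.2 * root l'.1 * om ^+ j * u (i - Zp1) j + root l'.2 * u i (j - Zp1).
Definition snd1 (m : weight R) (u : 'I_N -> 'I_N -> C) : 'I_N -> 'I_N -> C :=
  fun i j => root m.1 * om ^+ j * u i j.
Definition snd2 (m : weight R) (u : 'I_N -> 'I_N -> C) : 'I_N -> 'I_N -> C :=
  fun i j => root m.2 * u i (j - Zp1).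

Section Pair.
Variables (l l' : weight R).
Hypotheses (hl : nonsing l) (hl' : nonsing l') (hll' : nonsing (wmul l l')).
Let F := opF p root zeta l l'.
Let o := mcf F.
Let g := mcf F^-1%VF.

Lemma opFV_1 u : pair_op g (snd1 (wmul l l') u) = act1 l l' (pair_op g u).
Proof.
apply/funext => i; apply/funext => j; rewrite /pair_op /act1 /snd1 big_distrr /=.
apply: eq_bigr => -[x y] _ /=; rewrite mulrAC [RHS]mulrCA [RHS]mulrC; congr (_ * _).
have [gX _] := coupling_intertwiner oddN hroot hzeta hl hl' hll' x; exact: gX.
Qed.

Lemma opFV_2 u : pair_op g (snd2 (wmul l l') u) = act2 l l' (pair_op g u).
Proof.
apply/funext => i; apply/funext => j; rewrite /pair_op /act2 /snd2.
rewrite !big_distrr -big_split /=.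
rewrite (reindex_inj (h := fun q : 'I_N * 'I_N => (q.1, q.2 + Zp1))); last first.
  by move=> [x y] [x' y'] /= e; congr pair; [have := congr1 fst e | apply: (addIr Zp1); have := congr1 snd e].
apply: eq_bigr => -[x y] _ /=; rewrite addrK mulrAC.
have [_ gY] := coupling_intertwiner oddN hroot hzeta hl hl' hll' x.
have := gY i j y; rewrite /coupling -/F => e.
transitivity (u x y * (root (wmul l l').2 * g (x, y + Zp1) (i, j))).
  by rewrite mulrC mulrA.
by rewrite /g /mcf e mulrDr !mulrA; congr (_ + _); ring.
Qed.

Lemma opFK u : pair_op g (pair_op o u) = u.
Proof. by rewrite -mcf_comp lker0_compVf ?mcf1//; exact: opF_inj. Qed.

Lemma opFVK u : pair_op o (pair_op g u) = u.
Proof. by rewrite -mcf_comp lker0_compfV ?mcf1//; exact: opF_inj. Qed.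

Lemma opF_1 u : pair_op o (act1 l l' u) = snd1 (wmul l l') (pair_op o u).
Proof. by rewrite -{1}[u]opFK -opFV_1 opFVK. Qed.

Lemma opF_2 u : pair_op o (act2 l l' u) = snd2 (wmul l l') (pair_op o u).
Proof. by rewrite -{1}[u]opFK -opFV_2 opFVK. Qed.
End Pair.

Section Triple.
Variables (l1 l2 l3 : weight R).
Let l4 := wmul l1 l2.
Let l5 := wmul l2 l3.
Let l0 := wmul l4 l3.
Hypotheses (h1 : nonsing l1) (h2 : nonsing l2) (h3 : nonsing l3).
Hypotheses (h4 : nonsing l4) (h5 : nonsing l5) (h0 : nonsing l0).
Let l0E : wmul l1 l5 = l0. Proof. exact: wmulA. Qed.
Let h0' : nonsing (wmul l1 l5). Proof. by rewrite l0E. Qed.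
Local Notation T3 := ('I_N -> 'I_N -> 'I_N -> C).

Let o1 := mcf (opF p root zeta l1 l5).
Let o2 := mcf (opF p root zeta l2 l3).
Let g3 := mcf (opF p root zeta l1 l2)^-1%VF.
Let g4 := mcf (opF p root zeta l4 l3)^-1%VF.
Let L (v : T3) : T3 := op13 o1 (op23 o2 (op12 g3 (op23 g4 v))).

Let t1 (v : T3) : T3 := fun a b c => root l0.1 * om ^+ c * v a b c.
Let t2 (v : T3) : T3 := fun a b c => root l0.2 * v a b (c - Zp1).
Let D1 (v : T3) : T3 := fun a b c =>
  root l1.1 * root l2.1 * root l3.1 * om ^+ a * om ^+ b * om ^+ c * v a b c.
Let D2 (v : T3) : T3 := fun a b c =>
  root l1.2 * root l2.1 * root l3.1 * om ^+ b * om ^+ c * v (a - Zp1) b c +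
  root l2.2 * root l3.1 * om ^+ c * v a (b - Zp1) c + root l3.2 * v a b (c - Zp1).

Let T3P (v w : T3) : (forall a b c, v a b c = w a b c) -> v = w.
Proof. by move=> vw; apply/funext => a; apply/funext => b; apply/funext => c. Qed.

Let P2 (v w : 'I_N -> 'I_N -> C) : (forall a b, v a b = w a b) -> v = w.
Proof. by move=> vw; apply/funext => a; apply/funext => b. Qed.

(* [L] intertwines the action on the third factor because, on both sides of
   [F_13 F_23 (F_23 F_12)^-1], that action corresponds to [D1], [D2]. *)
Let Q1 v : op12 g3 (op23 g4 (t1 v)) = D1 (op12 g3 (op23 g4 v)).
Proof.
have -> : op23 g4 (t1 v) = fun a => act1 l4 l3 (op23 g4 v a).
  by apply/funext => a; exact: (opFV_1 h4 h3 h0 (v a)).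
move: (op23 g4 v) => w; apply: T3P => a b c; rewrite /op12 /D1.
transitivity (root l3.1 * om ^+ c * pair_op g3 (snd1 l4 (fun x y => w x y c)) a b).
  by rewrite -pair_opZ; congr (pair_op _ _ a b); apply: P2 => x y; rewrite /act1 /snd1; ring.
by rewrite (opFV_1 h1 h2 h4) /act1; ring.
Qed.

Let Q2 v : op12 g3 (op23 g4 (t2 v)) = D2 (op12 g3 (op23 g4 v)).
Proof.
have -> : op23 g4 (t2 v) = fun a => act2 l4 l3 (op23 g4 v a).
  by apply/funext => a; exact: (opFV_2 h4 h3 h0 (v a)).
move: (op23 g4 v) => w; apply: T3P => a b c; rewrite /op12 /D2.
transitivity (root l3.1 * om ^+ c * pair_op g3 (snd2 l4 (fun x y => w x y c)) a b +
   root l3.2 * pair_op g3 (fun x y => w x y (c - Zp1)) a b).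
  rewrite -(pair_opZ _ (root l3.2)) -pair_op_lin; congr (pair_op _ _ a b); apply: P2 => x y.
  by rewrite /act2 /snd2; ring.
by rewrite (opFV_2 h1 h2 h4) /act2; ring.
Qed.

Let P1' z : op13 o1 (op23 o2 (D1 z)) = t1 (op13 o1 (op23 o2 z)).
Proof.
have -> : op23 o2 (D1 z) = fun a b c => root l1.1 * om ^+ a * snd1 l5 (op23 o2 z a) b c.
  apply: T3P => a b c; rewrite -(opF_1 h2 h3 h5) -pair_opZ; congr (pair_op _ _ b c).
  by apply: P2 => x y; rewrite /act1 /D1; ring.
move: (op23 o2 z) => w; apply: T3P => a b c; rewrite /op13 /t1.
have := congr1 (fun f => f a c) (opF_1 h1 h5 h0' (fun x y => w x b y)).
rewrite l0E => e; apply: etrans e; congr (pair_op _ _ a c); apply: P2 => x y.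
by rewrite /act1 /snd1; ring.
Qed.

Let P2' z : op13 o1 (op23 o2 (D2 z)) = t2 (op13 o1 (op23 o2 z)).
Proof.
have -> : op23 o2 (D2 z) = fun a b c => root l1.2 * snd1 l5 (op23 o2 z (a - Zp1)) b c +
    snd2 l5 (op23 o2 z a) b c.
  apply: T3P => a b c; rewrite -(opF_1 h2 h3 h5) -(opF_2 h2 h3 h5) -pair_op_lin.
  by congr (pair_op _ _ b c); apply: P2 => x y; rewrite /act1 /act2 /D2; ring.
move: (op23 o2 z) => w; apply: T3P => a b c; rewrite /op13 /t2.
have := congr1 (fun f => f a c) (opF_2 h1 h5 h0' (fun x y => w x b y)).
rewrite l0E => e; apply: etrans e; congr (pair_op _ _ a c); apply: P2 => x y.
by rewrite /act2 /snd1 /snd2; ring.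
Qed.

Let L1 v : L (t1 v) = t1 (L v). Proof. by rewrite /L Q1 P1'. Qed.
Let L2 v : L (t2 v) = t2 (L v). Proof. by rewrite /L Q2 P2'. Qed.

Let LZ k v a b c : L (fun a b c => k * v a b c) a b c = k * L v a b c.
Proof.
rewrite /L /op13 -pair_opZ; congr (pair_op _ _ a c); apply: P2 => x y.
rewrite /op23 -pair_opZ; congr (pair_op _ _ b y); apply: P2 => x' y'.
rewrite /op12 -pair_opZ; congr (pair_op _ _ x x'); apply: P2 => x2 y2.
by rewrite /op23 -pair_opZ.
Qed.

Let dlt (a0 b0 c0 : 'I_N) : T3 := fun a b c =>
  (a == a0)%:R * ((b == b0)%:R * (c == c0)%:R).

Lemma dlt_shift a0 b0 c0 a b c : dlt a0 b0 c0 a b (c - Zp1) = dlt a0 b0 (c0 + Zp1) a b c.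
Proof. by rewrite /dlt; do 2 congr (_ * _); rewrite -(inj_eq (addIr Zp1)) subrK. Qed.

Let L_diag a0 b0 c0 a b c : L (dlt a0 b0 c0) a b c = (c == c0)%:R * L (dlt a0 b0 c0) a b c.
Proof.
case: eqVneq => [_|ne]; rewrite ?mul1r// mul0r.
have r0 : root l0.1 != 0 by case/andP: h0 => /(root_neq0 hroot).
have e : t1 (dlt a0 b0 c0) = fun a b c => root l0.1 * om ^+ c0 * dlt a0 b0 c0 a b c.
  apply: T3P => x y z; rewrite /t1 /dlt; case: (eqVneq z c0) => [->//|_].
  by rewrite !mulr0.
have := congr1 (fun f => f a b c) (L1 (dlt a0 b0 c0)); rewrite e LZ /t1 => e'.
apply/eqP/contraT => f0; move/eqP: ne; case.
by apply/esym/(@omega_ord_inj R); move: e' => /(mulIf f0) /(mulfI r0).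
Qed.

Let L_shift a0 b0 c0 a b c : L (dlt a0 b0 (c0 + Zp1)) a b (c + Zp1) = L (dlt a0 b0 c0) a b c.
Proof.
have r0 : root l0.2 != 0 by case/andP: h0 => _ /(root_neq0 hroot).
have e : t2 (dlt a0 b0 c0) = fun a b c => root l0.2 * dlt a0 b0 (c0 + Zp1) a b c.
  by apply: T3P => x y z; rewrite /t2 dlt_shift.
have := congr1 (fun f => f a b (c + Zp1)) (L2 (dlt a0 b0 c0)).
by rewrite e LZ /t2 addrK => /(mulfI r0).
Qed.

(** Schur's lemma again: commuting with [t1] makes L diagonal in the third index, commuting with
    [t2] makes the entries constant along that diagonal. *)
Lemma L_third a0 b0 c0 a b c :
  L (dlt a0 b0 c0) a b c = (c == c0)%:R * L (dlt a0 b0 0) a b 0.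
Proof.
rewrite L_diag; case: eqVneq => [->|]; rewrite ?mul0r// !mul1r.
by elim/ordS_ind: c0 => // c0 IH; rewrite L_shift.
Qed.

Let F12 := opF p root zeta l1 l2.
Let F43 := opF p root zeta l4 l3.
Let F23 := opF p root zeta l2 l3.
Let F15 := opF p root zeta l1 (wmul l2 l3).
Let i12 : lker F12 == 0%VS. Proof. exact: opF_inj. Qed.
Let i43 : lker F43 == 0%VS. Proof. exact: opF_inj. Qed.
Let i23 : lker F23 == 0%VS. Proof. exact: opF_inj. Qed.
Let i15 : lker F15 == 0%VS. Proof. exact: opF_inj. Qed.

Let Lop := (at2 slot1 slot3 F15 \o at2 slot2 slot3 F23 \o
     (at2 slot1 slot2 F12)^-1 \o (at2 slot2 slot3 F43)^-1)%VF.

Let cf3_Lop v : cf3 (Lop v) = L (cf3 v).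
Proof.
rewrite /Lop; rewrite -> comp_lfunE, comp_lfunE, comp_lfunE.
rewrite cf3_at13; congr op13; rewrite cf3_at23; congr op23.
rewrite (cf3_at2V (@cf3_at12 R _) (@op12_comp R _) (@op12_1 R _) i12); congr op12.
exact: (cf3_at2V (@cf3_at23 R _) (@op23_comp R _) (@op23_1 R _) i43).
Qed.

Let cf3_bv a0 b0 c0 : cf3 (bv R (trip a0 b0 c0)) = dlt a0 b0 c0.
Proof.
apply: T3P => a b c; rewrite /cf3 cf_bv /dlt -!natrM !mulnb; congr (_%:R); congr nat_of_bool.
apply/eqP/and3P => [e|[/eqP-> /eqP-> /eqP->//]].
by split; apply/eqP; [have := trip1 a b c | have := trip2 a b c | have := trip3 a b c];
  rewrite e ?trip1 ?trip2 ?trip3.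
Qed.

Let opT_exists : exists2 T : 'End(CN2 R p), lker T == 0%VS & Lop = at2 slot2 slot1 T.
Proof.
(* The third index is frozen at 0, as [L_third] permits. A pair lists the second factor before the
   first, because T enters as T_21. *)
pose T : 'End(CN2 R p) := lin (fun q : 'I_N * 'I_N =>
  \sum_(r : 'I_N * 'I_N) L (dlt q.2 q.1 0) r.2 r.1 0 *: bv R r).
have mT q r : mcf T q r = L (dlt q.2 q.1 0) r.2 r.1 0.
  rewrite /mcf /T lin_bv; rewrite -> cf_lincomb; rewrite (bigD1 r) //= cf_bv eqxx mulr1.
  by rewrite big1 ?addr0// => r' ne; rewrite cf_bv eq_sym (negbTE ne) mulr0.
have LT : Lop = at2 slot2 slot1 T.
  apply: hom_bvP => h; rewrite [h]trip_eta; move: (h slot1) (h slot2) (h slot3) => a0 b0 c0.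
  apply: cf3_inj; rewrite cf3_Lop cf3_at21 cf3_bv; apply: T3P => a b c.
  rewrite L_third /op21 /pair_op.
  transitivity (\sum_q (q == (b0, a0))%:R * ((c == c0)%:R * mcf T q (b, a))).
    by rewrite (sum_delta (b0, a0)) mT.
  apply: eq_bigr => -[y x] _; rewrite /dlt xpair_eqE -mulnb natrM !mulrA.
  by congr (_ * _ * _); exact: mulrC.
exists T; last exact: LT.
suff Li : lker Lop == 0%VS by apply: (lker0_of_at21 (0 : 'I_N)); move: Li; rewrite LT.
have j12 := at2_inj (@cf3_at12 R _) (@op12_comp R _) (@op12_1 R _) i12.
have j43 := at2_inj (@cf3_at23 R _) (@op23_comp R _) (@op23_1 R _) i43.
have j23 := at2_inj (@cf3_at23 R _) (@op23_comp R _) (@op23_1 R _) i23.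
have j15 := at2_inj (@cf3_at13 R _) (@op13_comp R _) (@op13_1 R _) i15.
apply/lker0_inj0 => v; rewrite /Lop; rewrite -> comp_lfunE, comp_lfunE, comp_lfunE => e.
have {}e := lker0_inj0 _ j23 _ (lker0_inj0 _ j15 _ e).
have e2 : (at2 slot2 slot3 F43)^-1%VF v = 0.
  rewrite -[LHS](lker0_lfunVK j12) e; exact: linear0.
rewrite -[LHS](lker0_lfunVK j43) e2; exact: linear0.
Qed.

Lemma opT_at2 : Lop = at2 slot2 slot1 (opT p root zeta l1 l2 l3).
Proof.
rewrite /opT; case: xgetP => [T -> [_ LT]|nT]; first exact: LT.
by have [T' Ti LT] := opT_exists; case: (nT T'); split.
Qed.

(** The definition of T solved as F_12^-1 F_23^-1 = F_23^-1 F_13^-1 T_21 and read in coefficients: T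
    plays the part of a 6j-symbol, comparing the two bracketings of a triple tensor product. *)
Lemma opT_coupling ht hs i1 i2 i3 k0 :
  \sum_k coupling root zeta l1 l2 ht i1 i2 k * coupling root zeta l4 l3 hs k i3 k0 =
  \sum_q mcf (opT p root zeta l1 l2 l3) (hs, ht) q *
    \sum_k coupling root zeta l1 l5 q.2 i1 k k0 * coupling root zeta l2 l3 q.1 i2 i3 k.
Proof.
have K23 v : op23 (mcf F23^-1%VF) (op23 o2 v) = v.
  by apply/funext => a; exact: (opFK h2 h3 h5 (v a)).
have K13 v : op13 (mcf F15^-1%VF) (op13 o1 v) = v.
  by apply: T3P => a b c; exact: (congr1 (fun f => f a c) (opFK h1 h5 h0' (fun x y => v x b y))).
have e : op12 g3 (op23 g4 (dlt ht hs k0)) =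
  op23 (mcf F23^-1%VF) (op13 (mcf F15^-1%VF) (op21 (mcf (opT p root zeta l1 l2 l3)) (dlt ht hs k0))).
  have := cf3_Lop (bv R (trip ht hs k0)); rewrite opT_at2 cf3_at21 cf3_bv => ->.
  exact: esym (etrans (congr1 (op23 _) (K13 _)) (K23 _)).
have {}e := congr1 (fun f => f i1 i2 i3) e.
have e1 : op12 g3 (op23 g4 (dlt ht hs k0)) i1 i2 i3 =
    \sum_k coupling root zeta l1 l2 ht i1 i2 k * coupling root zeta l4 l3 hs k i3 k0.
  rewrite /op12 /pair_op; transitivity (\sum_q (q.1 == ht)%:R * (g4 (hs, k0) (q.2, i3) * g3 q (i1, i2))).
    apply: eq_bigr => -[x y] _ /=; rewrite mulrA; congr (_ * _); rewrite /op23 /pair_op.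
    transitivity (\sum_q (q == (hs, k0))%:R * ((x == ht)%:R * g4 q (y, i3))).
      by apply: eq_bigr => -[x' y'] _; rewrite /dlt xpair_eqE -mulnb natrM /= [RHS]mulrCA [RHS]mulrA.
    by rewrite (sum_delta (hs, k0)).
  by rewrite (sum_delta_fst ht); apply: eq_bigr => k _; rewrite mulrC.
rewrite -e1 e /op23 /pair_op {e e1}.
transitivity (\sum_q (\sum_h mcf (opT p root zeta l1 l2 l3) (hs, ht) (q.1, h) *
    coupling root zeta l1 l5 h i1 q.2 k0) * coupling root zeta l2 l3 q.1 i2 i3 q.2).
  apply: eq_bigr => -[hs' k] _ /=; congr (_ * _); rewrite /op13 /pair_op /=.
  transitivity (\sum_q (q.2 == k0)%:R * (mcf (opT p root zeta l1 l2 l3) (hs, ht) (hs', q.1) * mcf F15^-1%VF q (i1, k))).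
    apply: eq_bigr => -[x y] _ /=; rewrite mulrA; congr (_ * _); rewrite /op21 /pair_op.
    transitivity (\sum_q (q == (hs, ht))%:R * ((y == k0)%:R * mcf (opT p root zeta l1 l2 l3) q (hs', x))).
      apply: eq_bigr => -[x' y'] _; rewrite /dlt xpair_eqE -mulnb natrM /= !mulrA.
      by congr (_ * _ * _); exact: mulrC.
    by rewrite (sum_delta (hs, ht)).
  exact: (sum_delta_snd k0).
rewrite -(pair_bigA _ (fun hs' k => (\sum_h mcf (opT p root zeta l1 l2 l3) (hs, ht) (hs', h) *
    coupling root zeta l1 l5 h i1 k k0) * coupling root zeta l2 l3 hs' i2 i3 k)).
transitivity (\sum_hs' \sum_ht' mcf (opT p root zeta l1 l2 l3) (hs, ht) (hs', ht') *
    \sum_k coupling root zeta l1 l5 ht' i1 k k0 * coupling root zeta l2 l3 hs' i2 i3 k).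
  2: by rewrite pair_bigA; apply: eq_bigr => -[].
apply: eq_bigr => hs' _; under eq_bigr do rewrite big_distrl /=.
rewrite exchange_big; apply: eq_bigr => ht' _; rewrite big_distrr /=.
by apply: eq_bigr => k _; rewrite mulrA.
Qed.

End Triple.
End PairRelations.

(** * The tensor of a dotted triangle *)

Section TriangleTensor.
Variables (R : realType) (p : nat).
Local Notation C := R[i].
Local Notation N := p.+1.
Local Notation om := (omega R p).
Variables (root : C -> C) (zeta : C -> C -> C).
Hypothesis oddN : odd N.
Hypothesis hroot : root_choice N root.
Hypothesis hzeta : forall a c : C, c ^+ N - a ^+ N = 1 -> zeta a c != 0.
Local Notation G := (@coupling R p root zeta).
Local Notation rt := (@rot_tensor R p root).
Local Notation A := (@opAA_cf R p root zeta).

(* For a triangle with vertices u < v < w, the indices [a], [b], [j] belong to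
   its sides uv, vw, wu, and k = 0, 1, 2 when the dot is at v, u, w. *)
Definition tri_tensor (k : nat) (l l' : weight R) (h a b j : 'I_N) : C :=
  match k with
  | 0 => G l l' h a b j
  | 1 => rt l l' (G l l' h) a b j
  | _ => rt l' (wdual (wmul l l')) (rt l l' (G l l' h)) a b j
  end.

Lemma rot_tensor_sum l l' (c : 'I_N -> C) (f : 'I_N -> 'I_N -> 'I_N -> 'I_N -> C) a b j :
  rt l l' (fun x y z => \sum_h c h * f h x y z) a b j =
  \sum_h c h * rt l l' (f h) a b j.
Proof. by rewrite /rot_tensor big_distrr /=; apply: eq_bigr => h _; rewrite mulrCA. Qed.

Section Pair.
Variables (l l' : weight R).
Hypotheses (hl : nonsing l) (hl' : nonsing l') (hll' : nonsing (wmul l l')).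
Let ld := wdual (wmul l l').
Let hld : nonsing ld. Proof. exact: nonsing_dual. Qed.
Let wld : wmul l' ld = wdual l. Proof. exact: wmul_rot. Qed.

Let rot_coupling_eq h : rt l l' (G l l' h) =
  fun a b j => \sum_h' A l l' h h' * G l' ld h' a b j.
Proof.
apply/funext => a; apply/funext => b; apply/funext => j.
exact: rot_coupling.
Qed.

(** In three rotations each index is negated twice and collects one phase of C and one of D, whose
    product is given by [beta_dual]. For j the phase of D comes first, which reverses the sign of
    the exponent. *)
Lemma rot_tensor3 f a b j :
  rt ld l (rt l' ld (rt l l' f)) a b j =
  om ^+ j / (om ^+ a * om ^+ b) * f a b j.
Proof.
have wld2 : wmul ld l = wdual l'.
  by have := wmul_rot hl' hld; rewrite wld wdualK => // -> //; rewrite nonsing_dual.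
have e1 := beta_dual root oddN l a; have e2 := beta_dual root oddN l' b.
have e3 := beta_dual root oddN ld (- j); rewrite opprK omega_N invrK {1}/ld wdualK// in e3.
rewrite /rot_tensor wld wld2 !opprK invfM -e1 -e2 -e3.
by ring.
Qed.

(** Moving the dot counterclockwise takes kind 0 to 2, 1 to 0 and 2 to 1. In the last two cases
    [rot_coupling] gives equality with c = 1. In the first, the dot passes from the middle to the
    largest vertex and a full turn of the tensor is completed, which is a scalar by
    [coupling_support]. *)
Lemma tri_tensor_rotate k : (k < 3)%N -> exists2 c : C, c != 0 &
  forall h a b j, \sum_h' A l l' h h' * tri_tensor ((k + 2) %% 3) l' ld h' a b j =
    c * tri_tensor k l l' h a b j.
Proof.
case: k => [|[|[|//]]] _.
- have [c c0 cE] := coupling_support oddN hroot hzeta hl hl' hll'.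
  exists c^-1 => [|h a b j]; first by rewrite invr_neq0.
  have -> : ((0 + 2) %% 3 = 2)%N by [].
  rewrite /tri_tensor wld wdualK//.
  transitivity (rt ld l (rt l' ld
    (rt l l' (G l l' h))) a b j).
    rewrite rot_coupling_eq -rot_tensor_sum; congr rot_tensor.
    apply/funext => x; apply/funext => y; apply/funext => z.
    by rewrite -rot_tensor_sum.
  rewrite rot_tensor3; apply: (mulfI c0); rewrite [RHS]mulrA divff// mul1r.
  have ab0 : om ^+ a * om ^+ b != 0 by rewrite mulf_neq0 ?omega_ord_neq0.
  by apply: (mulfI ab0); rewrite cE; field; rewrite ?omega_ord_neq0.
- exists 1 => [|h a b j]; first exact: oner_neq0.
  have -> : ((1 + 2) %% 3 = 0)%N by [].
  by rewrite /tri_tensor mul1r rot_coupling_eq.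
exists 1 => [|h a b j]; first exact: oner_neq0.
have -> : ((2 + 2) %% 3 = 1)%N by [].
by rewrite /tri_tensor mul1r rot_coupling_eq -rot_tensor_sum.
Qed.

Lemma opAA_cf_inj (v : 'I_N -> C) :
  (forall h', \sum_h v h * A l l' h h' = 0) -> forall h, v h = 0.
Proof.
move=> v0 h; pose w : CN R p := \sum_h v h *: bv R h.
have cw x : cf w x = v x.
  rewrite /w; rewrite -> cf_lincomb; rewrite (bigD1 x) //= cf_bv eqxx mulr1.
  by rewrite big1 ?addr0// => y ne; rewrite cf_bv eq_sym (negbTE ne) mulr0.
rewrite -cw (lker0_inj0 _ (opAA_inj oddN hroot hzeta hl hl' hll') w) ?cf0//.
apply: cfP => h'; rewrite cf0 -[RHS](v0 h').
transitivity (\sum_x cf w x * cf (opAA p root zeta l l' (bv R x)) h'); first exact: cf_hom.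
by apply: eq_bigr => x _; rewrite cw.
Qed.

End Pair.

Definition tensor_inj (f : 'I_N -> 'I_N -> 'I_N -> 'I_N -> C) : Prop :=
  forall v : 'I_N -> 'I_N -> C,
  (forall a b, \sum_h \sum_j v h j * f h a b j = 0) -> forall h j, v h j = 0.

Lemma tensor_inj_comp l l' f g : nonsing l -> nonsing l' -> nonsing (wmul l l') ->
  tensor_inj g -> (forall h a b j, f h a b j = \sum_h' A l l' h h' * g h' a b j) ->
  tensor_inj f.
Proof.
move=> hl hl' hll' gi fE v v0 h j.
apply: (opAA_cf_inj hl hl' hll' (v := fun h => v h j)) => h'.
apply: (gi (fun h' j => \sum_h v h j * A l l' h h')) => a b; rewrite -[RHS](v0 a b).
rewrite exchange_big [RHS]exchange_big; apply: eq_bigr => z _ /=.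
under eq_bigr do rewrite big_distrl /=.
rewrite exchange_big; apply: eq_bigr => x _ /=.
by rewrite fE big_distrr /=; apply: eq_bigr => y _; rewrite mulrA.
Qed.

(** A rotated tensor is an unrotated one with the injective A applied to its multiplicity index,
    which reduces the claim to injectivity of F^-1. *)
Lemma tri_tensor_inj k l l' : nonsing l -> nonsing l' -> nonsing (wmul l l') ->
  tensor_inj (tri_tensor k l l').
Proof.
have I0 l1 l2 : nonsing l1 -> nonsing l2 -> nonsing (wmul l1 l2) -> tensor_inj (G l1 l2).
  by move=> h1 h2 h12 v; exact: coupling_inj.
have I1 l1 l2 : nonsing l1 -> nonsing l2 -> nonsing (wmul l1 l2) ->
    tensor_inj (fun h => rt l1 l2 (G l1 l2 h)).
  move=> h1 h2 h12; apply: (tensor_inj_comp h1 h2 h12 (g := G l2 (wdual (wmul l1 l2)))).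
    by apply: I0; rewrite ?nonsing_dual// wmul_rot// nonsing_dual.
  by move=> h a b j; exact: rot_coupling.
move=> hl hl' hll'; case: k => [|[|k]]; [exact: I0|exact: I1|].
apply: (tensor_inj_comp hl hl' hll'
  (g := fun h => rt l' (wdual (wmul l l')) (G l' (wdual (wmul l l')) h))).
  by apply: I1; rewrite ?nonsing_dual// wmul_rot// nonsing_dual.
move=> h a b j; rewrite /tri_tensor -rot_tensor_sum; congr rot_tensor.
apply/funext => x; apply/funext => y; apply/funext => z; exact: rot_coupling.
Qed.

Section Flip.
Variables (l1 l2 l3 : weight R).
Let l4 := wmul l1 l2.
Let l5 := wmul l2 l3.
Let l0 := wmul l4 l3.
Hypotheses (h1 : nonsing l1) (h2 : nonsing l2) (h3 : nonsing l3).
Hypotheses (h4 : nonsing l4) (h5 : nonsing l5) (h0 : nonsing l0).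
Let T := mcf (opT p root zeta l1 l2 l3).
Let l0E : wmul l1 l5 = l0. Proof. exact: wmulA. Qed.

Lemma rot_tensor2 l l' f a b j : nonsing l -> nonsing l' ->
  rt l' (wdual (wmul l l')) (rt l l' f) a b j =
  alpha root l' j * (om ^+ b)^-1 * beta root (wmul l l') a * f b (- j) (- a).
Proof.
move=> hl hl'; rewrite /rot_tensor wmul_rot// opprK -(beta_dual root oddN l b).
by ring.
Qed.

Lemma flip_0 ht hs k12 k23 k34 k41 :
  \sum_c tri_tensor 0 l1 l2 ht k12 k23 c * tri_tensor 0 l4 l3 hs c k34 k41 =
  \sum_q T (hs, ht) q *
    \sum_c tri_tensor 0 l2 l3 q.1 k23 k34 c * tri_tensor 0 l1 l5 q.2 k12 c k41.
Proof.
rewrite /tri_tensor (opT_coupling oddN hroot hzeta h1 h2 h3 h4 h5 h0).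
by apply: eq_bigr => q _; congr (_ * _); apply: eq_bigr => c _; rewrite mulrC.
Qed.

Let sum_opp (F : 'I_N -> C) : \sum_c F c = \sum_c F (- c).
Proof. by rewrite (reindex_inj (inv_inj (@opprK _))). Qed.

(** The position with P4 the smallest vertex. Rotating twice leaves (om^c)^-1 at the index c of the
    old diagonal; [coupling_support] trades it for the constant c0 and for phases at the sides P1P2
    and P2P3, which also occur after the flip. *)
Lemma flip_1 : exists2 c0 : C, c0 != 0 & forall ht hs k12 k23 k34 k41,
  \sum_c tri_tensor 0 l1 l2 ht k12 k23 c * tri_tensor 2 l4 l3 hs k41 c k34 =
  c0 * \sum_q T (hs, ht) q *
    \sum_c tri_tensor 2 l2 l3 q.1 c k23 k34 * tri_tensor 2 l1 l5 q.2 k41 k12 c.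
Proof.
have [c0 c00 cE] := coupling_support oddN hroot hzeta h1 h2 h4.
exists c0 => // ht hs k12 k23 k34 k41; rewrite /tri_tensor.
pose X := alpha root l3 k34 * beta root l0 k41 * (om ^+ k12)^-1 * (om ^+ k23)^-1.
transitivity (c0 * X * \sum_c G l1 l2 ht k12 k23 c * G l4 l3 hs c (- k34) (- k41)).
  rewrite big_distrr; apply: eq_bigr => c _ /=; rewrite rot_tensor2// -/l0.
  have e : (om ^+ c)^-1 * G l1 l2 ht k12 k23 c =
      c0 * (om ^+ k12)^-1 * (om ^+ k23)^-1 * G l1 l2 ht k12 k23 c.
    have oc : om ^+ c * (om ^+ k12 * om ^+ k23) != 0 by rewrite !mulf_neq0 ?omega_ord_neq0.
    apply: (mulfI oc); transitivity (om ^+ k12 * om ^+ k23 * G l1 l2 ht k12 k23 c).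
      by field; rewrite omega_ord_neq0.
    by rewrite cE; field; rewrite !omega_ord_neq0.
  transitivity (alpha root l3 k34 * beta root l0 k41 * ((om ^+ c)^-1 * G l1 l2 ht k12 k23 c) *
    G l4 l3 hs c (- k34) (- k41)); first by ring.
  by rewrite e /X; ring.
rewrite (opT_coupling oddN hroot hzeta h1 h2 h3 h4 h5 h0) -mulrA; congr (_ * _).
rewrite big_distrr; apply: eq_bigr => q _ /=; rewrite mulrCA; congr (_ * _).
rewrite big_distrr sum_opp; apply: eq_bigr => c _ /=.
rewrite !rot_tensor2// -/l5 l0E -[G l2 l3 _ _ _ _ in LHS]mul1r -(alpha_beta hroot c h5) /X.
by ring.
Qed.

(** Here the old and the new diagonal each carry one phase [alpha] and one phase [beta] of the same
    weight and index, cancelling by [alpha_beta]. Replacing c by -c accounts for the signs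
    introduced by the rotations. *)
Lemma flip_2 ht hs k12 k23 k34 k41 :
  \sum_c tri_tensor 2 l1 l2 ht c k12 k23 * tri_tensor 1 l4 l3 hs k34 k41 c =
  \sum_q T (hs, ht) q *
    \sum_c tri_tensor 1 l2 l3 q.1 k34 c k23 * tri_tensor 2 l1 l5 q.2 k41 k12 c.
Proof.
rewrite /tri_tensor.
pose X := alpha root l2 k23 * beta root l0 k41 * (om ^+ k12)^-1.
transitivity (X * \sum_c G l1 l2 ht k12 (- k23) c * G l4 l3 hs c k34 (- k41)).
  rewrite [RHS]big_distrr [RHS]sum_opp; apply: eq_bigr => c _ /=.
  rewrite rot_tensor2// /rot_tensor -/l0 -/l4.
  by rewrite -[G l4 l3 _ _ _ _ in RHS]mul1r -(alpha_beta hroot c h4) /X; ring.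
rewrite (opT_coupling oddN hroot hzeta h1 h2 h3 h4 h5 h0).
rewrite big_distrr; apply: eq_bigr => q _ /=; rewrite mulrCA; congr (_ * _).
rewrite big_distrr sum_opp; apply: eq_bigr => c _ /=.
rewrite rot_tensor2// /rot_tensor -/l5 l0E -[G l2 l3 _ _ _ _ in LHS]mul1r -(alpha_beta hroot c h5) /X.
by ring.
Qed.

Lemma flip_3 ht hs k12 k23 k34 k41 :
  \sum_c tri_tensor 1 l1 l2 ht k23 c k12 * tri_tensor 1 l4 l3 hs k34 k41 c =
  \sum_q T (hs, ht) q *
    \sum_c tri_tensor 0 l2 l3 q.1 k23 k34 c * tri_tensor 1 l1 l5 q.2 c k41 k12.
Proof.
rewrite /tri_tensor /rot_tensor -/l0 -/l4 -/l5 l0E.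
pose X := alpha root l1 k12 * beta root l0 k41.
transitivity (X * \sum_c G l1 l2 ht (- k12) k23 c * G l4 l3 hs c k34 (- k41)).
  rewrite [RHS]big_distrr [RHS]sum_opp; apply: eq_bigr => c _ /=.
  by rewrite -[G l4 l3 _ _ _ _ in RHS]mul1r -(alpha_beta hroot c h4) /X; ring.
rewrite (opT_coupling oddN hroot hzeta h1 h2 h3 h4 h5 h0).
rewrite big_distrr; apply: eq_bigr => q _ /=; rewrite mulrCA; congr (_ * _).
by rewrite big_distrr; apply: eq_bigr => c _ /=; rewrite /X; ring.
Qed.

End Flip.
End TriangleTensor.

(** * State sums *)

Section Agree.
Variables (J X : finType).

Definition upd1 (f : {ffun J -> X}) (j : J) (x : X) : {ffun J -> X} :=
  [ffun i => if i == j then x else f i].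

Lemma upd1_eq f j x : upd1 f j x j = x. Proof. by rewrite ffunE eqxx. Qed.
Lemma upd1_neq f j x i : i != j -> upd1 f j x i = f i.
Proof. by rewrite ffunE => /negbTE ->. Qed.

Definition agree_off (S : {set J}) (f g : {ffun J -> X}) : bool :=
  [forall j, (j \notin S) ==> (f j == g j)].

Lemma agree_offP (S : {set J}) (f g : {ffun J -> X}) : reflect (forall j, j \notin S -> f j = g j) (agree_off S f g).
Proof.
apply: (iffP forallP) => [fg j jS|fg j]; first by have /implyP/(_ jS)/eqP := fg j.
by apply/implyP => /fg ->.
Qed.

Lemma agree_off0 (f g : {ffun J -> X}) : agree_off finset.set0 f g = (f == g).
Proof.
apply/agree_offP/eqP => [fg|->//]; apply/ffunP => j; apply: fg; by rewrite inE.
Qed.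

Lemma agree_offT (f g : {ffun J -> X}) : agree_off finset.setT f g.
Proof. by apply/agree_offP => j; rewrite inE. Qed.

Lemma sum_agree_split (K : nmodType) (S : {set J}) (g : {ffun J -> X}) (j0 : J)
    (F : {ffun J -> X} -> K) : j0 \in S ->
  \sum_(f | agree_off S f g) F f =
  \sum_(f | agree_off (S :\ j0) f g) \sum_x F (upd1 f j0 x).
Proof.
move=> j0S; rewrite (partition_big (fun f : {ffun J -> X} => f j0) predT) //= [RHS]exchange_big.
apply: eq_bigr => x _.
rewrite (reindex_onto (fun f => upd1 f j0 x) (fun f => upd1 f j0 (g j0))) /=; last first.
  move=> f /andP[_ /eqP fx]; apply/ffunP => i; rewrite !ffunE.
  by case: eqP => // ->.
apply: eq_bigl => f; apply/andP/agree_offP => [[/andP[/agree_offP fg _] /eqP ff] i|fg].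
  rewrite !inE negb_and negbK => /orP[/eqP ->|iS].
    by rewrite -ff !ffunE eqxx.
  by rewrite -fg// upd1_neq//; apply: contraNneq iS => ->.
split.
  apply/andP; split; last by rewrite upd1_eq.
  apply/agree_offP => i iS; rewrite upd1_neq; last by apply: contraNneq iS => ->.
  by apply: fg; rewrite !inE negb_and iS orbT.
apply/eqP/ffunP => i; rewrite !ffunE; case: eqP => // ->.
by rewrite fg// !inE eqxx.
Qed.

Lemma sum_agree_upd (K : nmodType) (S : {set J}) (g : {ffun J -> X}) (j0 : J) (x : X)
    (F : {ffun J -> X} -> K) : j0 \notin S ->
  \sum_(f | agree_off S f (upd1 g j0 x)) F f = \sum_(f | agree_off S f g) F (upd1 f j0 x).
Proof.
move=> j0S.
rewrite (reindex_onto (fun f => upd1 f j0 x) (fun f => upd1 f j0 (g j0))) /=; last first.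
  move=> f /agree_offP fg; apply/ffunP => i; rewrite !ffunE.
  by case: eqP => // ->; rewrite fg// upd1_eq.
apply: eq_bigl => f; apply/andP/agree_offP => [[/agree_offP fg /eqP ff] i iS|fg].
  case: (eqVneq i j0) => [->|ij]; first by rewrite -[in LHS]ff upd1_eq.
  by have := fg i iS; rewrite !upd1_neq.
split; first by apply/agree_offP => i iS; rewrite !ffunE; case: eqP => // _; exact: fg.
by apply/eqP/ffunP => i; rewrite !ffunE; case: eqP => // ->; rewrite fg.
Qed.
End Agree.

Section StateSum.
Variables (K : fieldType) (I E X : finType).

(** A state assigns an index to every segment, edge or not, so that all dotted triangulations share
    one target space. Outside D it is frozen to the boundary value k. *)
Definition state_sum (D : {set E}) (W : I -> X -> {ffun E -> X} -> K)
    (h : {ffun I -> X}) (k : {ffun E -> X}) : K :=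
  \sum_(c | agree_off D c k) \prod_t W t (h t) c.

Section Injectivity.
Variables (e1 e2 e3 : I -> E) (rank : I -> nat) (Th : I -> X -> X -> X -> X -> K).
Hypothesis e1_inj : injective e1.
Hypothesis e2_inj : injective e2.
Hypothesis e3_inj : injective e3.
Hypothesis e12 : forall t u, e1 t != e2 u.
Hypothesis rank1 : forall t u, e3 t = e1 u -> (rank t < rank u)%N.
Hypothesis rank2 : forall t u, e3 t = e2 u -> (rank t < rank u)%N.
Hypothesis Th_inj : forall t (v : X -> X -> K),
  (forall a b, \sum_h \sum_j v h j * Th t h a b j = 0) -> forall h j, v h j = 0.

Let W t h (c : {ffun E -> X}) := Th t h (c (e1 t)) (c (e2 t)) (c (e3 t)).

(** The relation left after removal of the triangles outside S; h0 and k fix their multiplicity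
    indices and the indices no longer summed. For all of I it is the hypothesis of [state_sum_inj],
    for the empty set it says that v vanishes. *)
Let claim (v : {ffun I -> X} -> K) (S : {set I}) := forall h0 k,
  \sum_(h | agree_off S h h0) \sum_(c | agree_off (e3 @: S) c k)
    v h * \prod_(t in S) W t (h t) c = 0.

(* The inner sides of a triangle of minimal rank in [S] belong to no other
   triangle of [S], so [Th_inj] allows to remove this triangle. *)
Let claim_step v S : claim v S -> S != finset.set0 ->
  exists2 t, t \in S & claim v (S :\ t).
Proof.
move=> cS /set0Pn[t0 t0S].
case: (@arg_minnP _ t0 (fun t => t \in S) rank t0S) => t tS tmin.
exists t => // h0 k.
have out1 u : u \in S -> e3 u != e1 t.
  by move=> uS; apply/eqP => /rank1; rewrite ltnNge tmin.
have out2 u : u \in S -> e3 u != e2 t.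
  by move=> uS; apply/eqP => /rank2; rewrite ltnNge tmin.
have e3S : e3 @: S :\ e3 t = e3 @: (S :\ t).
  apply/setP => e; apply/setD1P/imsetP => [[et /imsetP[u uS eu]]|[u /setD1P[ut uS] ->]].
    by exists u => //; apply/setD1P; split=> //; apply: contraNneq et => ut; rewrite eu ut.
  by split; [apply: contraNneq ut => /e3_inj -> | apply/imsetP; exists u].
have Sp (f : I -> K) : \prod_(u in S) f u = f t * \prod_(u in S :\ t) f u.
  rewrite (bigD1 t) //=; congr (_ * _); apply: eq_bigl => u.
  by rewrite !inE andbC.
(* The sum over the remaining triangles, with multiplicity index x at t and index j at the outer
   side of t. By [main], contracting it with the tensor of t gives zero. *)
pose B (k : {ffun E -> X}) (x j : X) : K := \sum_(h | agree_off (S :\ t) h h0)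
  \sum_(c | agree_off (e3 @: (S :\ t)) c k)
    v (upd1 h t x) * \prod_(u in S :\ t) W u (h u) (upd1 c (e3 t) j).
have e3t1 : e1 t != e3 t by rewrite eq_sym out1.
have e3t2 : e2 t != e3 t by rewrite eq_sym out2.
have main k' : \sum_x \sum_j B k' x j * Th t x (k' (e1 t)) (k' (e2 t)) j = 0.
  rewrite -[RHS](cS h0 k') (sum_agree_split h0 _ tS) [RHS]exchange_big /=.
  apply: eq_bigr => x _.
  transitivity (\sum_j \sum_(h | agree_off (S :\ t) h h0)
     \sum_(c | agree_off (e3 @: (S :\ t)) c k')
      v (upd1 h t x) * \prod_(u in S) W u (upd1 h t x u) (upd1 c (e3 t) j)); last first.
    rewrite exchange_big; apply: eq_bigr => h _ /=.
    by rewrite [RHS](@sum_agree_split _ _ _ _ _ (e3 t)) ?imset_f// e3S exchange_big.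
  apply: eq_bigr => j _; rewrite /B big_distrl; apply: eq_bigr => h _ /=.
  rewrite big_distrl; apply: eq_bigr => c /agree_offP ck /=.
  rewrite Sp -mulrA; congr (_ * _); rewrite mulrC; congr (_ * _); last first.
    by apply: eq_bigr => u /setD1P[ut _]; rewrite upd1_neq.
  rewrite /W !upd1_eq !upd1_neq// !ck//.
    by apply/imsetP => -[u /setD1P[_ uS]] e; have := out2 u uS; rewrite e eqxx.
  by apply/imsetP => -[u /setD1P[_ uS]] e; have := out1 u uS; rewrite e eqxx.
(* B ignores the inner sides of t, which belong to no other triangle of S. Their indices in [main]
   can therefore be set to arbitrary a and b, as [Th_inj] requires. *)
have Bindep k' e a : (forall u, u \in S :\ t -> [/\ e != e1 u, e != e2 u & e != e3 u]) ->
    B (upd1 k' e a) = B k'.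
  move=> he; apply/funext => x; apply/funext => j; apply: eq_bigr => h _.
  rewrite sum_agree_upd; last first.
    by apply/imsetP => -[u uS ee]; have [_ _ /eqP] := he u uS.
  apply: eq_bigr => c _; congr (_ * _); apply: eq_bigr => u uS.
  have R (f : {ffun E -> X}) y : y != e -> upd1 (upd1 f e a) (e3 t) j y = upd1 f (e3 t) j y.
    by move=> ye; rewrite !ffunE (negbTE ye).
  by have [u1 u2 u3] := he u uS; rewrite /W !R// eq_sym.
have h1 u : u \in S :\ t -> [/\ e1 t != e1 u, e1 t != e2 u & e1 t != e3 u].
  move=> /setD1P[ut uS]; split; [|exact: e12|by rewrite eq_sym out1].
  by apply: contraNneq ut => /e1_inj ->.
have h2 u : u \in S :\ t -> [/\ e2 t != e1 u, e2 t != e2 u & e2 t != e3 u].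
  move=> /setD1P[ut uS]; split; [by rewrite eq_sym e12| |by rewrite eq_sym out2].
  by apply: contraNneq ut => /e2_inj ->.
transitivity (B k (h0 t) (k (e3 t))).
  apply: eq_bigr => h /agree_offP hh0; apply: eq_bigr => c /agree_offP ck.
  have -> : upd1 h t (h0 t) = h.
    by apply/ffunP => u; rewrite ffunE; case: eqP => // ->; rewrite hh0// !inE eqxx.
  suff -> : upd1 c (e3 t) (k (e3 t)) = c by [].
  apply/ffunP => e; rewrite ffunE; case: eqP => // ->; rewrite ck//.
  by apply/imsetP => -[u /setD1P[ut _]] /e3_inj tu; rewrite tu eqxx in ut.
apply: (Th_inj (t := t)) => a b.
rewrite -[RHS](main (upd1 (upd1 k (e1 t) a) (e2 t) b)) !Bindep//.
apply: eq_bigr => x _; apply: eq_bigr => j _.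
by rewrite upd1_eq upd1_neq ?upd1_eq// e12.
Qed.

Lemma state_sum_inj (x0 : X) (v : {ffun I -> X} -> K) :
  (forall k, \sum_h v h * state_sum [set e3 t | t : I] W h k = 0) -> forall h, v h = 0.
Proof.
move=> v0; have claimT : claim v finset.setT.
  move=> h0 k; rewrite -[RHS](v0 k); apply: eq_big => [h|h _]; first by rewrite agree_offT.
  rewrite /state_sum big_distrr /=; apply: eq_big => [c|c _].
    congr agree_off; apply/setP => e.
    by apply/imsetP/imsetP => -[u _ ->]; exists u; rewrite ?inE.
  by congr (_ * _); apply: eq_bigl => u; rewrite inE.
have claim0 : claim v finset.set0.
  suff H m : forall S : {set I}, #|S| = m -> claim v S -> claim v finset.set0 by exact: (H _ _ erefl claimT).
  elim: m => [|m IH] S; first by move/eqP; rewrite cards_eq0 => /eqP ->.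
  move=> Sm /claim_step[|t tS]; first by rewrite -card_gt0 Sm.
  by apply: IH; move: Sm; rewrite (cardsD1 t) tS => -[].
move=> h; rewrite -[RHS](claim0 h [ffun=> x0]) (bigD1 h) /=; last by rewrite agree_off0.
rewrite [X in _ + X]big1 ?addr0 => [|g]; last by rewrite agree_off0 => /andP[/eqP ->]; rewrite eqxx.
rewrite imset0 (bigD1 [ffun=> x0]) /=; last by rewrite agree_off0.
rewrite [X in _ + X]big1 ?addr0 => [|g]; last by rewrite agree_off0 => /andP[/eqP ->]; rewrite eqxx.
by rewrite big_set0 mulr1.
Qed.

End Injectivity.

Section Flip.
Variables (D D' : {set E}) (W W' : I -> X -> {ffun E -> X} -> K) (s t : I) (x0 x1 : E).
Hypothesis st : s != t.
Hypothesis x0D : x0 \in D.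
Hypothesis x1D' : x1 \in D'.
Hypothesis DD' : D :\ x0 = D' :\ x1.
Hypothesis Wu : forall u, u != s -> u != t -> forall h c x, W u h (upd1 c x0 x) = W u h c.
Hypothesis Wu' : forall u, u != s -> u != t -> forall h c x, W' u h (upd1 c x1 x) = W u h c.
Variables (T : X * X -> X * X -> K) (a : K).
Hypothesis local_flip : forall hs ht c,
  \sum_x W t ht (upd1 c x0 x) * W s hs (upd1 c x0 x) =
  a * \sum_q T (hs, ht) q * \sum_x W' s q.1 (upd1 c x1 x) * W' t q.2 (upd1 c x1 x).

(** Summing over the index of the diagonal comes first: the other triangles do not see it and factor
    out, so [local_flip] applies. By [DD'] the outer sums range over the same states. *)
Lemma state_sum_flip h k : state_sum D W h k =
  a * \sum_q T (h s, h t) q * state_sum D' W' (upd2 s t h q) k.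
Proof.
have split2 (f : I -> K) : \prod_u f u = f s * f t * \prod_(u | (u != s) && (u != t)) f u.
  by rewrite (bigD1 s) //= (bigD1 t) ?mulrA// eq_sym.
rewrite /state_sum (sum_agree_split _ _ x0D).
transitivity (\sum_(c | agree_off (D :\ x0) c k) \sum_q (a * T (h s, h t) q) *
   \sum_x \prod_u W' u (upd2 s t h q u) (upd1 c x1 x)); last first.
  rewrite exchange_big big_distrr /=; apply: eq_bigr => q _.
  by rewrite -mulr_sumr mulrA DD' (sum_agree_split _ _ x1D').
apply: eq_bigr => c _.
transitivity ((\prod_(u | (u != s) && (u != t)) W u (h u) c) *
    \sum_x W t (h t) (upd1 c x0 x) * W s (h s) (upd1 c x0 x)).
  rewrite big_distrr /=; apply: eq_bigr => x _; rewrite split2 mulrC; congr (_ * _).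
    by apply: eq_bigr => u /andP[us ut]; rewrite Wu.
  exact: mulrC.
rewrite local_flip mulrCA mulr_sumr mulr_sumr; apply: eq_bigr => q _.
rewrite -[RHS]mulrA; congr (_ * _); rewrite mulrCA; congr (_ * _); rewrite mulr_sumr; apply: eq_bigr => x _.
rewrite split2 mulrC upd2_l upd2_r//; congr (_ * _).
by apply: eq_bigr => u /andP[us ut]; rewrite Wu'// /upd2 ffunE (negbTE us) (negbTE ut).
Qed.
End Flip.
End StateSum.

(** * Triangles and edges *)

Section Triangles.
Variable n : nat.
Implicit Types (T : dtriangle n) (a b c d x y : 'I_n).

(* 0, 1, 2 when the dot is at the middle, the smallest, the largest vertex *)
Definition tri_kind T : nat :=
  if (T.1.1 < T.1.2)%N then (if (T.1.2 < T.2)%N then 0 else 2) else 1.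

(** For vertices a < b < c the sides [inner1], [inner2], [outer] are ab, bc, ca and [span] is c - a,
    see [sorted_triangle]. *)
Definition inner1 T : {set 'I_n} :=
  match tri_kind T with 0 => side1 T | 1 => side2 T | _ => side3 T end.
Definition inner2 T : {set 'I_n} :=
  match tri_kind T with 0 => side2 T | 1 => side3 T | _ => side1 T end.
Definition outer T : {set 'I_n} :=
  match tri_kind T with 0 => side3 T | 1 => side1 T | _ => side2 T end.
Definition span T : nat :=
  match tri_kind T with 0 => T.2 - T.1.1 | 1 => T.1.1 - T.1.2 | _ => T.1.2 - T.2 end.

Definition tccw T : bool := ccw T.1.1 T.1.2 T.2.

Lemma tri_kind_lt T : (tri_kind T < 3)%N.
Proof. by rewrite /tri_kind; case: ifP => // _; case: ifP. Qed.

Lemma tri_kind_rot x d y : ccw x d y -> tri_kind (d, y, x) = ((tri_kind (x, d, y) + 2) %% 3)%N.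
Proof.
by rewrite /tri_kind /ccw /=; case: (ltngtP x d) => //= ?; case: (ltngtP d y) => //= ?;
  case: (ltngtP y x) => //= ?; lia.
Qed.

Lemma pair_eq a b c d : (a < b)%N -> (c < d)%N -> [set a; b] = [set c; d] -> a = c /\ b = d.
Proof.
move=> ab cd e; have ha : a \in [set c; d] by rewrite -e set21.
have hb : b \in [set c; d] by rewrite -e set22.
move: ha hb; rewrite !inE => /orP[] /eqP ac /orP[] /eqP bd; subst => //.
- by rewrite ltnn in ab.
- by move: (ltn_trans ab cd); rewrite ltnn.
- by rewrite ltnn in ab.
Qed.

Lemma sorted_triangle T : tccw T -> exists a b c,
  [/\ (a < b < c)%N, [/\ inner1 T = [set a; b], inner2 T = [set b; c] & outer T = [set c; a]],
      vertices T = [set a; b; c] & span T = (c - a)%N].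
Proof.
case: T => [[x d] y]; rewrite /tccw /ccw /= => /or3P[] /andP[h1 h2].
- exists x, d, y; rewrite /inner1 /inner2 /outer /span /tri_kind /= h1 h2.
  by split.
- have xd : (x < d)%N = false by lia.
  exists d, y, x; rewrite /inner1 /inner2 /outer /span /tri_kind /= xd h1 h2.
  by split=> //; apply/setP => v; rewrite !inE; case: (v == x); case: (v == d); case: (v == y).
have dy : (d < y)%N = false by lia.
exists y, x, d; rewrite /inner1 /inner2 /outer /span /tri_kind /= h2 dy h1.
by split=> //; apply/setP => v; rewrite !inE; case: (v == x); case: (v == d); case: (v == y).
Qed.

End Triangles.

Section Triangulation.
Variables (R : realType) (n : nat) (I : finType) (tau : LD R n I).

(** The record forbids crossings among diagonals only. A crossed segment has vertices strictly
    between its ends and others strictly beyond them, so it is not a side of the polygon. *)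
Lemma edge_nocross (a b c d : 'I_n) : (a < b)%N -> (b < c)%N -> (c < d)%N ->
  [set a; c] \in edges tau -> [set b; d] \in edges tau -> False.
Proof.
move=> ab bc cd; have dn := ltn_ord d.
have noside (p q : 'I_n) : (p < q)%N -> (exists2 v : 'I_n, p < v & v < q)%N ->
    (exists v : 'I_n, v < p \/ q < v)%N -> ~~ side [set p; q].
  move=> pq [v pv vq] [u uo]; apply/existsP => -[k /eqP e].
  have kn := ltn_ord k; have un := ltn_ord u; have qn := ltn_ord q.
  have : (p = k /\ q = ordS k) \/ (p = ordS k /\ q = k).
    case: (ltngtP k (ordS k)) => h.
    - by have [] := pair_eq pq h e; left.
    - by rewrite [RHS]finset.setUC in e; have [] := pair_eq pq h e; right.
    have kk := val_inj h; rewrite -kk in e.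
    have : (#|[set p; q]| = #|[set k; k]|)%N by rewrite e.
    by rewrite !cards2 eqxx -val_eqE /= ltn_eqF.
  have Sk : nat_of_ord (ordS k) = (if k.+1 == n then 0 else k.+1)%N.
    by rewrite /=; case: eqP => [->|?]; [rewrite modnn | rewrite modn_small //; lia].
  case=> -[ep eq']; move: pq pv vq uo; rewrite ep eq' Sk; case: eqP; lia.
rewrite !inE => /orP[ac|ac] /orP[bd|bd].
- by move: ac; apply/negP/noside; [lia | exists b | exists d; right].
- by move: ac; apply/negP/noside; [lia | exists b | exists d; right].
- by move: bd; apply/negP/noside; [lia | exists c | exists a; left].
have /maxsetP[/andP[_ /forall_inP nc] _] := diags_max tau.
have /forall_inP/(_ _ bd)/negP := nc _ ac; apply.
apply/existsP; exists a; apply/existsP; exists c; apply/existsP; exists b; apply/existsP; exists d.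
by rewrite !eqxx ab bc cd orbT.
Qed.

Lemma side_edges t :
  [/\ side1 (tri tau t) \in edges tau, side2 (tri tau t) \in edges tau
    & side3 (tri tau t) \in edges tau].
Proof. exact: tri_edges. Qed.

Lemma inner_edges t :
  [/\ inner1 (tri tau t) \in edges tau, inner2 (tri tau t) \in edges tau
    & outer (tri tau t) \in edges tau].
Proof.
by have [] := side_edges t; rewrite /inner1 /inner2 /outer; case: (tri_kind _) => [|[|]].
Qed.

Lemma same_vertices (t u : I) (a b c : 'I_n) : (a < b < c)%N ->
  vertices (tri tau t) = [set a; b; c] -> vertices (tri tau u) = [set a; b; c] ->
  [set a; b] \in edges tau -> [set b; c] \in edges tau -> [set c; a] \in edges tau -> t = u.
Proof.
move=> abc vt vu eab ebc eca.
have abc' : ccw a b c by rewrite /ccw abc.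
have [w [_ wu]] := tri_bij abc' eab ebc eca.
by rewrite -(wu t vt) -(wu u vu).
Qed.

Let data t := sorted_triangle (tri_ccw tau t).

(** Triangles on a common side ab with third vertices c < c' would have crossing sides ac and bc'.
    The next three lemmas find a crossing in the same way. *)
Lemma inner1_inj : injective (fun t => inner1 (tri tau t)).
Proof.
move=> t u /=; have [a [b [c [/andP[ab bc] [i1 i2 o] v _]]]] := data t.
have [a' [b' [c' [/andP[ab' bc'] [i1' i2' o'] v' _]]]] := data u.
have [E1 E2 E3] := inner_edges t; have [E1' E2' E3'] := inner_edges u.
rewrite i1 i2 o i1' i2' o' in E1 E2 E3 E1' E2' E3' *.
move/(pair_eq ab ab') => [ea eb]; subst a' b'.
have ec : c = c'.
  apply: val_inj; case: (ltngtP c c') => // cc; exfalso.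
    by apply: (edge_nocross ab bc cc) => //; rewrite finset.setUC.
  by apply: (edge_nocross ab bc' cc) => //; rewrite finset.setUC.
by subst c'; apply: (same_vertices _ v v') => //; rewrite ab bc.
Qed.

Lemma inner2_inj : injective (fun t => inner2 (tri tau t)).
Proof.
move=> t u /=; have [a [b [c [/andP[ab bc] [i1 i2 o] v _]]]] := data t.
have [a' [b' [c' [/andP[ab' bc'] [i1' i2' o'] v' _]]]] := data u.
have [E1 E2 E3] := inner_edges t; have [E1' E2' E3'] := inner_edges u.
rewrite i1 i2 o i1' i2' o' in E1 E2 E3 E1' E2' E3' *.
move/(pair_eq bc bc') => [eb ec]; subst b' c'.
have ea : a = a'.
  apply: val_inj; case: (ltngtP a a') => // aa; exfalso.
    by apply: (edge_nocross aa ab' bc) => //; rewrite finset.setUC.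
  by apply: (edge_nocross aa ab bc) => //; rewrite finset.setUC.
by subst a'; apply: (same_vertices _ v v') => //; rewrite ab bc.
Qed.

Lemma outer_inj : injective (fun t => outer (tri tau t)).
Proof.
move=> t u /=; have [a [b [c [/andP[ab bc] [i1 i2 o] v _]]]] := data t.
have [a' [b' [c' [/andP[ab' bc'] [i1' i2' o'] v' _]]]] := data u.
have [E1 E2 E3] := inner_edges t; have [E1' E2' E3'] := inner_edges u.
rewrite i1 i2 o i1' i2' o' in E1 E2 E3 E1' E2' E3' *.
rewrite finset.setUC [RHS]finset.setUC.
move/(pair_eq (ltn_trans ab bc) (ltn_trans ab' bc')) => [ea ec]; subst a' c'.
have eb : b = b'.
  apply: val_inj; case: (ltngtP b b') => // bb; exfalso.
    by apply: (edge_nocross ab bb bc').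
  by apply: (edge_nocross ab' bb bc).
by subst b'; apply: (same_vertices _ v v') => //; rewrite ab bc.
Qed.

Lemma inner12 t u : inner1 (tri tau t) != inner2 (tri tau u).
Proof.
have [a [b [c [/andP[ab bc] [i1 i2 o] v _]]]] := data t.
have [a' [b' [c' [/andP[ab' bc'] [i1' i2' o'] v' _]]]] := data u.
have [E1 E2 E3] := inner_edges t; have [E1' E2' E3'] := inner_edges u.
rewrite i1 i2 o i1' i2' o' in E1 E2 E3 E1' E2' E3' *.
apply/eqP => /(pair_eq ab bc') [ea eb]; subst b' c'.
by apply: (edge_nocross ab' ab bc); rewrite finset.setUC.
Qed.

Lemma span1 t u : outer (tri tau t) = inner1 (tri tau u) ->
  (span (tri tau t) < span (tri tau u))%N.
Proof.
have [a [b [c [/andP[ab bc] [i1 i2 o] v ->]]]] := data t.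
have [a' [b' [c' [/andP[ab' bc'] [i1' i2' o'] v' ->]]]] := data u.
rewrite o i1' finset.setUC => /(pair_eq (ltn_trans ab bc) ab') [-> ->]; lia.
Qed.

Lemma span2 t u : outer (tri tau t) = inner2 (tri tau u) ->
  (span (tri tau t) < span (tri tau u))%N.
Proof.
have [a [b [c [/andP[ab bc] [i1 i2 o] v ->]]]] := data t.
have [a' [b' [c' [/andP[ab' bc'] [i1' i2' o'] v' ->]]]] := data u.
rewrite o i2' finset.setUC => /(pair_eq (ltn_trans ab bc) bc') [-> ->]; lia.
Qed.

End Triangulation.

(** * Elementary morphisms *)

Section Transport.
Variables (R : realType) (V W : vectType R[i]).
Implicit Types (f g : 'End(V)) (A B : 'Hom(V, W)).

Lemma transport_inj f A B (c : R[i]) : lker A == 0%VS -> c != 0 ->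
  (B \o f)%VF = c *: A -> lker f == 0%VS.
Proof.
move=> /lker0_inj0 Ai c0 e; apply/lker0_inj0 => v fv; apply: Ai.
have := congr1 (fun h : 'Hom(V, W) => h v) e; rewrite comp_lfunE fv linear0 scale_lfunE.
by move/esym/eqP; rewrite scaler_eq0 (negbTE c0) => /eqP.
Qed.

(** f is injective, hence invertible as an endomorphism of a finite dimensional space, and the
    relation can be composed with f^-1. *)
Lemma transport_inv f A B (c : R[i]) : lker A == 0%VS -> c != 0 ->
  (B \o f)%VF = c *: A -> (A \o f^-1)%VF = c^-1 *: B.
Proof.
move=> Ai c0 e; have fi := transport_inj Ai c0 e.
by rewrite -[B in RHS](lker0_compfK fi) e -comp_lfunZl scalerA mulVf ?scale1r.
Qed.

Lemma transport_comp f g A B D (c c' : R[i]) :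
  (B \o f)%VF = c *: A -> (D \o g)%VF = c' *: B -> (D \o (g \o f))%VF = (c' * c) *: A.
Proof. by move=> e e'; rewrite comp_lfunA e' -comp_lfunZl e scalerA. Qed.

Lemma transport_unique f g A B (c c' : R[i]) : lker B == 0%VS -> c != 0 -> c' != 0 ->
  (B \o f)%VF = c *: A -> (B \o g)%VF = c' *: A -> proj_eq f g.
Proof.
move=> Bi c0 c'0 e e'; exists (c / c'); first by rewrite mulf_neq0 ?invr_neq0.
apply/lfunP => v; apply: (lker0P Bi).
have := congr1 (fun h : 'Hom(V, W) => h v) e; rewrite comp_lfunE scale_lfunE => ->.
have := congr1 (fun h : 'Hom(V, W) => h v) e'; rewrite comp_lfunE scale_lfunE => e2.
by rewrite scale_lfunE linearZ /= e2 scalerA divfK.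
Qed.

End Transport.

Section StateSums.
Variables (R : realType) (p : nat).
Local Notation C := R[i].
Local Notation N := p.+1.
Variables (root : C -> C) (zeta : C -> C -> C).
Hypothesis oddN : odd N.
Hypothesis hroot : root_choice N root.
Hypothesis hzeta : forall a c : C, c ^+ N - a ^+ N = 1 -> zeta a c != 0.
Variables (n : nat) (I : finType).
Local Notation TT := (@tri_tensor R p root zeta).
Local Notation E := {set 'I_n}.
Local Notation sp := (Defs.space R).

(** The tensor with its indices listed by position relative to the dot instead of by the order of
    the vertices. *)
Definition side_tensor (k : nat) (l l' : weight R) (h k1 k2 k3 : 'I_N) : C :=
  match k with
  | 0 => TT 0 l l' h k1 k2 k3
  | 1 => TT 1 l l' h k2 k3 k1
  | _ => TT 2 l l' h k3 k1 k2
  end.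

Definition tri_weight (tau : LD R n I) (t : I) (h : 'I_N) (c : {ffun E -> 'I_N}) : C :=
  side_tensor (tri_kind (tri tau t)) (w1 tau t) (w2 tau t) h
    (c (side1 (tri tau t))) (c (side2 (tri tau t))) (c (side3 (tri tau t))).

Lemma tri_weightE tau t h c : tri_weight tau t h c =
  TT (tri_kind (tri tau t)) (w1 tau t) (w2 tau t) h (c (inner1 (tri tau t)))
    (c (inner2 (tri tau t))) (c (outer (tri tau t))).
Proof.
by rewrite /tri_weight /inner1 /inner2 /outer; case: (tri_kind _) => [|[|]].
Qed.

(** Besides the diagonals this contains the polygon side joining vertices 0 and n - 1. Summing over
    its index loses nothing, as F^-1 is injective in the multiplicity index and this index
    jointly. *)
Definition outers (tau : LD R n I) : {set E} := [set outer (tri tau t) | t : I].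

Definition gluing (tau : LD R n I) :
    'Hom(sp {ffun I -> 'I_N}, sp {ffun E -> 'I_N}) :=
  lin (fun h : {ffun I -> 'I_N} =>
    finfun (fun k => state_sum (outers tau) (tri_weight tau) h k : C^o) : sp {ffun E -> 'I_N}).

Lemma cf_gluing tau v k :
  cf (gluing tau v) k = \sum_h cf v h * state_sum (outers tau) (tri_weight tau) h k.
Proof.
rewrite /gluing linE; rewrite -> cf_lincomb; apply: eq_bigr => h _; congr (_ * _).
exact: cf_finfun.
Qed.

Lemma cf_gluing_bv tau h k :
  cf (gluing tau (bv R h)) k = state_sum (outers tau) (tri_weight tau) h k.
Proof.
rewrite cf_gluing (bigD1 h) //= cf_bv eqxx mul1r big1 ?addr0// => h' ne.
by rewrite cf_bv (negbTE ne) mul0r.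
Qed.

Lemma side_nonsing (tau : LD R n I) t :
  [/\ nonsing (w1 tau t), nonsing (w2 tau t) & nonsing (w3 tau t)].
Proof. by have [e1 e2 e3] := tri_edges tau t; split; apply: wt_nonsing. Qed.

Lemma gluing_inj (tau : saneLD R n I) : lker (gluing tau) == 0%VS.
Proof.
apply/lker0_inj0 => v gv; apply: cfP => h; rewrite cf0.
pose Th t := TT (tri_kind (tri tau t)) (w1 tau t) (w2 tau t).
have Th_inj t : tensor_inj (Th t).
  have [h1 h2 h3] := side_nonsing tau t.
  by apply: (tri_tensor_inj oddN hroot hzeta) => //; rewrite (ld_sane tau t).
have := state_sum_inj (@inner1_inj _ _ _ tau) (@inner2_inj _ _ _ tau) (@outer_inj _ _ _ tau)
  (@inner12 _ _ _ tau) (@span1 _ _ _ tau) (@span2 _ _ _ tau) Th_inj ord0 (v := cf v).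
apply=> k; have := cf_gluing tau v k; rewrite gv cf0 => /esym e; rewrite -[RHS]e.
apply: eq_bigr => g _; congr (_ * _); apply: eq_bigr => c _; apply: eq_bigr => t _.
by rewrite tri_weightE.
Qed.

Lemma gluing_P (g : {perm I}) (tau tau' : saneLD R n I) : is_P g tau tau' ->
  (gluing tau' \o permI R 'I_N g)%VF = 1 *: gluing tau.
Proof.
case=> _ wE tE; rewrite scale1r; apply: hom_bvP => h; apply: cfP => k.
rewrite comp_lfunE cf_gluing_bv /permI lin_bv cf_gluing_bv.
have oE : outers tau' = outers tau.
  apply/setP => e; apply/imsetP/imsetP => -[t _ ->].
    by exists (g^-1 t)%g => //; rewrite -tE permKV.
  by exists (g t) => //; rewrite tE.
rewrite /state_sum oE; apply: eq_bigr => c _.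
rewrite (reindex_inj (@perm_inj _ g)); apply: eq_bigr => t _ /=.
by rewrite ffunE permK /tri_weight /w1 /w2 tE wE.
Qed.

Lemma side_rotate k l l' : nonsing l -> nonsing l' -> nonsing (wmul l l') -> (k < 3)%N ->
  exists2 c : C, c != 0 & forall h k1 k2 k3,
  \sum_h' opAA_cf root zeta l l' h h' *
     side_tensor ((k + 2) %% 3) l' (wdual (wmul l l')) h' k2 k3 k1 =
  c * side_tensor k l l' h k1 k2 k3.
Proof.
move=> hl hl' hll' k3; have [c c0 cE] := tri_tensor_rotate oddN hroot hzeta hl hl' hll' k3.
by exists c => // h k1 k2 k3'; case: k k3 cE => [|[|[|]]] // _ cE; exact: cE.
Qed.

Lemma local_A (eps : {ffun I -> bool}) (tau tau' : saneLD R n I) t : is_A eps tau tau' ->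
  exists2 c : C, c != 0 & forall h k,
    \sum_x cf ((if eps t then opAA p root zeta (w1 tau t) (w2 tau t)
      else (opAA p root zeta (wdual (w3 tau t)) (w1 tau t))^-1%VF) (bv R h)) x *
      tri_weight tau' t x k = c * tri_weight tau t h k.
Proof.
case=> _ /(_ t); have sane1 := ld_sane tau t; have sane2 := ld_sane tau' t.
have [n1 n2 n3] := side_nonsing tau t; have [n1' n2' n3'] := side_nonsing tau' t.
have kt := tri_kind_lt (tri tau t); have kt' := tri_kind_lt (tri tau' t).
have ccw1 := tri_ccw tau t; have ccw2 := tri_ccw tau' t.
move: sane1 sane2 n1 n2 n3 n1' n2' n3' kt kt' ccw1 ccw2.
rewrite /tri_weight /w1 /w2 /w3; case: (tri tau t) => [[a d] b]; case: (eps t) => /=.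
  move=> sane1 sane2 n1 n2 n3 n1' n2' n3' kt kt' ccw1 ccw2 [tE] [] e1 e2 e3.
  rewrite tE /side1 /side2 /side3 /= in sane1 sane2 n1 n2 n3 n1' n2' n3' kt kt' ccw1 ccw2 e1 e2 e3 *.
  rewrite -sane1 in n3; have [c c0 cE] := side_rotate n1 n2 n3 kt.
  exists c => // h k; rewrite e2 e3 tri_kind_rot// -sane1; exact: cE.
(* For a clockwise move the operator A of the new triangle leads back to the old one, so its
   rotation relation is taken for [tau'] and solved by means of A^-1. *)
move=> sane1 sane2 n1 n2 n3 n1' n2' n3' kt kt' ccw1 ccw2 [tE] [] e1 e2 e3.
rewrite tE /side1 /side2 /side3 /= in sane1 sane2 n1 n2 n3 n1' n2' n3' kt kt' ccw1 ccw2 e1 e2 e3 *.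
rewrite -sane2 in n3'; have [c c0 cE] := side_rotate n1' n2' n3' kt'.
rewrite e1 e2 e3 in sane2 n1' n2' n3' cE *.
have Ai := opAA_inj oddN hroot hzeta n1' n2' n3'.
rewrite sane2 wdualK// in cE.
exists c^-1 => [|h k]; first by rewrite invr_neq0.
rewrite -(tri_kind_rot ccw2) in cE.
set AA := opAA _ _ _ _ _ in Ai *.
set W := side_tensor _ _ _ _ _ _ _.
transitivity (\sum_x \sum_h' c^-1 * (cf (AA^-1%VF (bv R h)) x * (cf (AA (bv R x)) h' *
   side_tensor (tri_kind (a, d, b)) (wt tau [set a; d]) (wt tau [set d; b]) h' (k [set a; d])
     (k [set d; b]) (k [set b; a])))).
  apply: eq_bigr => x _; rewrite -mulr_sumr -mulr_sumr mulrCA; congr (_ * _).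
  by apply: (mulfI c0); rewrite mulVKf// -cE.
rewrite exchange_big /=.
transitivity (\sum_h' c^-1 * ((h' == h)%:R * side_tensor (tri_kind (a, d, b)) (wt tau [set a; d])
   (wt tau [set d; b]) h' (k [set a; d]) (k [set d; b]) (k [set b; a]))).
  apply: eq_bigr => h' _; rewrite -mulr_sumr; congr (_ * _).
  rewrite -cf_bv -[bv R h in RHS](lker0_lfunVK Ai).
  transitivity ((\sum_x cf (AA^-1%VF (bv R h)) x * cf (AA (bv R x)) h') *
    side_tensor (tri_kind (a, d, b)) (wt tau [set a; d])
   (wt tau [set d; b]) h' (k [set a; d]) (k [set d; b]) (k [set b; a])).
    by rewrite mulr_suml; apply: eq_bigr => x _; rewrite mulrA.
  by congr (_ * _); symmetry; exact: cf_hom.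
by rewrite -mulr_sumr sum_delta.
Qed.

Lemma gluing_A (eps : {ffun I -> bool}) (tau tau' : saneLD R n I) : is_A eps tau tau' ->
  exists2 c : C, c != 0 & (gluing tau' \o tensI (fun t =>
      if eps t then opAA p root zeta (w1 tau t) (w2 tau t)
      else (opAA p root zeta (wdual (w3 tau t)) (w1 tau t))^-1%VF))%VF = c *: gluing tau.
Proof.
move=> isA; pose O t : 'End(CN R p) := if eps t then opAA p root zeta (w1 tau t) (w2 tau t)
  else (opAA p root zeta (wdual (w3 tau t)) (w1 tau t))^-1%VF.
change (exists2 c : C, c != 0 & (gluing tau' \o tensI O)%VF = c *: gluing tau).
have /choice[c cE] : forall t, exists c : C, c != 0 /\ forall h k,
    \sum_x cf (O t (bv R h)) x * tri_weight tau' t x k = c * tri_weight tau t h k.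
  by move=> t; have [c c0 cE] := local_A t isA; exists c.
have oE : outers tau' = outers tau.
  apply: eq_imset => t; case: isA => _ /(_ t).
  have := tri_ccw tau t; have := tri_ccw tau' t; case: (tri tau t) => [[a d] b] /=.
  case: (eps t) => c1 c2 [tE _]; rewrite tE /= in c1 *; rewrite /outer.
    have := tri_kind_lt (a, d, b); rewrite (tri_kind_rot c2).
    by case: (tri_kind _) => [|[|[|]]].
  have := tri_kind_lt (b, a, d); rewrite (tri_kind_rot c1).
  by case: (tri_kind _) => [|[|[|]]].
exists (\prod_t c t); first by rewrite prodf_seq_neq0; apply/allP => t _; case: (cE t).
apply: hom_bvP => h; apply: cfP => k.
transitivity ((\prod_t c t) * state_sum (outers tau) (tri_weight tau) h k); last first.
  by rewrite -cf_gluing_bv; symmetry; exact: cf_homZ.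
rewrite comp_lfunE cf_gluing tensI_cf lin_bv.
transitivity (\sum_(h' : {ffun I -> 'I_N}) (\prod_t cf (O t (bv R (h t))) (h' t)) *
    state_sum (outers tau') (tri_weight tau') h' k).
  by apply: eq_bigr => h' _; congr (_ * _); exact: cf_finfun.
rewrite /state_sum mulr_sumr oE.
transitivity (\sum_(k' | agree_off (outers tau) k' k) \sum_(h' : {ffun I -> 'I_N})
    \prod_t (cf (O t (bv R (h t))) (h' t) * tri_weight tau' t (h' t) k')).
  rewrite exchange_big; apply: eq_bigr => h' _ /=; rewrite mulr_sumr.
  by apply: eq_bigr => k' _; rewrite big_split.
apply: eq_bigr => k' _.
rewrite -(bigA_distr_bigA (fun t x => cf (O t (bv R (h t))) x * tri_weight tau' t x k')).
by rewrite -big_split; apply: eq_bigr => t _; case: (cE t).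
Qed.

End StateSums.

(** * Flips of a diagonal *)

Section Quadrilateral.
Variable n : nat.
Implicit Types P : 'I_n.

Lemma ccw_rot P1 P2 P3 : ccw P1 P2 P3 -> ccw P2 P3 P1.
Proof. by rewrite /ccw => /or3P[] ->; rewrite ?orbT. Qed.

Lemma quad_kinds P1 P2 P3 P4 : ccw P1 P2 P3 -> ccw P1 P3 P4 ->
  [\/ [/\ (P1 < P2)%N, (P2 < P3)%N & (P3 < P4)%N],
      [/\ (P4 < P1)%N, (P1 < P2)%N & (P2 < P3)%N],
      [/\ (P3 < P4)%N, (P4 < P1)%N & (P1 < P2)%N] |
      [/\ (P2 < P3)%N, (P3 < P4)%N & (P4 < P1)%N]].
Proof.
rewrite /ccw => /or3P[] /andP[a b] /or3P[] /andP[c d]; try (exfalso; lia).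
- by constructor 1.
- by constructor 2.
- by constructor 4.
- by constructor 3.
Qed.

Lemma quad_nocross (R : realType) (I : finType) (tau : LD R n I) P1 P2 P3 P4 :
  ccw P1 P2 P3 -> ccw P1 P3 P4 ->
  [set P1; P3] \in edges tau -> [set P2; P4] \notin edges tau.
Proof.
move=> c1 c2 e13; apply/negP => e24.
have e31 : [set P3; P1] \in edges tau by rewrite finset.setUC.
have e42 : [set P4; P2] \in edges tau by rewrite finset.setUC.
by case: (quad_kinds c1 c2) => -[a b c];
  [apply: (edge_nocross a b c e13 e24) | apply: (edge_nocross a b c e42 e13)
  | apply: (edge_nocross a b c e31 e42) | apply: (edge_nocross a b c e24 e31)].
Qed.

End Quadrilateral.

Section Flip.
Variables (R : realType) (p : nat).
Local Notation C := R[i].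
Local Notation N := p.+1.
Variables (root : C -> C) (zeta : C -> C -> C).
Hypothesis oddN : odd N.
Hypothesis hroot : root_choice N root.
Hypothesis hzeta : forall a c : C, c ^+ N - a ^+ N = 1 -> zeta a c != 0.
Local Notation ST := (@side_tensor R p root zeta).

Lemma side_flip n (P1 P2 P3 P4 : 'I_n) (l1 l2 l3 : weight R) :
  ccw P1 P2 P3 -> ccw P1 P3 P4 ->
  nonsing l1 -> nonsing l2 -> nonsing l3 -> nonsing (wmul l1 l2) -> nonsing (wmul l2 l3) ->
  nonsing (wmul (wmul l1 l2) l3) ->
  exists2 a : C, a != 0 & forall ht hs k12 k23 k34 k41,
  \sum_c ST (tri_kind (P1, P2, P3)) l1 l2 ht k12 k23 c *
         ST (tri_kind (P1, P3, P4)) (wmul l1 l2) l3 hs c k34 k41 =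
  a * \sum_q mcf (opT p root zeta l1 l2 l3) (hs, ht) q *
    \sum_c ST (tri_kind (P2, P3, P4)) l2 l3 q.1 k23 k34 c *
           ST (tri_kind (P1, P2, P4)) l1 (wmul l2 l3) q.2 k12 c k41.
Proof.
move=> c1 c2 h1 h2 h3 h4 h5 h0; rewrite /tri_kind /=.
have lF (x y : 'I_n) : (x < y)%N -> (y < x)%N = false by lia.
case: (quad_kinds c1 c2) => -[a b c]; have d := ltn_trans a b; have e := ltn_trans b c.
- have f := ltn_trans d c; rewrite a b c d e; exists 1 => [|ht hs k12 k23 k34 k41].
    exact: oner_neq0.
  by rewrite mul1r; exact: flip_0.
- have f := ltn_trans d c.
  rewrite b c (lF _ _ f) (lF _ _ d) e.
  exact: (flip_1 oddN hroot hzeta h1 h2 h3 h4 h5 h0).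
- have f := ltn_trans d c.
  rewrite c (lF _ _ f) (lF _ _ e) (lF _ _ d); exists 1 => [|ht hs k12 k23 k34 k41].
    exact: oner_neq0.
  by rewrite mul1r; exact: (flip_2 oddN hroot hzeta h1 h2 h3 h4 h5 h0).
have f := ltn_trans d c.
rewrite a b (lF _ _ f) (lF _ _ e); exists 1 => [|ht hs k12 k23 k34 k41].
  exact: oner_neq0.
by rewrite mul1r; exact: (flip_3 oddN hroot hzeta h1 h2 h3 h4 h5 h0).
Qed.

(** The segment y from the smallest to the largest vertex of the quadrilateral is an outer side
    before and after the flip; the remaining triangle has the current diagonal as its outer side. *)
Lemma quad_outer n (P1 P2 P3 P4 : 'I_n) : ccw P1 P2 P3 -> ccw P1 P3 P4 ->
  exists y : {set 'I_n},
  [/\ y \in [:: [set P1; P2]; [set P2; P3]; [set P3; P4]; [set P4; P1]],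
      (outer (P1, P2, P3) = [set P1; P3] /\ outer (P1, P3, P4) = y) \/
      (outer (P1, P2, P3) = y /\ outer (P1, P3, P4) = [set P1; P3]) &
      (outer (P2, P3, P4) = [set P2; P4] /\ outer (P1, P2, P4) = y) \/
      (outer (P2, P3, P4) = y /\ outer (P1, P2, P4) = [set P2; P4])].
Proof.
move=> c1 c2; rewrite /outer /tri_kind /side1 /side2 /side3 /=.
have lF (x y : 'I_n) : (x < y)%N -> (y < x)%N = false by lia.
case: (quad_kinds c1 c2) => -[a b c]; have d := ltn_trans a b; have e := ltn_trans b c;
  have f := ltn_trans d c; rewrite ?a ?b ?c ?d ?e ?f ?(lF _ _ a) ?(lF _ _ b) ?(lF _ _ c)
    ?(lF _ _ d) ?(lF _ _ e) ?(lF _ _ f).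
- exists [set P4; P1]; split; first by rewrite !inE eqxx !orbT.
    by left; split; rewrite // finset.setUC.
  by left; split; rewrite // finset.setUC.
- exists [set P3; P4]; split; first by rewrite !inE eqxx !orbT.
    by left; split; rewrite // finset.setUC.
  by right.
- exists [set P2; P3]; split; first by rewrite !inE eqxx !orbT.
    by right.
  by right.
exists [set P1; P2]; split; first by rewrite !inE eqxx.
  by right.
by left; split; rewrite // finset.setUC.
Qed.

Lemma gluing_T n (I : finType) (s t : I) (tau tau' : saneLD R n I) : is_T s t tau tau' ->
  exists2 c : C, c != 0 & (gluing p root zeta tau' \o
    at2 s t (opT p root zeta (w1 tau t) (w2 tau t) (w2 tau s)))%VF = c *: gluing p root zeta tau.
Proof.
case=> P1 [P2 [P3 [P4 [[tE sE] [sE' tE'] uE _ wE]]]].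
have c1 : ccw P1 P2 P3 by have := tri_ccw tau t; rewrite tE.
have c2 : ccw P1 P3 P4 by have := tri_ccw tau s; rewrite sE.
have st : s != t.
  apply/eqP => st; move: c1; rewrite -st sE in tE; case: tE => -> _; rewrite /ccw; lia.
set x0 := [set P1; P3]; set x1 := [set P2; P4].
have [et1 et2 et3] := tri_edges tau t; have [es1 es2 es3] := tri_edges tau s.
have [et1' et2' et3'] := tri_edges tau' t; have [es1' es2' es3'] := tri_edges tau' s.
rewrite tE sE tE' sE' /side1 /side2 /side3 /= in et1 et2 et3 es1 es2 es3 et1' et2' et3' es1' es2' es3'.
have x1n : x1 \notin edges tau by exact: (quad_nocross c1 c2).
have c1' : ccw P2 P3 P4 by have := tri_ccw tau' s; rewrite sE'.
have c2' : ccw P2 P4 P1 by apply: ccw_rot; have := tri_ccw tau' t; rewrite tE'.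
(* Read from P2 on, the quadrilateral of [tau'] has the diagonal x1, and x0 is now the one that
   crosses it. *)
have x0n : x0 \notin edges tau'.
  by rewrite /x0 finset.setUC; apply: (quad_nocross c1' c2').
have ne0 e : e \in edges tau' -> e != x0 by move=> h; apply: contraNneq x0n => <-.
have ne1 e : e \in edges tau -> e != x1 by move=> h; apply: contraNneq x1n => <-.
have wE' e : e \in edges tau -> e \in edges tau' -> wt tau' e = wt tau e.
  by move=> h h'; apply: wE; [apply: ne0 | apply: ne1].
have x31 : [set P3; P1] = x0 by rewrite finset.setUC.
have x42 : [set P4; P2] = x1 by rewrite finset.setUC.
have sane_t := ld_sane tau t; have sane_s := ld_sane tau s; have sane_s' := ld_sane tau' s.
have [n1 n2 n4] := side_nonsing tau t; have [_ n3 n0] := side_nonsing tau s.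
have [_ _ n5] := side_nonsing tau' s.
pose l1 := w1 tau t; pose l2 := w2 tau t; pose l3 := w2 tau s.
have w12 : wt tau [set P1; P2] = l1 by rewrite /l1 /w1 tE.
have w23 : wt tau [set P2; P3] = l2 by rewrite /l2 /w2 tE.
have w34 : wt tau [set P3; P4] = l3 by rewrite /l3 /w2 sE.
have w13 : wt tau x0 = wmul l1 l2 by rewrite /l1 /l2 sane_t /w3 tE /side3 /= x31.
have w24 : wt tau' x1 = wmul l2 l3.
  rewrite -x42 -w23 -w34 -(wE' _ et2 es1') -(wE' _ es2 es2').
  by have := sane_s'; rewrite /w1 /w2 /w3 sE' => <-.
have m4 : nonsing (wmul l1 l2) by rewrite /l1 /l2 sane_t.
have m5 : nonsing (wmul l2 l3) by rewrite -w24 -x42; move: n5; rewrite /w3 sE'.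
have m0 : nonsing (wmul (wmul l1 l2) l3).
  by rewrite -w13; have := sane_s; rewrite /w1 sE /side1 /= -/x0 -/l3 => ->.
have [a a0 aE] := side_flip c1 c2 n1 n2 n3 m4 m5 m0.
(* [side_flip] expresses the old sum by the new one, whereas the relation required here runs the
   other way. *)
exists a^-1; first by rewrite invr_neq0.
pose W := @tri_weight R p root zeta n I tau; pose W' := @tri_weight R p root zeta n I tau'.
have Wu u : u != s -> u != t -> forall h (c : {ffun {set 'I_n} -> 'I_N}) x, W u h (upd1 c x0 x) = W u h c.
  move=> us ut h c x; have [e1 e2 e3] := tri_edges tau' u; rewrite uE// in e1 e2 e3.
  rewrite /W /tri_weight.
  by rewrite (upd1_neq _ _ (ne0 _ e1)) (upd1_neq _ _ (ne0 _ e2)) (upd1_neq _ _ (ne0 _ e3)).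
have Wu' u : u != s -> u != t -> forall h (c : {ffun {set 'I_n} -> 'I_N}) x, W' u h (upd1 c x1 x) = W u h c.
  move=> us ut h c x; have [e1 e2 e3] := tri_edges tau u.
  have [e1' e2' e3'] := tri_edges tau' u; rewrite uE// in e1' e2' e3'.
  rewrite /W' /W /tri_weight /w1 /w2 uE// (wE' _ e1 e1') (wE' _ e2 e2').
  by rewrite (upd1_neq _ _ (ne1 _ e1)) (upd1_neq _ _ (ne1 _ e2)) (upd1_neq _ _ (ne1 _ e3)).
have local hs ht (c : {ffun {set 'I_n} -> 'I_N}) :
    \sum_x W t ht (upd1 c x0 x) * W s hs (upd1 c x0 x) =
    a * \sum_q mcf (opT p root zeta l1 l2 l3) (hs, ht) q *
      \sum_x W' s q.1 (upd1 c x1 x) * W' t q.2 (upd1 c x1 x).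
  have := aE ht hs (c [set P1; P2]) (c [set P2; P3]) (c [set P3; P4]) (c [set P4; P1]).
  rewrite /W /W' /tri_weight /w1 /w2 tE sE tE' sE' /side1 /side2 /side3 /= -/x0 -/x1 x31 x42.
  rewrite w12 w23 w34 w13 w24 (wE' _ et2 es1') (wE' _ es2 es2') (wE' _ et1 et1') w12 w23 w34 => e.
  transitivity (\sum_c0 ST (tri_kind (P1, P2, P3)) l1 l2 ht (c [set P1; P2]) (c [set P2; P3]) c0 *
     ST (tri_kind (P1, P3, P4)) (wmul l1 l2) l3 hs c0 (c [set P3; P4]) (c [set P4; P1])).
    apply: eq_bigr => x _; rewrite !upd1_eq.
    rewrite (upd1_neq _ _ (ne0 _ et1')) (upd1_neq _ _ (ne0 _ es1')).
    by rewrite (upd1_neq _ _ (ne0 _ es2')) (upd1_neq _ _ (ne0 _ et3')).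
  rewrite e; congr (_ * _); apply: eq_bigr => q _; congr (_ * _); apply: eq_bigr => x _.
  rewrite !upd1_eq (upd1_neq _ _ (ne1 _ et1)) (upd1_neq _ _ (ne1 _ et2)).
  by rewrite (upd1_neq _ _ (ne1 _ es2)) (upd1_neq _ _ (ne1 _ es3)).
have [y [yin yo yo']] := quad_outer c1 c2.
have [y0 y1] : y != x0 /\ y != x1.
  by move: yin; rewrite !inE => /or4P[] /eqP ->; rewrite ne0// ne1.
rewrite -/x0 -/x1 -tE -sE -tE' -sE' in yo yo'.
have x0D : x0 \in outers tau.
  by apply/imsetP; case: yo => -[e1 e2]; [exists t | exists s].
have x1D' : x1 \in outers tau'.
  by apply/imsetP; case: yo' => -[e1 e2]; [exists s | exists t].
have yD : y \in outers tau.
  by apply/imsetP; case: yo => -[e1 e2]; [exists s | exists t].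
have yD' : y \in outers tau'.
  by apply/imsetP; case: yo' => -[e1 e2]; [exists t | exists s].
have out2 u : (u == s) || (u == t) -> outer (tri tau u) = x0 \/ outer (tri tau u) = y.
  by case/orP => /eqP ->; case: yo => -[e1 e2]; auto.
have out2' u : (u == s) || (u == t) -> outer (tri tau' u) = x1 \/ outer (tri tau' u) = y.
  by case/orP => /eqP ->; case: yo' => -[e1 e2]; auto.
(* Outside the quadrilateral the triangles are unchanged; inside it y stays and the diagonals are
   exchanged. *)
have DD : outers tau :\ x0 = outers tau' :\ x1.
  apply/setP => e; apply/setD1P/setD1P => [[ex /imsetP[u _ eu]]|[ex /imsetP[u _ eu]]].
    have [ust|] := boolP ((u == s) || (u == t)).
      by case: (out2 u ust) => h; move: ex; rewrite eu h ?eqxx// => _.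
    rewrite negb_or => /andP[us ut]; split; last by apply/imsetP; exists u; rewrite // uE.
    by rewrite eu; have [_ _ h] := inner_edges tau u; exact: ne1.
  have [ust|] := boolP ((u == s) || (u == t)).
    by case: (out2' u ust) => h; move: ex; rewrite eu h ?eqxx// => _.
  rewrite negb_or => /andP[us ut]; split; last by apply/imsetP; exists u; rewrite // -uE.
  by rewrite eu; have [_ _ h] := inner_edges tau' u; exact: ne0.
have key h k := state_sum_flip st x0D x1D' DD Wu Wu' local h k.
apply: hom_bvP => h; apply: cfP => k.
transitivity (a^-1 * state_sum (outers tau) W h k); last first.
  by rewrite -cf_gluing_bv; symmetry; exact: cf_homZ.
rewrite comp_lfunE (at2_lin s t) lin_bv key mulKf// linear_sum.
transitivity (\sum_q cf (gluing p root zeta tau' (cf (opT p root zeta (w1 tau t) (w2 tau t) (w2 tau s)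
  (bv R (h s, h t))) q *: bv R (upd2 s t h q))) k); first exact: cf_sum.
apply: eq_bigr => q _; rewrite linearZ /=.
transitivity (mcf (opT p root zeta l1 l2 l3) (h s, h t) q *
  cf (gluing p root zeta tau' (bv R (upd2 s t h q))) k); first exact: cfZ.
by rewrite cf_gluing_bv.
Qed.

Lemma gluing_elementary n (I : finType) (m : elementary I) (tau tau' : saneLD R n I) :
  is_elementary m tau tau' ->
  exists2 c : C, c != 0 & (gluing p root zeta tau' \o
    (elementary_op p root zeta m tau tau' : 'End(Defs.space R {ffun I -> 'I_N})))%VF =
    c *: gluing p root zeta tau.
Proof.
case: m => [eps|s t|g] /= h; [exact: gluing_A | exact: gluing_T |].
by exists 1; [exact: oner_neq0 | exact: gluing_P].
Qed.

Lemma gluing_seq n (I : finType) (tau tau' : saneLD R n I) (s : sane_seq tau tau') :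
  exists2 c : C, c != 0 & (gluing p root zeta tau' \o
    (seq_op p root zeta s : 'End(Defs.space R {ffun I -> 'I_N})))%VF = c *: gluing p root zeta tau.
Proof.
elim: s => [|m tau1 tau2 s [c c0 cE] h|m tau1 tau2 s [c c0 cE] h] /=.
- by exists 1; [exact: oner_neq0 | rewrite scale1r; exact: comp_lfun1r].
- have [c' c'0 cE'] := gluing_elementary h.
  by exists (c' * c); [exact: mulf_neq0 | exact: transport_comp cE cE'].
have [c' c'0 cE'] := gluing_elementary h.
exists (c'^-1 * c); first by rewrite mulf_neq0 ?invr_neq0.
apply: transport_comp cE _; apply: transport_inv cE' => //.
exact: (gluing_inj oddN hroot hzeta).
Qed.

End Flip.

Theorem theorem5p19 (R : realType) (p : nat) (oddN : odd p.+1)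
  (root : R[i] -> R[i]) (hroot : root_choice p.+1 root)
  (zeta : R[i] -> R[i] -> R[i])
  (hzeta : forall a c : R[i], c ^+ p.+1 - a ^+ p.+1 = 1 -> zeta a c != 0)
  (n : nat) (hn : (3 <= n)%N) (I : finType) (hI : #|I| = (n - 2)%N) :
  (forall (tau tau' : saneLD R n I) (s s' : sane_seq tau tau'),
      proj_eq (seq_op p root zeta s) (seq_op p root zeta s')) /\
  exists F1 : forall tau tau' : saneLD R n I,
      sane_mor tau tau' -> 'Hom(obj_space p tau, obj_space p tau'),
    projective_functor F1 /\
    forall (tau tau' : saneLD R n I) (s : sane_seq tau tau'),
      proj_eq (F1 tau tau' (inhabits s)) (seq_op p root zeta s).
Proof.
have inj tau := @gluing_inj R p root zeta oddN hroot hzeta n I tau.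
have comp tau tau' s := @gluing_seq R p root zeta oddN hroot hzeta n I tau tau' s.
have uniq (tau tau' : saneLD R n I) (s s' : sane_seq tau tau') :
    proj_eq (seq_op p root zeta s) (seq_op p root zeta s').
  have [c c0 cE] := comp _ _ s; have [c' c'0 cE'] := comp _ _ s'.
  exact: (transport_unique (inj tau') c0 c'0 cE cE').
split=> //.
(* A morphism only asserts that a sequence exists, so one is selected by choice. By [uniq] the
   selection matters only up to a scalar; for an identity it is compared with the empty sequence. *)
have pick (tau tau' : saneLD R n I) (u : sane_mor tau tau') : exists s : sane_seq tau tau', True.
  by case: u => s; exists s.
exists (fun tau tau' u => seq_op p root zeta (projT1 (cid (pick tau tau' u)))).
split; last by move=> tau tau' s; exact: uniq.
split=> [tau u|tau1 tau2 tau3 u v w]; first exact: (uniq _ _ _ (seq_nil tau)).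
have [c c0 cE] := comp _ _ (projT1 (cid (pick _ _ w))).
have [c1 c10 cE1] := comp _ _ (projT1 (cid (pick _ _ u))).
have [c2 c20 cE2] := comp _ _ (projT1 (cid (pick _ _ v))).
exact: (transport_unique (inj tau3) c0 (mulf_neq0 c20 c10) cE (transport_comp cE1 cE2)).
Qed.
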